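(* The dual space of $H^1(\mathbb B)$ is $BMOA(\mathbb B)$, with respect to the pairing of $H^2(\mathbb B)$. That is: for every $b\in BMOA(\mathbb B)$ the functional $\Lambda_b(h)=\langle h,b\rangle_{H^2(\mathbb B)}$, defined on polynomials $h$, extends to a bounded linear functional on $H^1(\mathbb B)$; and conversely, for every bounded linear functional $L$ on $H^1(\mathbb B)$ there is $b\in BMOA(\mathbb B)$ such that $L$ is the extension of $\Lambda_b$, i.e. $L(h)=\langle h,b\rangle_{H^2(\mathbb B)}$ for every polynomial $h$.
   Context: $\mathbb H$ is the skew-field of quaternions, $\mathbb B=\{q\in\mathbb H:|q|<1\}$, $\mathbb S=\{q\in\mathbb H:q^2=-1\}$. Vector spaces over $\mathbb H$ have scalars on the right; linear functionals are right-linear and $\mathbb H$-valued. Regular functions on $\mathbb B$ are the functions $f(q)=\sum_{n\ge0}q^na_n$, $a_n\in\mathbb H$, with power series converging in $\mathbb B$; polynomials are those with finitely many nonzero $a_n$. For a polynomial $h=\sum q^nh_n$ and a regular $b=\sum q^nb_n$, $\langle h,b\rangle_{H^2(\mathbb B)}=\sum_n\overline{b_n}h_n$. $H^1(\mathbb B)$ is the space of regular $f$ on $\mathbb B$ with $\|f\|_{H^1(\mathbb B)}=\sup_{I\in\mathbb S}\sup_{0<r<1}\frac1{2\pi}\int_{-\pi}^{\pi}|f(re^{I\theta})|d\theta<\infty$; such $f$ have radial limits $f(e^{I\theta})$ for a.e. $\theta$, for every $I\in\mathbb S$. For $f\in H^1(\mathbb B)$, $I\in\mathbb S$ and an interval $a\subset\mathbb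 R$ with length $|a|\le2\pi$, put $f_{I,a}=\frac1{|a|}\int_af(e^{\theta I})d\theta$. $BMOA(\mathbb B)$ is the set of $f\in H^1(\mathbb B)$ with $\sup_{I\in\mathbb S}\sup_{a}\frac1{|a|}\int_a|f(e^{\theta I})-f_{I,a}|d\theta<\infty$ (inner supremum over all such intervals $a$). *)

(* Defs.v *)
From HB Require Import structures.
From mathcomp Require Import all_boot all_order all_algebra.
From mathcomp Require Import all_classical all_reals all_analysis.
From mathcomp Require Import ring lra.

Set Implicit Arguments.
Unset Strict Implicit.
Unset Printing Implicit Defensive.
Import Order.TTheory GRing.Theory Num.Theory.
Import numFieldNormedType.Exports.

Local Open Scope classical_set_scope.
Local Open Scope ring_scope.

(* [Quat a b c d] is a + b i + c j + d k. *)
Record quat (R : realType) : Type :=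
  Quat { q1 : R ; qi : R ; qj : R ; qk : R }.

Section QuatAlgebra.
Variable R : realType.
Implicit Types p q r : quat R.

Definition quat_tuple q : R * R * R * R := (q1 q, qi q, qj q, qk q).
Definition tuple_quat (t : R * R * R * R) : quat R :=
  let: (a, b, c, d) := t in Quat a b c d.
Lemma quat_tupleK : cancel quat_tuple tuple_quat. Proof. by case. Qed.

HB.instance Definition _ := Choice.copy (quat R) (can_type quat_tupleK).

Lemma quatP p q :
  q1 p = q1 q -> qi p = qi q -> qj p = qj q -> qk p = qk q -> p = q.
Proof. by case: p => ????; case: q => ???? /= -> -> -> ->. Qed.

Definition addq p q :=
  Quat (q1 p + q1 q) (qi p + qi q) (qj p + qj q) (qk p + qk q).
Definition oppq p := Quat (- q1 p) (- qi p) (- qj p) (- qk p).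
Definition mulq p q := Quat
  (q1 p * q1 q - qi p * qi q - qj p * qj q - qk p * qk q)
  (q1 p * qi q + qi p * q1 q + qj p * qk q - qk p * qj q)
  (q1 p * qj q - qi p * qk q + qj p * q1 q + qk p * qi q)
  (q1 p * qk q + qi p * qj q - qj p * qi q + qk p * q1 q).
Definition scaleq (t : R) p := Quat (t * q1 p) (t * qi p) (t * qj p) (t * qk p).
Definition conjq p := Quat (q1 p) (- qi p) (- qj p) (- qk p).
Definition normq p :=
  Num.sqrt (q1 p ^+ 2 + qi p ^+ 2 + qj p ^+ 2 + qk p ^+ 2).

Local Ltac quat_ring := move=> *; apply: quatP => /=; ring.

Fact addqA : associative addq. Proof. quat_ring. Qed.
Fact addqC : commutative addq. Proof. quat_ring. Qed.
Fact add0q : left_id (Quat 0 0 0 0) addq. Proof. quat_ring. Qed.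
Fact addNq : left_inverse (Quat 0 0 0 0) oppq addq. Proof. quat_ring. Qed.

HB.instance Definition _ := GRing.isZmodule.Build (quat R) addqA addqC add0q addNq.

Fact mulqA : associative mulq. Proof. quat_ring. Qed.
Fact mul1q : left_id (Quat 1 0 0 0) mulq. Proof. quat_ring. Qed.
Fact mulq1 : right_id (Quat 1 0 0 0) mulq. Proof. quat_ring. Qed.
Fact mulqDl : left_distributive mulq +%R. Proof. quat_ring. Qed.
Fact mulqDr : right_distributive mulq +%R. Proof. quat_ring. Qed.
Fact oneq_neq0 : Quat 1 0 0 0 != 0 :> quat R.
Proof. by apply/eqP => -[] /eqP; rewrite oner_eq0. Qed.

HB.instance Definition _ := GRing.Zmodule_isNzRing.Build (quat R)
  mulqA mul1q mulq1 mulqDl mulqDr oneq_neq0.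

Fact scaleqA a b p : scaleq a (scaleq b p) = scaleq (a * b) p.
Proof. quat_ring. Qed.
Fact scale1q : left_id 1 scaleq. Proof. quat_ring. Qed.
Fact scaleqDr : right_distributive scaleq +%R. Proof. quat_ring. Qed.
Fact scaleqDl p : {morph scaleq^~ p : a b / a + b}. Proof. quat_ring. Qed.

HB.instance Definition _ := GRing.Zmodule_isLmodule.Build R (quat R)
  scaleqA scale1q scaleqDr scaleqDl.

Fact scaleqAl (a : R) p q : a *: (p * q) = (a *: p) * q. Proof. quat_ring. Qed.
Fact scaleqAr (a : R) p q : a *: (p * q) = p * (a *: q). Proof. quat_ring. Qed.

HB.instance Definition _ := GRing.Lmodule_isLalgebra.Build R (quat R) scaleqAl.
HB.instance Definition _ := GRing.Lalgebra_isAlgebra.Build R (quat R) scaleqAr.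

Let sqnormq_ge0 p : 0 <= q1 p ^+ 2 + qi p ^+ 2 + qj p ^+ 2 + qk p ^+ 2.
Proof. by rewrite !addr_ge0 ?sqr_ge0. Qed.

Fact ler_normqD p q : normq (p + q) <= normq p + normq q.
Proof.
have := sqrtr_ge0 (q1 p ^+ 2 + qi p ^+ 2 + qj p ^+ 2 + qk p ^+ 2).
have := sqrtr_ge0 (q1 q ^+ 2 + qi q ^+ 2 + qj q ^+ 2 + qk q ^+ 2).
have := sqr_sqrtr (sqnormq_ge0 p); have := sqr_sqrtr (sqnormq_ge0 q).
rewrite -!/(normq _); set x := normq q; set y := normq p => hx hy x0 y0.
rewrite -[leRHS]ger0_norm ?addr_ge0// -sqrtr_sqr ler_wsqrtr//=.
rewrite [leRHS]sqrrD hx hy.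
have xy : q1 p * q1 q + qi p * qi q + qj p * qj q + qk p * qk q <= y * x.
  apply: le_trans (ler_norm _) _.
  rewrite -[leRHS]ger0_norm ?mulr_ge0// -ler_sqr ?nnegrE// !real_normK ?num_real//.
  rewrite exprMn hx hy -subr_ge0.
  rewrite [leRHS](_ : _ =
    (q1 p * qi q - qi p * q1 q) ^+ 2 + (q1 p * qj q - qj p * q1 q) ^+ 2 +
    (q1 p * qk q - qk p * q1 q) ^+ 2 + (qi p * qj q - qj p * qi q) ^+ 2 +
    (qi p * qk q - qk p * qi q) ^+ 2 + (qj p * qk q - qk p * qj q) ^+ 2); last by ring.
  by rewrite !addr_ge0 ?sqr_ge0.
move: xy; rewrite mulr2n; nra.
Qed.

Fact normqZ (a : R) p : normq (a *: p) = `|a| * normq p.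
Proof.
rewrite -sqrtr_sqr -sqrtrM ?sqr_ge0//; congr Num.sqrt => /=; ring.
Qed.

Fact normq0_eq0 p : normq p = 0 -> p = 0.
Proof.
move=> /eqP; rewrite sqrtr_eq0 => h.
by apply: quatP => /=; nra.
Qed.

HB.instance Definition _ := Lmodule_isNormed.Build R (quat R)
  ler_normqD normqZ normq0_eq0.

Lemma normqE p :
  `|p| = Num.sqrt (q1 p ^+ 2 + qi p ^+ 2 + qj p ^+ 2 + qk p ^+ 2).
Proof. by []. Qed.

Lemma normqM p q : `|p * q| = `|p| * `|q|.
Proof. rewrite !normqE -sqrtrM//; congr Num.sqrt => /=; ring. Qed.

Lemma normq1 : `|1 : quat R| = 1.
Proof. by rewrite normqE -[RHS]sqrtr1; congr Num.sqrt => /=; ring. Qed.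

End QuatAlgebra.

Section HardyBMOA.
Variable R : realType.
Local Notation H := (quat R).
Implicit Types (f g b : H -> H) (q I : H) (L : (H -> H) -> H).

Definition imag_units : set H := [set I | I ^+ 2 = -1].

Definition expI I (t : R) : H := (cos t)%:A + sin t *: I.

(* A function on the open unit ball is represented by a function on all of
   the quaternions; every notion below only looks at its values on the ball. *)
Definition has_expansion f (a : nat -> H) : Prop :=
  forall q, `|q| < 1 -> series (fun n => q ^+ n * a n) @ \oo --> f q.

Definition regular f : Prop := exists a, has_expansion f a.

(* This is unambiguous for regular functions: see [has_expansion_inj]. *)
Definition coef f : nat -> H := get (has_expansion f).

(* [p.[q]] would put the coefficients on the left of the powers of q. *)
Definition poly_fun (h : {poly H}) : H -> H :=
  fun q => \sum_(n < size h) q ^+ n * h`_n.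

Definition H2_pairing (h : {poly H}) b : H :=
  \sum_(n < size h) conjq (coef b n) * h`_n.

Definition circle_mean f I (r : R) : \bar R :=
  (((2 * pi)^-1)%:E *
   \int[lebesgue_measure]_(t in `[(- pi)%R, pi]) (`|f (r *: expI I t)|)%:E)%E.

Definition H1_norm f : \bar R :=
  ereal_sup [set circle_mean f p.1 p.2 | p in imag_units `*` `]0, 1[].

Definition in_H1 f : Prop := regular f /\ (H1_norm f < +oo)%E.

(* The radial limit f(e^{It}); on the null set of t where the limit does not
   exist this is an arbitrary constant. *)
Definition bdry f I (t : R) : H := lim (f (r *: expI I t) @[r --> 1^'-]).

Definition qRintegral (D : set R) (F : R -> H) : H :=
  Quat (\int[lebesgue_measure]_(t in D) q1 (F t))
       (\int[lebesgue_measure]_(t in D) qi (F t))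
       (\int[lebesgue_measure]_(t in D) qj (F t))
       (\int[lebesgue_measure]_(t in D) qk (F t)).

Definition mean f I (u v : R) : H :=
  (v - u)^-1 *: qRintegral `[u, v] (bdry f I).

Definition mean_osc f I (u v : R) : \bar R :=
  (((v - u)^-1)%:E *
   \int[lebesgue_measure]_(t in `[u, v]) (`|bdry f I t - mean f I u v|)%:E)%E.

Definition bmo_seminorm f : \bar R := ereal_sup
  [set s | exists I u v,
     [/\ imag_units I, u < v, v - u <= 2 * pi & s = mean_osc f I u v]].

Definition BMOA f : Prop := in_H1 f /\ (bmo_seminorm f < +oo)%E.

(* Only the restriction of L to H^1 matters.  The two conditions force L f = L g
   whenever f and g are in H^1 and agree on the ball, so that L is a functional
   on functions on the ball: see [bounded_right_linear_ext]. *)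
Definition bounded_right_linear L : Prop :=
  (forall f g (c : H), in_H1 f -> in_H1 g ->
     L (fun q => f q * c + g q) = L f * c + L g) /\
  (exists C : R, forall f, in_H1 f -> (`|L f|%:E <= C%:E * H1_norm f)%E).

Lemma has_expansion_inj f : is_subset1 (has_expansion f).
Proof.
move=> a a' fa fa'; apply/funext => k; apply/eqP; rewrite -subr_eq0; apply/eqP.
pose c n := a n - a' n; rewrite -/(c k).
have c0 (x : R) : `|x| < 1 -> series (fun n => x ^+ n *: c n) @ \oo --> (0 : H).
  move=> x1; have q1 : `|x%:A : H| < 1 by rewrite normrZ normq1 mulr1.
  rewrite -(subrr (f x%:A)).
  rewrite (_ : series _ = series (fun n => x%:A ^+ n * a n) -
                          series (fun n => x%:A ^+ n * a' n)).
    by apply: cvgB; [exact: fa|exact: fa'].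
  apply/funext => n; rewrite /series /= fctE -sumrB; apply: eq_bigr => i _.
  by rewrite -mulrBr exprZn expr1n -scalerAl mul1r.
have [M M0 cM] : exists2 M : R, 0 <= M & forall n, `|c n| <= M * 2 ^+ n.
  have h : `|2^-1 : R| < 1 by rewrite gtr0_norm; lra.
  have /cvgP/cvg_series_cvg_0/cvgP/cvg_seq_bounded := c0 _ h.
  move=> /pinfty_ex_gt0[M M0 bM]; exists M; first exact: ltW.
  move=> n; have := bM n I; rewrite /= normrZ ger0_norm ?exprn_ge0//.
  by rewrite exprVn ler_pdivrMl ?exprn_gt0// mulrC.
elim/ltn_ind: k => k IH.
have geo (y : R) m j : 0 <= y <= 2^-1 ->
    \sum_(m <= n < m + j) y ^+ n <= 2 * (y ^+ m - y ^+ (m + j)).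
  move=> /andP[y0 y1]; elim: j => [|j IHj].
    by rewrite addn0 big_geq// subrr mulr0.
  rewrite addnS big_nat_recr ?leq_addr//= exprSr.
  have := exprn_ge0 (m + j) y0; move: IHj; move: (_ ^+ (m + j)) => z; nra.
have ck (x : R) : 0 < x <= 4^-1 -> `|c k| <= (4 * M * 2 ^+ k) * x.
  move=> /andP[x0 x1].
  have y01 : 0 <= 2 * x <= 2^-1 by lra.
  have h : `|x| < 1 by rewrite gtr0_norm; lra.
  suff : x ^+ k * `|c k| <= M * (2 * (2 * x) ^+ k.+1).
    rewrite exprMn !exprSr [leRHS](_ : _ = x ^+ k * (4 * M * 2 ^+ k * x)).
      by rewrite ler_pM2l ?exprn_gt0.
    by ring.
  apply/ler_addgt0Pl => e e0.
  have /cvgrPdist_lt/(_ e e0)[N _ SN] := c0 _ h.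
  have := SN (k.+1 + N)%N (leq_addl _ _).
  rewrite sub0r normrN /series/= => /ltW hN.
  have eS : \sum_(0 <= n < k.+1 + N) x ^+ n *: c n =
      x ^+ k *: c k + \sum_(k.+1 <= n < k.+1 + N) x ^+ n *: c n.
    rewrite (@big_cat_nat _ _ _ k.+1)//= ?leq_addr// big_nat_recr//=.
    rewrite big_nat_cond big1 ?add0r// => n /andP[/andP[_ nk] _].
    by rewrite [c n]IH// scaler0.
  have -> : x ^+ k * `|c k| = `|x ^+ k *: c k|.
    by rewrite normrZ ger0_norm// exprn_ge0// ltW.
  have -> : x ^+ k *: c k = \sum_(0 <= n < k.+1 + N) x ^+ n *: c n -
      \sum_(k.+1 <= n < k.+1 + N) x ^+ n *: c n by rewrite eS addrK.
  apply: le_trans (ler_normB _ _) _; rewrite lerD//.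
  apply: le_trans (ler_norm_sum _ _ _) _.
  apply: (@le_trans _ _ (\sum_(k.+1 <= n < k.+1 + N) M * (2 * x) ^+ n)).
    apply: ler_sum => n _; rewrite normrZ ger0_norm ?exprn_ge0 ?(ltW x0)//.
    by rewrite exprMn mulrCA mulrA mulrC ler_pM2r ?exprn_gt0// mulrC cM.
  rewrite -mulr_sumr ler_wpM2l//; apply: le_trans (geo _ _ _ y01) _.
  by rewrite ler_pM2l// gerBl exprn_ge0//; case/andP: y01.
apply/eqP; rewrite -normr_le0; apply/ler_addgt0Pl => e e0; rewrite addr0.
pose D := 4 * M * 2 ^+ k.
have D0 : 0 <= D by rewrite !mulr_ge0// exprn_ge0.
pose x := Num.min 4^-1 (e / (D + 1)).
have x0 : 0 < x by rewrite lt_min divr_gt0//; lra.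
have xl : x <= 4^-1 by rewrite ge_min lexx.
apply: le_trans (ck x _) _; first by rewrite x0.
have : x <= e / (D + 1) by rewrite ge_min lexx orbT.
rewrite ler_pdivlMr -/D; last lra.
nra.
Qed.

Lemma normq_expI I (t : R) : imag_units I -> `|expI I t| = 1.
Proof.
case: I => a b c d [/= h1 h2 h3 h4].
rewrite normqE -[RHS]sqrtr1; congr Num.sqrt => /=.
have := cos2Dsin2 t; move: (cos t) (sin t) => x y xy.
have a0 : a = 0 by nra.
rewrite a0 in h1 *; nra.
Qed.

Lemma bounded_right_linear_ext L f g : bounded_right_linear L ->
  in_H1 f -> in_H1 g -> (forall q, `|q| < 1 -> f q = g q) -> L f = L g.
Proof.
move=> [Llin [C LC]] f1 g1 fg.
pose h : H -> H := fun q => f q * (-1) + g q.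
have h0 q : `|q| < 1 -> h q = 0.
  by move=> /fg; rewrite /h => ->; rewrite mulrN1 addNr.
have hm I (r : R) : imag_units I -> 0 < r < 1 -> circle_mean h I r = 0%E.
  move=> I1 /andP[r0 r1]; rewrite /circle_mean integral0_eq ?mule0// => t _.
  by rewrite h0 ?normr0// normrZ normq_expI// mulr1 gtr0_norm.
have hn : H1_norm h = 0%E.
  apply/eqP; rewrite eq_le; apply/andP; split.
    apply: ge_ereal_sup => _ [[I r] [/= I1 r01] <-].
    by rewrite hm//; move: r01; rewrite in_itv.
  have i1 : imag_units (Quat 0 1 0 0 : H) by apply: quatP => /=; ring.
  apply: ereal_sup_ubound => /=; exists (Quat 0 1 0 0, 2^-1) => /=.
    by split => //=; rewrite in_itv/=; apply/andP; split; lra.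
  by apply: hm => //; apply/andP; split; lra.
have h1 : in_H1 h.
  split; last by rewrite hn.
  exists (fun=> 0) => q q1; rewrite h0//.
  rewrite (_ : series _ = cst 0); first exact: cvg_cst.
  by apply/funext => n; rewrite /series/= big1// => i _; rewrite mulr0.
have := LC _ h1; rewrite hn mule0 lee_fin normr_le0 Llin// => /eqP.
by rewrite mulrN1 addrC => /eqP; rewrite subr_eq0 => /eqP.
Qed.

End HardyBMOA.

(* Main.v *)
(** If [L] is bounded on [H^1], let [b] have the coefficients conj (L z^n).
Testing [L] on [z G(z) / (1 - rho z)], where [G] is the difference quotient of
[b] at a point of the disc, bounds the Poisson average of [|b - b(z)|^2]
uniformly in [z]; this is Garsia's form of bounded mean oscillation.

Conversely, a function of bounded mean oscillation satisfies Garsia's bound by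
the John-Nirenberg inequality.  For complex polynomials [F], [u], [v], with [P]
the Poisson extension from the circle, put [t = 1 - (P(|F|^2) - |F|^2)], which
lies in [0, 1] when Garsia's bound is normalized, and let
[D = P(uv conj F) - uv conj F].  For unimodular [omega] the function
[(t^2 + t + 6)(|u|^2 + |v|^2) + 2 Re (omega D)] has nonnegative Laplacian;
comparing its value at the centre with its mean on the circle gives
[|<uv, F>| <= C (|u|_2^2 + |v|_2^2)].  Since a polynomial [h] factors
approximately on the circle as [uv] with [|u|^2 = |v|^2 = |h|], this is
the bound [|<h, F>| <= C |h|_1].  Fejer averages reduce a general [b] to
polynomials, and the functional is extended from polynomials to [H^1] as an
ultrafilter limit of the pairings of dilates. *)

(* Pointwise multiplication of quaternionic power series does not give power series, so
   factorization is carried out over the complex numbers: on the slice of [i] a quaternion is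
   written z + w j, and one quaternionic pairing becomes four complex ones. For test polynomials, a
   bound on one slice extends to all slices with a factor 2, because values on a slice are affine in
   its imaginary unit.

   The oscillation condition on [b] concerns almost everywhere boundary values and says nothing
   directly about partial sums. The bridge is boundary values, then dilates, then Fejer means. That
   dilates converge to the boundary values in mean rests on writing each complex component of a
   function in H^1 as a product of two square-summable series.

   In the weight t^2 + t + 6, the quadratic term yields 2 |dt|^2 (|u|^2 + |v|^2), which completes
   the square against the cross terms between dt and u', v'; the linear term keeps |F'|^2 (|u|^2 +
   |v|^2) available where t = 0; the constant pays for |u'|^2 + |v'|^2. The function is a polynomial
   in z and conj z, so its Laplacian is a formal derivative and circle means are averages over roots
   of unity. *)
Require Import Defs.
From HB Require Import structures.
From mathcomp Require Import all_boot all_order all_algebra.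
From mathcomp Require Import all_classical all_reals all_analysis.
From mathcomp Require Import measurable_realfun.
From mathcomp Require Import complex polyXY polyrcf.
From mathcomp Require Import ring lra.

Set Implicit Arguments.
Unset Strict Implicit.
Unset Printing Implicit Defensive.
Import Order.TTheory GRing.Theory Num.Theory.
Import numFieldNormedType.Exports.

Local Open Scope classical_set_scope.
Local Open Scope ring_scope.

(** * Integrals of continuous functions *)

Section ContinuousIntegral.
Context {R : realType}.
Local Notation mu := (@lebesgue_measure R).
Implicit Types (f g : R -> R) (a b c k : R).

Definition itg a b f : R := \int[mu]_(t in `[a, b]) f t.

Lemma ctsD (T : topologicalType) (f g : T -> R) :
  continuous f -> continuous g -> continuous (fun t => f t + g t).
Proof. by move=> cf cg x; apply: cvgD; [exact: cf|exact: cg]. Qed.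

Lemma ctsM (T : topologicalType) (f g : T -> R) :
  continuous f -> continuous g -> continuous (fun t => f t * g t).
Proof. by move=> cf cg x; apply: cvgM; [exact: cf|exact: cg]. Qed.

Lemma ctsN (T : topologicalType) (f : T -> R) :
  continuous f -> continuous (fun t => - f t).
Proof. by move=> cf x; apply: cvgN; exact: cf. Qed.

Lemma ctsB (T : topologicalType) (f g : T -> R) :
  continuous f -> continuous g -> continuous (fun t => f t - g t).
Proof. by move=> cf cg; apply: ctsD => //; exact: ctsN. Qed.

Lemma cts_cst (T : topologicalType) k : continuous (fun _ : T => k).
Proof. by move=> x; exact: cvg_cst. Qed.

Lemma cts_comp (T : topologicalType) (f : R -> R) (g : T -> R) :
  continuous f -> continuous g -> continuous (fun t => f (g t)).
Proof. by move=> cf cg x; apply: continuous_comp; [exact: cg|exact: cf]. Qed.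

Lemma cts_sum (T : topologicalType) (I : Type) (r : seq I) (P : pred I) (F : I -> T -> R) :
  (forall i, continuous (F i)) ->
  continuous (fun t => \sum_(i <- r | P i) F i t).
Proof.
move=> cF; elim: r => [|i r IH].
  by under eq_fun do rewrite big_nil; exact: cts_cst.
under eq_fun do rewrite big_cons.
by case: (P i); [apply: ctsD => //; exact: cF|exact: IH].
Qed.

Lemma cts_id : continuous (fun t : R => t).
Proof. by move=> x; exact: cvg_id. Qed.

Lemma cts_exp (T : topologicalType) (f : T -> R) n :
  continuous f -> continuous (fun t => f t ^+ n).
Proof.
move=> cf; elim: n => [|n IH].
  by under eq_fun do rewrite expr0; exact: cts_cst.
by under eq_fun do rewrite exprS; exact: ctsM.
Qed.

Lemma cts_norm (T : topologicalType) (f : T -> R) :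
  continuous f -> continuous (fun t => `|f t|).
Proof. by move=> cf x; apply: cvg_norm; exact: cf. Qed.

Lemma itg_integrable f a b : continuous f -> mu.-integrable `[a, b] (EFin \o f).
Proof.
move=> cf; apply: continuous_compact_integrable; first exact: segment_compact.
exact: continuous_subspaceT.
Qed.

Lemma eq_itg a b f g : (forall t, a <= t <= b -> f t = g t) -> itg a b f = itg a b g.
Proof. by move=> fg; apply: eq_Rintegral => t; rewrite inE/= in_itv/= => /fg. Qed.

Lemma itgE f a b : continuous f ->
  (\int[mu]_(t in `[a, b]) (f t)%:E)%E = (itg a b f)%:E.
Proof.
move=> cf; rewrite /itg /Rintegral fineK//; apply: integrable_fin_num => //.
exact: itg_integrable.
Qed.

Lemma itgD f g a b : continuous f -> continuous g ->
  itg a b (fun t => f t + g t) = itg a b f + itg a b g.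
Proof. by move=> cf cg; rewrite /itg RintegralD//; exact: itg_integrable. Qed.

Lemma itgB f g a b : continuous f -> continuous g ->
  itg a b (fun t => f t - g t) = itg a b f - itg a b g.
Proof. by move=> cf cg; rewrite /itg RintegralB//; exact: itg_integrable. Qed.

Lemma itgZ k f a b : continuous f -> itg a b (fun t => k * f t) = k * itg a b f.
Proof. by move=> cf; rewrite /itg RintegralZl//; exact: itg_integrable. Qed.

Lemma itg_cst k a b : a <= b -> itg a b (fun=> k) = k * (b - a).
Proof.
move=> ab; rewrite /itg Rintegral_cst//= lebesgue_measure_itv/= lte_fin.
have [/=|ba] := ltP a b; first by [].
have -> : a = b by apply/eqP; rewrite eq_le ab.
by rewrite subrr.
Qed.

Lemma itg_sum (I : Type) (r : seq I) (P : pred I) (F : I -> R -> R) a b :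
  (forall i, continuous (F i)) ->
  itg a b (fun t => \sum_(i <- r | P i) F i t) = \sum_(i <- r | P i) itg a b (F i).
Proof.
move=> cF; elim: r => [|i r IH].
  rewrite big_nil; under eq_itg do rewrite big_nil.
  by rewrite /itg Rintegral_cst// mul0r.
rewrite big_cons; under eq_itg do rewrite big_cons.
case: (P i) => //; have cS := @cts_sum _ I r P F cF.
by rewrite itgD ?IH.
Qed.

Lemma le_itg f g a b : continuous f -> continuous g ->
  (forall t, a <= t <= b -> f t <= g t) -> itg a b f <= itg a b g.
Proof.
move=> cf cg fg; by apply: le_Rintegral => //; exact: itg_integrable.
Qed.

Lemma itg_ge0 f a b : (forall t, a <= t <= b -> 0 <= f t) -> 0 <= itg a b f.
Proof. by move=> f0; apply: Rintegral_ge0 => t /=; rewrite in_itv/= => /f0. Qed.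

Lemma itg_norm f a b : continuous f -> `|itg a b f| <= itg a b (fun t => `|f t|).
Proof. by move=> cf; apply: le_normr_Rintegral => //; exact: itg_integrable. Qed.

Lemma itg_cat c f a b : continuous f -> a <= c <= b ->
  itg a b f = itg a c f + itg c b f.
Proof.
move=> cf /andP[ac cb]; apply/eqP; rewrite addrC -subr_eq; apply/eqP.
rewrite /itg Rintegral_itvB ?bnd_simp//; last exact: itg_integrable.
rewrite Rintegral_itv_obnd_cbnd//.
apply: integrableS (itg_integrable c b cf) => //.
by apply: subset_itvr; rewrite bnd_simp.
Qed.

Lemma itg_FTC (F f : R -> R) a b : a <= b -> continuous f ->
  (forall x : R, is_derive x 1 F (f x)) -> itg a b f = F b - F a.
Proof.
rewrite le_eqVlt => /orP[/eqP ->|ab] cf dF.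
  by rewrite subrr /itg set_itv1 Rintegral_set1.
have cF x : F y @[y --> x] --> F x.
  by apply/differentiable_continuous/derivable1_diffP; apply: ex_derive.
apply: EFin_inj; rewrite EFinB -itgE// (@continuous_FTC2 R f F a b ab)//.
- exact: continuous_subspaceT.
- split; first by move=> x _; apply: ex_derive.
  + exact: cvg_at_right_filter.
  + exact: cvg_at_left_filter.
- by move=> x _; rewrite derive1E derive_val.
Qed.

Lemma itg_shift c f a b : a <= b -> continuous f ->
  itg (a + c) (b + c) f = itg a b (fun t => f (t + c)).
Proof.
move=> ab cf; rewrite /itg /Rintegral; congr fine.
have dF (x : R) : is_derive x 1 (fun t => t + c) (1 : R) := is_derive_shift x 1 c.
have eF : (fun t : R => t + c)^`()%classic = cst (1 : R).
  by apply/funext => x; rewrite derive1E derive_val.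
rewrite (@integration_by_substitution_increasing R (fun t => t + c) f a b ab).
- by rewrite eF; apply: eq_integral => t _ /=; rewrite fctE mulr1.
- by move=> x y _ _; rewrite ltrD2r.
- by rewrite eF => x _; exact: cvg_cst.
- by rewrite eF; exact: is_cvg_cst.
- by rewrite eF; exact: is_cvg_cst.
- have cF : continuous (fun t : R => t + c) by apply: ctsD; [exact: cts_id|exact: cts_cst].
  split; first by move=> x _; apply: ex_derive.
  + exact/cvg_at_right_filter/cF.
  + exact/cvg_at_left_filter/cF.
- exact: continuous_subspaceT.
Qed.

Lemma cts_cos (T : topologicalType) (f : T -> R) :
  continuous f -> continuous (fun t => cos (f t)).
Proof. by apply: cts_comp; exact: continuous_cos. Qed.

Lemma cts_sin (T : topologicalType) (f : T -> R) :
  continuous f -> continuous (fun t => sin (f t)).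
Proof. by apply: cts_comp; exact: continuous_sin. Qed.

Lemma cts_affine (n : nat) k : continuous (fun t : R => n%:R * t + k).
Proof.
by apply: ctsD; [apply: ctsM; [exact: cts_cst|exact: cts_id]|exact: cts_cst].
Qed.

Lemma cosD2pin x n : cos (x + n%:R * (2 * pi)) = cos x :> R.
Proof.
have := periodicn (@cosD2pi R) n x.
by rewrite -[pi *+ 2 *+ n]mulr_natl -[pi *+ 2]mulr_natl.
Qed.

Lemma sinD2pin x n : sin (x + n%:R * (2 * pi)) = sin x :> R.
Proof.
have := periodicn (@sinD2pi R) n x.
by rewrite -[pi *+ 2 *+ n]mulr_natl -[pi *+ 2]mulr_natl.
Qed.

Lemma itg_cos_period n a k : (0 < n)%N ->
  itg a (a + 2 * pi) (fun t => cos (n%:R * t + k)) = 0.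
Proof.
move=> n0; have nn0 : n%:R != 0 :> R by rewrite pnatr_eq0 -lt0n.
pose F t := n%:R^-1 * sin (n%:R * t + k).
have dF (x : R) : is_derive x 1 F (cos (n%:R * x + k)).
  have h1 : is_derive x (1 : R) (fun t : R => n%:R * t + k) n%:R.
    have := is_deriveD (is_deriveZ n%:R (is_derive_id x (1 : R))) (is_derive_cst k x 1).
    by rewrite addr0 /GRing.scale/= mulr1.
  have h2 := @is_derive1_comp _ sin (fun t : R => n%:R * t + k) x _ _ (is_derive_sin _) h1.
  have := is_deriveZ (n%:R^-1) h2.
  by rewrite /GRing.scale/= mulrC -mulrA mulfV// mulr1.
rewrite (@itg_FTC F (fun t => cos (n%:R * t + k)))//.
- rewrite /F [X in sin X](_ : _ = (n%:R * a + k) + n%:R * (2 * pi)); last ring.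
  by rewrite sinD2pin subrr.
- by have := @pi_gt0 R; lra.
- exact/cts_cos/cts_affine.
Qed.

(** The factor kills the case [n = 0], where the integrand sin k is constant and its integral need
    not vanish. Otherwise the sine is a cosine shifted by pi/2. *)
Lemma itg_sin_period n a k :
  itg a (a + 2 * pi) (fun t => sin (n%:R * t + k) * (n != 0)%N%:R) = 0.
Proof.
case: n => [|n] /=.
  under eq_itg do rewrite mulr0.
  by rewrite /itg Rintegral_cst// mul0r.
rewrite -(@itg_cos_period n.+1 a (k - pi / 2))//.
by apply: eq_itg => t _; rewrite mulr1 addrA cosBpihalf.
Qed.

End ContinuousIntegral.

(** * The Poisson kernel *)

Section PoissonKernel.
Context {R : realType}.
Implicit Types (f g : R -> R) (r : R).

Lemma sin_ge_xcosx (x : R) : 0 <= x <= pi -> x * cos x <= sin x.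
Proof.
move=> /andP[x0 xp].
have dF (y : R) : is_derive y (1 : R) (fun t : R => sin t - t * cos t) (y * sin y).
  have h := is_deriveM (is_derive_id y (1 : R)) (is_derive_cos y).
  have -> : y * sin y = cos y - (y *: (- sin y) + cos y *: 1) by rewrite /GRing.scale/=; ring.
  exact: is_deriveB (is_derive_sin y) h.
have := itg_FTC x0 _ dF; rewrite sin0 mul0r !subrr !subr0 => h.
rewrite -subr_ge0 -h; last first.
  by apply: ctsM; [exact: cts_id|exact: continuous_sin].
apply: itg_ge0 => t /andP[t0 tx]; rewrite mulr_ge0// sin_ge0_pi// t0/=; lra.
Qed.

Lemma sin_lex (x : R) : 0 <= x -> sin x <= x.
Proof.
move=> x0.
have dF (y : R) : is_derive y (1 : R) (fun t : R => t - sin t) (1 - cos y).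
  by have := is_deriveB (is_derive_id y (1 : R)) (is_derive_sin y).
have := itg_FTC x0 _ dF; rewrite sin0 !subr0 => h.
rewrite -subr_ge0 -h; last first.
  by apply: ctsB; [exact: cts_cst|exact: continuous_cos].
by apply: itg_ge0 => t _; rewrite subr_ge0 cos_le1.
Qed.

Lemma onem_cosE (t : R) : 1 - cos t = 2 * sin (t / 2) ^+ 2.
Proof.
rewrite -{1}[t](_ : (t / 2) *+ 2 = t); last by rewrite -mulr_natr; field.
rewrite cos_mulr2n mulr2n cos2sin2; ring.
Qed.

(** With u = |t|, sin(u/4) is at least (u/4) cos(u/4) and 2 cos(u/4)^2 = 1 + cos(u/2) is at least 1,
    so sin(u/2) = 2 sin(u/4) cos(u/4) is at least u/4. Then 1 - cos u = 2 sin(u/2)^2. *)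
Lemma onem_cos_ge (t : R) : `|t| <= pi -> t ^+ 2 / 8 <= 1 - cos t.
Proof.
move=> tp; rewrite -cos_norm -real_normK ?num_real//.
have := normr_ge0 t; move: `|t| tp => u up u0.
have pi0 := @pi_gt0 R.
have c0 : 0 <= cos (u / 2) by apply: cos_ge0_pihalf; apply/andP; split; lra.
have hs : sin (u / 2) = 2 * (sin (u / 4) * cos (u / 4)).
  rewrite -[u / 2](_ : (u / 4) *+ 2 = _); last by rewrite -mulr_natr; field.
  by rewrite sin_mulr2n -mulr_natl; ring.
have hc : cos (u / 2) = 2 * cos (u / 4) ^+ 2 - 1.
  rewrite -[u / 2](_ : (u / 4) *+ 2 = _); last by rewrite -mulr_natr; field.
  by rewrite cos_mulr2n -mulr_natl; ring.
have h4 : u / 4 * cos (u / 4) <= sin (u / 4).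
  by apply: sin_ge_xcosx; apply/andP; split; lra.
have c4 : 0 <= cos (u / 4) by apply: cos_ge0_pihalf; apply/andP; split; lra.
have : u / 4 <= sin (u / 2).
  rewrite hs; have : u / 4 * cos (u / 4) * cos (u / 4) <= sin (u / 4) * cos (u / 4).
    by rewrite ler_wpM2r.
  have : 1 <= 2 * cos (u / 4) ^+ 2 by lra.
  rewrite expr2; nra.
rewrite onem_cosE; set s := sin _ => us; nra.
Qed.

Lemma onem_cos_le (t : R) : 1 - cos t <= t ^+ 2 / 2.
Proof.
rewrite -cos_norm -[t ^+ 2]real_normK ?num_real//; set u := `|t|.
have u0 : 0 <= u / 2 by rewrite divr_ge0// /u.
rewrite onem_cosE; have := sin_lex u0; have := sin_lex u0.
have [s0|s0] := leP 0 (sin (u / 2)); first by move: (sin _) s0 => s s0; nra.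
have := sin_geN1 (u / 2).
have [u2|u2] := leP (u / 2) pi.
  by have := @sin_ge0_pi R (u / 2); rewrite u0 u2 => /(_ isT); rewrite leNgt s0.
have := @pi_ge2 R; move: (sin _) s0 => s; nra.
Qed.

(** Normalized to have integral 2 pi over a period. The denominator is |1 - r e^(it)|^2,
    equivalently |e^(it) - r|^2. *)
Definition poisson (r t : R) : R := (1 - r ^+ 2) / (1 - 2 * r * cos t + r ^+ 2).

Lemma poisson_denE r t :
  1 - 2 * r * cos t + r ^+ 2 = (1 - r) ^+ 2 + 2 * r * (1 - cos t) :> R.
Proof. ring. Qed.

Lemma poisson_den_gt0 r (t : R) : 0 <= r < 1 -> 0 < 1 - 2 * r * cos t + r ^+ 2.
Proof.
move=> /andP[r0 r1]; rewrite poisson_denE; have := cos_le1 t; move: (cos t) => c; nra.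
Qed.

Lemma poisson_ge0 r t : 0 <= r < 1 -> 0 <= poisson r t.
Proof.
move=> r01; rewrite /poisson divr_ge0 ?(ltW (poisson_den_gt0 t r01))//.
by move: r01 => /andP[r0 r1]; nra.
Qed.

Lemma cts_poisson r : 0 <= r < 1 -> continuous (poisson r).
Proof.
move=> r01 t; apply: cvgM; first exact: cvg_cst.
apply: cvgV; first by rewrite gt_eqF// poisson_den_gt0.
have : continuous (fun t => 1 - 2 * r * cos t + r ^+ 2); last exact.
apply: ctsD; last exact: cts_cst.
apply: ctsB; first exact: cts_cst.
by apply: ctsM; [exact: cts_cst|exact: continuous_cos].
Qed.

Lemma poisson_le_center r t : 0 <= r < 1 -> poisson r t <= 2 / (1 - r).
Proof.
move=> r01; have d0 := poisson_den_gt0 t r01; move: r01 => /andP[r0 r1].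
rewrite ler_pdivrMr// mulrAC ler_pdivlMr; last lra.
rewrite poisson_denE; have := cos_le1 t; move: (cos t) => c c1.
have : 0 <= r * (1 - c) by rewrite mulr_ge0// subr_ge0.
have : 0 <= (1 - r) ^+ 2 * (1 - r) by rewrite mulr_ge0 ?sqr_ge0//; lra.
lra.
Qed.

Lemma poisson_le_tail r t : 2^-1 <= r < 1 -> 0 < `|t| <= pi ->
  poisson r t <= 16 * (1 - r) / t ^+ 2.
Proof.
move=> /andP[r0 r1] /andP[t0 tp]; have r01 : 0 <= r < 1 by apply/andP; split; lra.
have d0 := poisson_den_gt0 t r01.
have t2 : 0 < t ^+ 2 by rewrite exprn_even_gt0//= -normr_gt0.
rewrite ler_pdivrMr// mulrAC ler_pdivlMr//.
have h := onem_cos_ge tp; rewrite poisson_denE.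
have : t ^+ 2 / 8 <= (1 - r) ^+ 2 + 2 * r * (1 - cos t).
  move: (t ^+ 2) t2 h => u u0; move: (cos t) => c h; nra.
move: (_ + _) (t ^+ 2) t2 => d u u0 du.
have : (1 - r) * u <= (1 - r) * (8 * d) by rewrite ler_wpM2l; lra.
have : (1 - r ^+ 2) * u <= 2 * (1 - r) * u by rewrite ler_wpM2r; nra.
lra.
Qed.

(** The denominator is at most d^2/16 + d^2 = (17/16) d^2, and the numerator (d/4)(1 + r) is at
    least d/4. Distance d/4 to the circle keeps the radius positive for all arcs up to the full
    circle, as pi < 4. *)
Lemma poisson_ge (d r t : R) : 0 < d -> r = 1 - d / 4 -> 0 <= r -> `|t| <= d ->
  4 / (17 * d) <= poisson r t.
Proof.
move=> d0 re r0 td; have r01 : 0 <= r < 1 by apply/andP; split; lra.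
have D0 := poisson_den_gt0 t r01.
rewrite /poisson ler_pdivlMr// mulrAC ler_pdivrMr; last lra.
have h := onem_cos_le t; rewrite poisson_denE.
have t2 : t ^+ 2 <= d ^+ 2 by rewrite -[t ^+ 2]real_normK ?num_real// lerXn2r ?nnegrE// ltW.
have : (1 - r) ^+ 2 + 2 * r * (1 - cos t) <= 17 / 16 * d ^+ 2.
  have c1 := cos_le1 t.
  have : r * (1 - cos t) <= 1 - cos t by rewrite ler_piMl; lra.
  move: (cos t) (t ^+ 2) c1 h t2 => c u c1 h t2 h2.
  have -> : (1 - r) ^+ 2 = d ^+ 2 / 16 by rewrite re; field.
  lra.
have : 1 - r ^+ 2 = d / 4 * (1 + r) by rewrite re; field.
move=> ->; nra.
Qed.

Definition poisson_sum (r t : R) N := 1 + 2 * \sum_(m < N) r ^+ m.+1 * cos (m.+1%:R * t).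

(** The product telescopes because 2 cos t cos(mt) = cos((m+1)t) + cos((m-1)t), leaving only the end
    terms. *)
Lemma poisson_sumE r (t : R) N :
  (1 - 2 * r * cos t + r ^+ 2) * poisson_sum r t N =
  1 - r ^+ 2 - 2 * r ^+ N.+1 * cos (N.+1%:R * t) + 2 * r ^+ N.+2 * cos (N%:R * t).
Proof.
rewrite /poisson_sum; elim: N => [|N IH].
  by rewrite big_ord0 mul0r cos0 mul1r !exprS expr0; ring.
rewrite big_ord_recr/=; set S := \sum_(m < N) _ in IH *; set x := _ ^+ _ * cos _.
have -> : 1 + 2 * (S + x) = (1 + 2 * S) + 2 * x by ring.
rewrite mulrDr IH {}/x.
have -> : N.+2%:R * t = N.+1%:R * t + t by rewrite -[N.+2]addn1 natrD; ring.
have -> : N%:R * t = N.+1%:R * t - t by rewrite -[N.+1]addn1 natrD; ring.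
rewrite (cosD (N.+1%:R * t) t) (cosB (N.+1%:R * t) t) !exprS; ring.
Qed.

Lemma cts_poisson_sum r N : continuous (fun t => poisson_sum r t N).
Proof.
apply: ctsD; first exact: cts_cst.
apply: ctsM; first exact: cts_cst.
apply: cts_sum => m; apply: ctsM; first exact: cts_cst.
apply: cts_cos; apply: ctsM; [exact: cts_cst|exact: cts_id].
Qed.

Lemma poisson_sum_err r (t : R) N : 0 <= r < 1 ->
  `|poisson r t - poisson_sum r t N| <= 4 * r ^+ N / (1 - r) ^+ 2.
Proof.
move=> r01; have d0 := poisson_den_gt0 t r01.
have dr : (1 - r) ^+ 2 <= 1 - 2 * r * cos t + r ^+ 2.
  rewrite poisson_denE lerDl mulr_ge0 ?subr_ge0 ?cos_le1//.
  by move: r01 => /andP[r0 _]; lra.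
have -> : poisson r t - poisson_sum r t N =
  (2 * r ^+ N.+1 * cos (N.+1%:R * t) - 2 * r ^+ N.+2 * cos (N%:R * t)) /
   (1 - 2 * r * cos t + r ^+ 2).
  apply: (mulIf (lt0r_neq0 d0)); rewrite divfK ?gt_eqF//.
  rewrite mulrBl {1}/poisson divfK ?gt_eqF//.
  rewrite [poisson_sum _ _ _ * _]mulrC poisson_sumE; ring.
have rN : 0 <= r ^+ N <= 1 by move: r01 => /andP[r0 r1]; rewrite exprn_ge0//= exprn_ile1// ltW.
move: r01 => /andP[r0 r1].
rewrite normrM normfV (gtr0_norm d0) ler_pM// ?invr_ge0 ?(ltW d0)//.
  rewrite !exprS; move: (r ^+ N) rN => x /andP[x0 x1].
  apply: le_trans (ler_normB _ _) _.
  have h (a : R) y : 0 <= a -> a <= 2 * x -> `|a * cos y| <= 2 * x.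
    move=> a0 ax; rewrite normrM (ger0_norm a0) (le_trans _ ax)// ler_piMr//.
    exact: cos_max.
  rewrite [leRHS](_ : _ = 2 * x + 2 * x); last ring.
  have rx : r * x <= x by rewrite ler_piMl// ltW.
  have rx0 : 0 <= r * x by rewrite mulr_ge0.
  have rrx : r * (r * x) <= r * x by rewrite ler_piMl// ltW.
  have rrx0 : 0 <= r * (r * x) by rewrite mulr_ge0.
  by apply: lerD; apply: h; lra.
by rewrite lef_pV2 ?posrE// exprn_gt0// subr_gt0.
Qed.

Local Notation circ := (itg (- pi) pi).

Lemma circ_cos n (k : R) : circ (fun t => cos (n%:R * t + k)) = (n == 0)%N%:R * (2 * pi * cos k).
Proof.
have pi0 := @pi_gt0 R.
case: n => [|n].
  under eq_itg do rewrite mul0r add0r.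
  by rewrite itg_cst/=; [rewrite mul1r; ring|lra].
have := @itg_cos_period R n.+1 (- pi) k isT.
by rewrite (_ : - pi + 2 * pi = pi) ?mul0r//; ring.
Qed.

Lemma circ_coscos m n (k : R) : (0 < m)%N ->
  circ (fun t => cos (m%:R * t) * cos (n%:R * t + k)) = (m == n)%:R * (pi * cos k).
Proof.
move=> m0.
have e t : cos (m%:R * t) * cos (n%:R * t + k) = 2^-1 * cos ((m + n)%:R * t + k) +
    2^-1 * cos (n%:R * t - m%:R * t + k).
  have -> : (m + n)%:R * t + k = (n%:R * t + k) + m%:R * t by rewrite natrD; ring.
  have -> : n%:R * t - m%:R * t + k = (n%:R * t + k) - m%:R * t by ring.
  by rewrite (cosD (n%:R * t + k) (m%:R * t)) (cosB (n%:R * t + k) (m%:R * t)); field.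
have c2 : continuous (fun t : R => cos (n%:R * t - m%:R * t + k)).
  apply: cts_cos; apply: ctsD; last exact: cts_cst.
  by apply: ctsB; apply: ctsM; [exact: cts_cst|exact: cts_id|exact: cts_cst|exact: cts_id].
under eq_itg do rewrite e.
have c1 : continuous (fun t : R => cos ((m + n)%:R * t + k)).
  exact/cts_cos/cts_affine.
rewrite itgD; try by apply: ctsM => //; exact: cts_cst.
rewrite !itgZ// circ_cos addn_eq0 (gtn_eqF m0)/= mul0r mulr0 add0r.
have [mn|mn|mn] := ltngtP m n; last 1 first.
- rewrite mn; under eq_itg do rewrite subrr add0r.
  by rewrite itg_cst; [rewrite mul1r; field|have := @pi_gt0 R; lra].
- under eq_itg do rewrite -mulrBl -natrB ?(ltnW mn)//.
  by rewrite circ_cos subn_eq0 leqNgt mn/= !mul0r mulr0.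
- under eq_itg => t _.
    have -> : n%:R * t - m%:R * t + k = - ((m - n)%:R * t + (- k)).
      by rewrite natrB ?(ltnW mn)//; ring.
    rewrite cosN; over.
  by rewrite circ_cos subn_eq0 leqNgt mn/= !mul0r mulr0.
Qed.

(** The cosine expansion enters only through partial sums: orthogonality evaluates the integral
    exactly once [n <= N], and the error of [poisson_sum] is uniform in the angle and tends to 0. *)
Lemma poisson_cos r n (k : R) : 0 <= r < 1 ->
  circ (fun t => poisson r t * cos (n%:R * t + k)) = 2 * pi * (r ^+ n * cos k).
Proof.
move=> r01; have pi0 := @pi_gt0 R.
have ck : continuous (fun t : R => cos (n%:R * t + k)) by exact/cts_cos/cts_affine.
have hN N : (n <= N)%N ->
    circ (fun t => poisson_sum r t N * cos (n%:R * t + k)) = 2 * pi * (r ^+ n * cos k).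
  move=> nN.
  have cF m : continuous (fun t : R => cos (m.+1%:R * t) * cos (n%:R * t + k)).
    apply: ctsM => //; apply: cts_cos; apply: ctsM; [exact: cts_cst|exact: cts_id].
  have cF2 (m : 'I_N) : continuous (fun t : R =>
      2 * r ^+ m.+1 * (cos (m.+1%:R * t) * cos (n%:R * t + k))).
    by apply: ctsM => //; exact: cts_cst.
  have e t : poisson_sum r t N * cos (n%:R * t + k) = cos (n%:R * t + k) +
     \sum_(m < N) 2 * r ^+ m.+1 * (cos (m.+1%:R * t) * cos (n%:R * t + k)).
    rewrite /poisson_sum mulrDl mul1r; congr (_ + _).
    rewrite mulr_sumr mulr_suml; apply: eq_bigr => m _; ring.
  under eq_itg do rewrite e.
  rewrite itgD//; last exact: cts_sum.
  rewrite itg_sum//.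
  under eq_bigr do rewrite itgZ// circ_coscos//.
  rewrite circ_cos.
  case: n nN {ck cF cF2 e} => [|n] nN.
    rewrite big1 ?expr0/=; first ring.
    by move=> m _; rewrite mul0r mulr0.
  rewrite (bigD1 (Ordinal nN))//= eqxx big1/=; first ring.
  move=> m /negbTE; rewrite -val_eqE/= => mn.
  by rewrite eqSS mn mul0r mulr0.
have cP := cts_poisson r01.
apply/eqP; rewrite -subr_eq0 -normr_le0; apply/ler_addgt0Pl => e e0; rewrite addr0.
have [N nN Ne] : exists2 N, (n <= N)%N & 2 * pi * (4 * r ^+ N / (1 - r) ^+ 2) <= e.
  have r1 : `|r| < 1 by move: r01 => /andP[r0 r1]; rewrite ger0_norm.
  have /cvgrPdist_le := cvg_expr r1.
  have d0 : 0 < e * (1 - r) ^+ 2 / (8 * pi).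
    rewrite divr_gt0 ?mulr_gt0 ?exprn_gt0//; move: r01 => /andP[r0 r2]; lra.
  move=> /(_ _ d0)[N _ hN']; exists (N + n)%N; first exact: leq_addl.
  have := hN' (N + n)%N (leq_addr _ _); rewrite sub0r normrN.
  rewrite ler_pdivlMr ?mulr_gt0// => h.
  have q0 : 0 < (1 - r) ^+ 2 by rewrite exprn_gt0//; move: r01 => /andP[r0 r2]; lra.
  rewrite mulrA ler_pdivrMr//; apply: le_trans h.
  apply: (@le_trans _ _ (r ^+ (N + n) * (8 * pi))); first by rewrite le_eqVlt; apply/orP; left; apply/eqP; ring.
  by rewrite ler_wpM2r ?ler_norm// mulr_ge0// ltW.
rewrite -(hN _ nN) -itgB; try by apply: ctsM => //; exact: cts_poisson_sum.
apply: le_trans (itg_norm _ _ _) _.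
  by apply: ctsB; apply: ctsM => //; exact: cts_poisson_sum.
apply: le_trans Ne.
have -> : 2 * pi * (4 * r ^+ N / (1 - r) ^+ 2) = circ (fun=> 4 * r ^+ N / (1 - r) ^+ 2).
  by rewrite itg_cst; [ring|lra].
apply: le_itg.
- by apply: cts_norm; apply: ctsB; apply: ctsM => //; exact: cts_poisson_sum.
- exact: cts_cst.
- move=> t _; rewrite -mulrBl normrM -[leRHS]mulr1 ler_pM ?poisson_sum_err//.
  exact: cos_max.
Qed.

Lemma dyadic_scale r : 0 <= r < 1 -> exists n, 1 - r <= 2^-1 ^+ n <= 2 * (1 - r).
Proof.
move=> /andP[r0 r1].
have ex : exists n, (2^-1 : R) ^+ n < 1 - r.
  have h : `|2^-1 : R| < 1 by rewrite gtr0_norm; lra.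
  have /cvgrPdist_lt/(_ (1 - r)) := cvg_expr h.
  rewrite subr_gt0 => /(_ r1)[N _ hN]; exists N; have := hN N (leqnn _).
  by rewrite /= sub0r normrN ger0_norm// exprn_ge0.
have [n hn nmin] := ex_minnP ex.
case: n hn nmin => [|n] hn nmin; first by move: hn; rewrite expr0; lra.
exists n; apply/andP; split; last by move: hn; rewrite exprS; lra.
by rewrite leNgt; apply/negP => /nmin; rewrite ltnn.
Qed.

(** Shells are peeled off from the outside. On the shell between pi 2^-(k+1) and pi 2^-k the tail
    bound 16 (1 - r) / t^2 is at most 16 * 2^k * 2^-(n-k), using pi^2 >= 4; on the innermost window
    the bound 2 / (1 - r) is at most 4 * 2^n. *)
Lemma poisson_dyadic r n g : 0 <= r < 1 -> 1 - r <= 2^-1 ^+ n <= 2 * (1 - r) ->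
  continuous g -> (forall t, 0 <= g t) ->
  circ (fun t => poisson r t * g t) <=
  16 * \sum_(k < n.+1) 2 ^+ k * 2^-1 ^+ (n - k) *
      itg (- (pi * 2^-1 ^+ k)) (pi * 2^-1 ^+ k) g.
Proof.
move=> r01 /andP[rn nr] cg g0; have pi0 := @pi_gt0 R; have pi2 := @pi_ge2 R.
have cPg : continuous (fun t => poisson r t * g t) by apply: ctsM => //; exact: cts_poisson.
pose d k : R := pi * 2^-1 ^+ k.
have d0 k : 0 < d k by rewrite mulr_gt0// exprn_gt0.
have dS k : d k = 2 * d k.+1 by rewrite /d exprS; field.
have step m : (m <= n)%N -> circ (fun t => poisson r t * g t) <=
    16 * \sum_(k < m) 2 ^+ k * 2^-1 ^+ (n - k) * itg (- d k) (d k) g +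
    itg (- d m) (d m) (fun t => poisson r t * g t).
  elim: m => [|m IH] mn.
    by rewrite big_ord0 mulr0 add0r /d expr0 mulr1.
  apply: le_trans (IH (ltnW mn)) _.
  rewrite big_ord_recr/= mulrDr -[leRHS]addrA lerD2l.
  have hd := d0 m.+1; have hS := dS m.
  rewrite (@itg_cat _ (- d m.+1) _ (- d m)) ?(@itg_cat _ (d m.+1) _ (- d m.+1) (d m))//;
    try by apply/andP; split; lra.
  rewrite (@itg_cat _ (- d m.+1) g (- d m)) ?(@itg_cat _ (d m.+1) g (- d m.+1) (d m))//;
    try by apply/andP; split; lra.
  (* A shell is removed only if [n] is positive, and then 1 - r <= 2^-n <= 1/2, as the tail bound
     requires. *)
  have r2 : 2^-1 <= r < 1.
    move: r01 => /andP[_ ->]; rewrite andbT.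
    have : (2^-1 : R) ^+ n <= 2^-1.
      by case: n mn {rn nr IH} => // n _; rewrite exprS ler_piMr ?exprn_ile1//; lra.
    lra.
  pose C : R := 16 * (2 ^+ m * 2^-1 ^+ (n - m)).
  have C0 : 0 <= C by rewrite !mulr_ge0// exprn_ge0.
  have hC t : d m.+1 <= `|t| <= d m -> poisson r t * g t <= C * g t.
    move=> /andP[t1 t2]; rewrite ler_wpM2r//.
    apply: le_trans (poisson_le_tail r2 _) _.
      rewrite (lt_le_trans hd t1)/= (le_trans t2)// /d ger_pMr//.
      by rewrite exprn_ile1//; lra.
    have tt : d m.+1 ^+ 2 <= t ^+ 2.
      by rewrite -[t ^+ 2]real_normK ?num_real// lerXn2r ?nnegrE// ltW.
    rewrite ler_pdivrMr; last by apply: lt_le_trans tt; rewrite exprn_gt0.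
    apply: (@le_trans _ _ (C * d m.+1 ^+ 2)); last by rewrite ler_wpM2l.
    rewrite /C -mulrA ler_wpM2l//; apply: le_trans rn _.
    have -> : (2^-1 : R) ^+ n = 2^-1 ^+ (n - m) * 2^-1 ^+ m.
      by rewrite -exprD subnK// ltnW.
    rewrite [leRHS]mulrAC mulrC ler_wpM2r ?exprn_ge0//.
    rewrite /d exprMn [_ ^+ m.+1]exprS.
    have x0 : 0 < (2^-1 : R) ^+ m by rewrite exprn_gt0.
    have -> : (2 : R) ^+ m = (2^-1 ^+ m)^-1 by rewrite exprVn invrK.
    move: (2^-1 ^+ m) x0 => x x0.
    have -> : x^-1 * (pi ^+ 2 * (2^-1 * x) ^+ 2) = pi ^+ 2 / 4 * x by field; rewrite gt_eqF.
    have h2 : 2 ^+ 2 <= pi ^+ 2 :> R by rewrite lerXn2r ?nnegrE//; lra.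
    by apply: ler_peMl; [exact: ltW|lra].
  have cCg : continuous (fun t => C * g t) by apply: ctsM => //; exact: cts_cst.
  have i1 : itg (- d m) (- d m.+1) (fun t => poisson r t * g t) <= C * itg (- d m) (- d m.+1) g.
    rewrite -itgZ//; apply: le_itg => // t /andP[t1 t2]; apply: hC.
    by rewrite ler0_norm; [apply/andP; split|]; lra.
  have i2 : itg (d m.+1) (d m) (fun t => poisson r t * g t) <= C * itg (d m.+1) (d m) g.
    rewrite -itgZ//; apply: le_itg => // t /andP[t1 t2]; apply: hC.
    by rewrite ger0_norm; [apply/andP; split|]; lra.
  have i3 : 0 <= C * itg (- d m.+1) (d m.+1) g by rewrite mulr_ge0// itg_ge0.
  rewrite [16 * (_ * _)]mulrA -/C; lra.
apply: le_trans (step n (leqnn n)) _.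
rewrite [in leRHS]big_ord_recr/= mulrDr lerD2l subnn expr0 mulr1 -/(d n).
have -> : 16 * (2 ^+ n * itg (- d n) (d n) g) = itg (- d n) (d n) (fun t => 16 * 2 ^+ n * g t).
  by rewrite itgZ// mulrA.
apply: le_itg => //; first by apply: ctsM => //; exact: cts_cst.
move=> t _; rewrite ler_wpM2r//; apply: le_trans (poisson_le_center _ r01) _.
have x0 : 0 < (2^-1 : R) ^+ n by rewrite exprn_gt0.
have -> : (2 : R) ^+ n = (2^-1 ^+ n)^-1 by rewrite exprVn invrK.
move: r01 => /andP[r0 r1].
rewrite ler_pdivrMr ?subr_gt0//; move: (2^-1 ^+ n) x0 rn nr => x x0 rn nr.
rewrite mulrAC ler_pdivlMr//; lra.
Qed.

End PoissonKernel.

(** * Quaternionic power series *)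

Section QuaternionBasics.
Context {R : realType}.
Local Notation H := (quat R).
Implicit Types (p q x y I : H) (a : nat -> H).

Lemma q1D p q : q1 (p + q) = q1 p + q1 q. Proof. by []. Qed.
Lemma q1B p q : q1 (p - q) = q1 p - q1 q. Proof. by []. Qed.
Lemma q1Z (k : R) p : q1 (k *: p) = k * q1 p. Proof. by []. Qed.

Lemma q1_sum (T : Type) (r : seq T) (P : pred T) (F : T -> H) :
  q1 (\sum_(i <- r | P i) F i) = \sum_(i <- r | P i) q1 (F i).
Proof. by apply: (big_morph (@q1 R)) => //; exact: q1D. Qed.

Lemma normq_sqrtE q :
  `|q| = Num.sqrt (q1 q ^+ 2 + qi q ^+ 2 + qj q ^+ 2 + qk q ^+ 2) :> R.
Proof. by []. Qed.

Lemma normq_sqr q : `|q| ^+ 2 = q1 q ^+ 2 + qi q ^+ 2 + qj q ^+ 2 + qk q ^+ 2.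
Proof. by rewrite normq_sqrtE sqr_sqrtr// !addr_ge0 ?sqr_ge0. Qed.

Lemma conjqM p q : conjq (p * q) = conjq q * conjq p.
Proof. by apply: quatP => /=; ring. Qed.

Lemma conjqD p q : conjq (p + q) = conjq p + conjq q.
Proof. by apply: quatP => /=; ring. Qed.

Lemma conjqK p : conjq (conjq p) = p.
Proof. by apply: quatP => /=; ring. Qed.

Lemma conjqZ (k : R) p : conjq (k *: p) = k *: conjq p.
Proof. by apply: quatP => /=; ring. Qed.

Lemma norm_conjq p : `|conjq p| = `|p|.
Proof. by rewrite !normq_sqrtE; congr Num.sqrt => /=; ring. Qed.

Lemma conjq_sum (T : Type) (r : seq T) (P : pred T) (F : T -> H) :
  conjq (\sum_(i <- r | P i) F i) = \sum_(i <- r | P i) conjq (F i).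
Proof.
apply: (big_morph (@conjq R)); first exact: conjqD.
by apply: quatP => /=; rewrite ?oppr0.
Qed.

Lemma conjq_mul p : conjq p * p = (`|p| ^+ 2)%:A.
Proof. by apply: quatP; rewrite /= normq_sqr; ring. Qed.

Lemma mul_conjq p : p * conjq p = (`|p| ^+ 2)%:A.
Proof. by apply: quatP; rewrite /= normq_sqr; ring. Qed.

Definition dotq p q : R := q1 (conjq p * q).

Lemma dotqC p q : dotq p q = dotq q p.
Proof. rewrite /dotq/=; ring. Qed.

Lemma normqD_sqr p q : `|p + q| ^+ 2 = `|p| ^+ 2 + `|q| ^+ 2 + 2 * dotq p q.
Proof. rewrite !normq_sqr /dotq/=; ring. Qed.

Lemma comp_le_normq q : [/\ `|q1 q| <= `|q|, `|qi q| <= `|q|, `|qj q| <= `|q| & `|qk q| <= `|q|].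
Proof.
have h := normq_sqr q.
have hx (x : R) : x ^+ 2 <= `|q| ^+ 2 -> `|x| <= `|q|.
  by move=> hx; rewrite -(ger0_norm (normr_ge0 q)) -ler_sqr ?nnegrE// !real_normK ?num_real.
have := (sqr_ge0 (q1 q), sqr_ge0 (qi q), sqr_ge0 (qj q), sqr_ge0 (qk q)).
by move=> [[[? ?] ?] ?]; split; apply: hx; rewrite h; lra.
Qed.

Lemma norm_q1_le q : `|q1 q| <= `|q|. Proof. by have [] := comp_le_normq q. Qed.
Lemma norm_qi_le q : `|qi q| <= `|q|. Proof. by have [] := comp_le_normq q. Qed.
Lemma norm_qj_le q : `|qj q| <= `|q|. Proof. by have [] := comp_le_normq q. Qed.
Lemma norm_qk_le q : `|qk q| <= `|q|. Proof. by have [] := comp_le_normq q. Qed.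

Lemma normq_le_comp q : `|q| <= `|q1 q| + `|qi q| + `|qj q| + `|qk q|.
Proof.
rewrite -(ger0_norm (normr_ge0 q)) -(@ger0_norm _ (_ + `|qk q|)); last by rewrite !addr_ge0.
rewrite -ler_sqr ?nnegrE// !real_normK ?num_real// normq_sqr.
rewrite -[q1 q ^+ 2]real_normK ?num_real// -[qi q ^+ 2]real_normK ?num_real//.
rewrite -[qj q ^+ 2]real_normK ?num_real// -[qk q ^+ 2]real_normK ?num_real//.
have := (normr_ge0 (q1 q), normr_ge0 (qi q), normr_ge0 (qj q), normr_ge0 (qk q)).
move: `|q1 q| `|qi q| `|qj q| `|qk q| => a b c d [[[a0 b0] c0] d0].
have := (mulr_ge0 a0 b0, mulr_ge0 a0 c0, mulr_ge0 a0 d0).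
have := (mulr_ge0 b0 c0, mulr_ge0 b0 d0, mulr_ge0 c0 d0).
move=> [[? ?] ?] [[? ?] ?]; lra.
Qed.

(** Every component is the real part of a right multiple, so facts about [q1 (f * c)] for all [c]
    cover the four components. *)
Lemma qi_q1 q : qi q = q1 (q * Quat 0 (-1) 0 0). Proof. rewrite /=; ring. Qed.
Lemma qj_q1 q : qj q = q1 (q * Quat 0 0 (-1) 0). Proof. rewrite /=; ring. Qed.
Lemma qk_q1 q : qk q = q1 (q * Quat 0 0 0 (-1)). Proof. rewrite /=; ring. Qed.

(** With the unit vector conj q / |q|, norms become real parts, so scalar integral formulas yield
    norm inequalities. *)
Lemma norm_q1_dual q : exists2 u : H, `|u| <= 1 & q1 (q * u) = `|q|.
Proof.
have [->|q0] := eqVneq q 0; first by exists 0; rewrite ?normr0// mulr0.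
exists (`|q|^-1 *: conjq q).
  by rewrite normrZ norm_conjq normfV normr_id mulVf// normr_eq0.
by rewrite -scalerAr mul_conjq /= mulr1 expr2 mulrA mulVf ?mul1r// normr_eq0.
Qed.

Lemma expI0 I : expI I 0 = 1.
Proof. by rewrite /expI sin0 cos0 scale0r addr0 scale1r. Qed.

Lemma expID I (s t : R) : imag_units I -> expI I (s + t) = expI I s * expI I t.
Proof.
rewrite /imag_units/= /expI sinD cosD => I2.
rewrite mulrDl !mulrDr -!scalerAl -!scalerAr !mul1r mulr1 -expr2 I2.
rewrite !scalerA scalerBl scalerDl scalerN.
move: ((cos s * cos t)%:A) ((sin s * sin t)%:A) (_ *: I) (_ *: I) => u v w z.
by rewrite [z + w]addrC addrACA [- v + z]addrC.
Qed.

Lemma expIX I (t : R) n : imag_units I -> expI I t ^+ n = expI I (n%:R * t).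
Proof.
move=> I2; elim: n => [|n IH]; first by rewrite expr0 mul0r expI0.
by rewrite exprS IH -expID// -[n.+1]add1n natrD mulrDl mul1r.
Qed.

Lemma imag_units_conj I : imag_units I -> conjq I = - I.
Proof.
case: I => a b c d [/= h1 h2 h3 h4].
have a0 : a = 0 by nra.
by apply: quatP => //=; rewrite a0 oppr0.
Qed.

Lemma conj_expI I (t : R) : imag_units I -> conjq (expI I t) = expI I (- t).
Proof.
move=> /imag_units_conj h; rewrite /expI conjqD !conjqZ h sinN cosN scaleNr scalerN.
by congr (_ *: _ + _); apply: quatP => /=; rewrite ?oppr0.
Qed.

Lemma norm_imag_units I : imag_units I -> `|I| = 1.
Proof.
move=> h; have := normq_expI (pi / 2) h.
by rewrite /expI cos_pihalf sin_pihalf scale0r scale1r add0r.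
Qed.

Lemma cts_comp_q1 (T : topologicalType) (F : T -> H) :
  continuous F -> continuous (fun t => q1 (F t)).
Proof.
move=> cF t; apply/cvgrPdist_le => e e0.
have /cvgrPdist_le/(_ e e0) := cF t.
by apply: filterS => u; apply: le_trans; rewrite -q1B; exact: norm_q1_le.
Qed.

Lemma ctsHD (T : topologicalType) (F G : T -> H) :
  continuous F -> continuous G -> continuous (fun t => F t + G t).
Proof. by move=> cF cG t; apply: cvgD; [exact: cF|exact: cG]. Qed.

Lemma ctsHB (T : topologicalType) (F G : T -> H) :
  continuous F -> continuous G -> continuous (fun t => F t - G t).
Proof. by move=> cF cG t; apply: cvgB; [exact: cF|exact: cG]. Qed.

Lemma ctsHZ (T : topologicalType) (f : T -> R) (F : T -> H) :
  continuous f -> continuous F -> continuous (fun t => f t *: F t).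
Proof. by move=> cf cF t; apply: cvgZ; [exact: cf|exact: cF]. Qed.

Lemma ctsH_cst (T : topologicalType) q : continuous (fun _ : T => q).
Proof. by move=> t; exact: cvg_cst. Qed.

Lemma cts_normq (T : topologicalType) (F : T -> H) :
  continuous F -> continuous (fun t => `|F t|).
Proof. by move=> cF x; apply: cvg_norm; exact: cF. Qed.

Lemma ctsHMr (T : topologicalType) (F : T -> H) q :
  continuous F -> continuous (fun t => F t * q).
Proof.
move=> cF t; apply/cvgrPdist_le => e e0.
have d0 : 0 < e / (`|q| + 1) by rewrite divr_gt0// ltr_wpDl.
have /cvgrPdist_le/(_ _ d0) := cF t.
apply: filterS => u hu; rewrite -mulrBl normqM.
move: hu; rewrite ler_pdivlMr ?ltr_wpDl// => hu; apply: le_trans hu.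
by rewrite ler_wpM2l// lerDl.
Qed.

Lemma ctsH_sum (T : topologicalType) (I : Type) (r : seq I) (P : pred I) (F : I -> T -> H) :
  (forall i, continuous (F i)) ->
  continuous (fun t => \sum_(i <- r | P i) F i t).
Proof.
move=> cF; elim: r => [|i r IH].
  by under eq_fun do rewrite big_nil; exact: ctsH_cst.
under eq_fun do rewrite big_cons.
by case: (P i); [apply: ctsHD => //; exact: cF|exact: IH].
Qed.

Lemma cts_expI (T : topologicalType) I (f : T -> R) :
  continuous f -> continuous (fun t => expI I (f t)).
Proof.
by move=> cf; apply: ctsHD; apply: ctsHZ; try exact: ctsH_cst;
  [exact: cts_cos|exact: cts_sin].
Qed.

Lemma quat_cvg (T : Type) (F : set_system T) (f : T -> H) q : Filter F ->
  (fun t => q1 (f t)) @ F --> q1 q -> (fun t => qi (f t)) @ F --> qi q ->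
  (fun t => qj (f t)) @ F --> qj q -> (fun t => qk (f t)) @ F --> qk q ->
  f @ F --> q.
Proof.
move=> FF /cvgrPdist_le h1 /cvgrPdist_le h2 /cvgrPdist_le h3 /cvgrPdist_le h4.
apply/cvgrPdist_le => e e0; have d0 : 0 < e / 4 by rewrite divr_gt0.
apply: filterS (filterI (filterI (h1 _ d0) (h2 _ d0)) (filterI (h3 _ d0) (h4 _ d0))).
move=> t [[t1 t2] [t3 t4]]; apply: le_trans (normq_le_comp _) _.
move: t1 t2 t3 t4; rewrite /=; lra.
Qed.

Lemma cvg_comp_q1 (T : Type) (F : set_system T) (f : T -> H) q : Filter F ->
  f @ F --> q -> (fun t => q1 (f t)) @ F --> q1 q.
Proof.
move=> FF /cvgrPdist_le h; apply/cvgrPdist_le => e /h.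
by apply: filterS => t; apply: le_trans; rewrite -q1B; exact: norm_q1_le.
Qed.

Lemma cvg_mulqr (T : Type) (F : set_system T) (f : T -> H) q c : Filter F ->
  f @ F --> q -> (fun t => f t * c) @ F --> q * c.
Proof.
move=> FF /cvgrPdist_le h; apply/cvgrPdist_le => e e0.
have d0 : 0 < e / (`|c| + 1) by rewrite divr_gt0// ltr_wpDl.
apply: filterS (h _ d0) => u hu; rewrite -mulrBl normqM.
move: hu; rewrite ler_pdivlMr ?ltr_wpDl// => hu; apply: le_trans hu.
by rewrite ler_wpM2l// lerDl.
Qed.

Lemma quat_series_cvg (x : nat -> H) (u : nat -> R) :
  (forall n, `|x n| <= u n) -> cvgn (series u) -> exists l : H, series x @ \oo --> l.
Proof.
move=> xu cu.
have real_cvg (y : nat -> R) : (forall n, `|y n| <= `|x n|) -> cvgn (series y).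
  move=> yx; apply: normed_cvg; apply: series_le_cvg cu => n.
  - exact: normr_ge0.
  - exact: le_trans (normr_ge0 _) (xu n).
  - exact: le_trans (yx n) (xu n).
have c1 := real_cvg (fun n => q1 (x n)) (fun n => norm_q1_le _).
have c2 := real_cvg (fun n => qi (x n)) (fun n => norm_qi_le _).
have c3 := real_cvg (fun n => qj (x n)) (fun n => norm_qj_le _).
have c4 := real_cvg (fun n => qk (x n)) (fun n => norm_qk_le _).
exists (Quat (limn (series (fun n => q1 (x n)))) (limn (series (fun n => qi (x n))))
  (limn (series (fun n => qj (x n)))) (limn (series (fun n => qk (x n))))).
have comp_sum (c : H -> R) : c 0 = 0 -> (forall p q, c (p + q) = c p + c q) ->
    (fun n => c (series x n)) = series (fun n => c (x n)).
  move=> c0' cD; apply/funext => n; rewrite /series/=.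
  by apply: (big_morph c).
by apply: quat_cvg => /=; rewrite comp_sum.
Qed.

(** The partial sum of the power series with coefficients [a] at the point r e^(It). *)
Definition circ_sum I a N (r t : R) : H :=
  \sum_(n < N) r ^+ n *: (expI I (n%:R * t) * a n).

Lemma expI_powE I (r t : R) n p : imag_units I ->
  (r *: expI I t) ^+ n * p = r ^+ n *: (expI I (n%:R * t) * p).
Proof. by move=> I2; rewrite exprZn expIX// -scalerAl. Qed.

Lemma cts_circ_sum I a N r : continuous (circ_sum I a N r).
Proof.
apply: ctsH_sum => n; apply: ctsHZ; first exact: cts_cst.
by apply: ctsHMr; apply: cts_expI; apply: ctsM; [exact: cts_cst|exact: cts_id].
Qed.

Lemma cts_circ_sum_r I a N t : continuous (fun r => circ_sum I a N r t).
Proof.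
by apply: ctsH_sum => n; apply: ctsHZ; [apply: cts_exp; exact: cts_id|exact: ctsH_cst].
Qed.

Lemma circ_sumMr I a N r t u :
  circ_sum I a N r t * u = circ_sum I (fun n => a n * u) N r t.
Proof.
by rewrite /circ_sum mulr_suml; apply: eq_bigr => n _; rewrite -scalerAl mulrA.
Qed.

Lemma q1_expIM I (t : R) p : q1 (expI I t * p) = q1 p * cos t + q1 (I * p) * sin t.
Proof. by rewrite /expI mulrDl -!scalerAl mul1r q1D !q1Z mulrC [in X in _ + X]mulrC. Qed.

Lemma q1_mul_expIM I (t : R) p x :
  q1 (p * (expI I t * x)) = q1 (p * x) * cos t + q1 (p * I * x) * sin t.
Proof. rewrite /expI/=; ring. Qed.

Lemma circ_sum_recr I a N r t :
  circ_sum I a N.+1 r t = circ_sum I a N r t + r ^+ N *: (expI I (N%:R * t) * a N).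
Proof. by rewrite /circ_sum big_ord_recr. Qed.

(** Induction on [N]: the last term has constant modulus |a_N|, and the real parts of its cross
    products with the earlier terms have frequencies N - m > 0, so they vanish over any period. The
    free starting point [c] serves rotated integrands. *)
Lemma parseval I a N (c : R) : imag_units I ->
  itg c (c + 2 * pi) (fun t => `|circ_sum I a N 1 t| ^+ 2) = 2 * pi * \sum_(n < N) `|a n| ^+ 2.
Proof.
move=> I2; have pi0 := @pi_gt0 R.
have cS M : continuous (fun t => `|circ_sum I a M 1 t| ^+ 2).
  by apply: cts_exp; apply: cts_normq; exact: cts_circ_sum.
elim: N => [|N IH].
  rewrite big_ord0 mulr0 /circ_sum; under eq_itg do rewrite big_ord0 normr0 expr0n/=.
  by rewrite itg_cst ?mul0r//; lra.
pose X (m : 'I_N) t := 2 * (q1 (conjq (a N) * a m) * cos ((N - m)%:R * t + 0) -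
    q1 (conjq (a N) * I * a m) * sin ((N - m)%:R * t + 0)).
have cc (m : 'I_N) : continuous (fun t : R => cos ((N - m)%:R * t + 0)) by exact/cts_cos/cts_affine.
have cs (m : 'I_N) : continuous (fun t : R => sin ((N - m)%:R * t + 0)) by exact/cts_sin/cts_affine.
have cX m : continuous (X m).
  apply: ctsM; first exact: cts_cst.
  by apply: ctsB; (apply: ctsM; first exact: cts_cst).
have e t : `|circ_sum I a N.+1 1 t| ^+ 2 =
    `|circ_sum I a N 1 t| ^+ 2 + `|a N| ^+ 2 + \sum_(m < N) X m t.
  rewrite circ_sum_recr expr1n scale1r normqD_sqr normqM normq_expI// mul1r; congr (_ + _).
  rewrite dotqC /dotq /circ_sum mulr_sumr q1_sum mulr_sumr; apply: eq_bigr => m _.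
  rewrite expr1n scale1r conjqM conj_expI// -!mulrA [expI _ _ * _]mulrA -expID//.
  have -> : - (N%:R * t) + m%:R * t = - ((N - m)%:R * t + 0).
    by rewrite natrB ?(ltnW (ltn_ord m))//; ring.
  rewrite q1_mul_expIM /X sinN cosN; ring.
under eq_itg do rewrite e.
rewrite itgD; [|by apply: ctsD => //; exact: cts_cst|exact: cts_sum].
rewrite itgD//; last exact: cts_cst.
rewrite IH itg_cst; last lra.
rewrite itg_sum// [X in _ + X]big1 ?addr0; last first.
  move=> m _; have mN : (0 < N - m)%N by rewrite subn_gt0.
  rewrite itgZ; last by apply: ctsB; (apply: ctsM; first exact: cts_cst).
  rewrite itgB; try by apply: ctsM => //; exact: cts_cst.
  rewrite !itgZ// itg_cos_period// mulr0.
  have := @itg_sin_period R (N - m) c 0; rewrite -lt0n mN/=.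
  by under eq_itg do rewrite mulr1; move=> ->; rewrite mulr0 subrr mulr0.
rewrite big_ord_recr/=; ring.
Qed.

Lemma parseval_circ I a N : imag_units I ->
  itg (- pi) pi (fun t => `|circ_sum I a N 1 t| ^+ 2) = 2 * pi * \sum_(n < N) `|a n| ^+ 2.
Proof.
by move=> I2; rewrite -(parseval _ _ (- pi) I2); congr itg; ring.
Qed.

Lemma circ_sum_radius I a N r t :
  circ_sum I a N r t = circ_sum I (fun n => r ^+ n *: a n) N 1 t.
Proof.
by apply: eq_bigr => n _; rewrite expr1n scale1r -scalerAr.
Qed.

Lemma circ_sum_rot I a N r (t s : R) : imag_units I ->
  circ_sum I a N r (t + s) = circ_sum I (fun n => expI I (n%:R * s) * a n) N r t.
Proof.
by move=> I2; apply: eq_bigr => n _; rewrite mulrDr expID// mulrA.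
Qed.

(** Each term contributes a cosine and a sine of frequency [n]; the sine is handled as a cosine with
    phase shifted by pi/2. *)
Lemma circ_sum_poisson I a N r t : imag_units I -> 0 <= r < 1 ->
  2 * pi * q1 (circ_sum I a N r t) =
  itg (- pi) pi (fun s => poisson r s * q1 (circ_sum I a N 1 (s + t))).
Proof.
move=> I2 r01; have cP := cts_poisson r01.
pose X (n : 'I_N) s := q1 (a n) * (poisson r s * cos (n%:R * s + n%:R * t)) +
  q1 (I * a n) * (poisson r s * cos (n%:R * s + (n%:R * t - pi / 2))).
have cc (n : 'I_N) (k : R) : continuous (fun s => poisson r s * cos (n%:R * s + k)).
  by apply: ctsM => //; exact/cts_cos/cts_affine.
have e s : poisson r s * q1 (circ_sum I a N 1 (s + t)) = \sum_(n < N) X n s.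
  rewrite /circ_sum q1_sum mulr_sumr; apply: eq_bigr => n _.
  rewrite expr1n scale1r q1_expIM /X addrA cosBpihalf mulrDr [n%:R * (_ + _)]mulrDr; ring.
under eq_itg do rewrite e.
have cM (k : R) (f : R -> R) : continuous f -> continuous (fun s => k * f s).
  by move=> cf; apply: ctsM => //; exact: cts_cst.
rewrite itg_sum; last by move=> n; apply: ctsD; apply: cM.
rewrite /circ_sum q1_sum mulr_sumr; apply: eq_bigr => n _.
rewrite itgD; [|exact: cM|exact: cM].
rewrite !itgZ// !poisson_cos// cosBpihalf q1Z q1_expIM; ring.
Qed.

Lemma circ_sum_poisson_le I a N r t : imag_units I -> 0 <= r < 1 ->
  2 * pi * `|circ_sum I a N r t| <=
  itg (- pi) pi (fun s => poisson r s * `|circ_sum I a N 1 (s + t)|).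
Proof.
move=> I2 r01; have [u u1 <-] := norm_q1_dual (circ_sum I a N r t).
rewrite circ_sumMr circ_sum_poisson//; have cP := cts_poisson r01.
have cS b : continuous (fun s => circ_sum I b N 1 (s + t)).
  move=> s; apply: (@continuous_comp _ _ _ (fun s => s + t) (circ_sum I b N 1)).
    by apply: ctsD; [exact: cts_id|exact: cts_cst].
  exact: cts_circ_sum.
apply: le_itg.
- by apply: ctsM => //; apply: cts_comp_q1.
- by apply: ctsM => //; exact: cts_normq.
- move=> s _; rewrite -circ_sumMr ler_wpM2l ?poisson_ge0//.
  by rewrite (le_trans (ler_norm _))// (le_trans (norm_q1_le _))// normqM ler_piMr.
Qed.

End QuaternionBasics.

(** * Radial limits of square-summable series *)

Section RadialLimits.
Context {R : realType}.
Local Notation H := (quat R).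
Local Notation mu := (@lebesgue_measure R).
Local Notation win A := (`[(- A)%R, A%R]%classic).
Implicit Types (p q I : H) (a : nat -> H).

Lemma quat_cauchy (T : Type) (F : set_system T) (f : T -> H) : ProperFilter F ->
  (forall e : R, 0 < e -> exists q, F [set t | `|f t - q| < e]) -> exists l : H, f @ F --> l.
Proof.
move=> FF hf.
have hc (c : H -> R) : (forall p q, `|c p - c q| <= `|p - q|) -> cvg ((fun t => c (f t)) @ F).
  move=> cl; apply: R_complete; apply: cauchy_exP => e /hf[q hq]; exists (c q).
  change (F [set t | ball (c q) e (c (f t))]).
  apply: filterS hq => t ht; rewrite /= -ball_normE/= distrC.
  exact: le_lt_trans (cl _ _) ht.
have c1 := hc (@q1 R) (fun p q => norm_q1_le (p - q)).
have c2 := hc (@qi R) (fun p q => norm_qi_le (p - q)).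
have c3 := hc (@qj R) (fun p q => norm_qj_le (p - q)).
have c4 := hc (@qk R) (fun p q => norm_qk_le (p - q)).
by eexists (Quat _ _ _ _); apply: quat_cvg => /=; [exact: c1|exact: c2|exact: c3|exact: c4].
Qed.

Lemma sum_tail (V : zmodType) (G : nat -> V) m n : (m <= n)%N ->
  \sum_(i < n) (if (m <= i)%N then G i else 0) = \sum_(i < n) G i - \sum_(i < m) G i.
Proof.
move=> mn; apply/eqP; rewrite eq_sym subr_eq (big_ord_widen n G mn) [X in _ + X]big_mkcond.
rewrite -big_split/=; apply/eqP; apply: eq_bigr => i _.
by rewrite ltnNge; case: (_ <= _)%N; rewrite ?addr0 ?add0r.
Qed.

Lemma bounded_sum_tail (c : nat -> R) M : (forall n, 0 <= c n) ->
  (forall n, \sum_(i < n) c i <= M) ->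
  forall e, 0 < e -> exists m, forall n, (m <= n)%N -> \sum_(i < n) c i - \sum_(i < m) c i <= e.
Proof.
move=> c0 cM e e0; pose S := range (fun n => \sum_(i < n) c i).
have hS : has_sup S.
  by split; [exists 0, 0%N => //; rewrite big_ord0|exists M => _ [n _ <-]].
have [_ [m _ <-] hm] := sup_adherent e0 hS; exists m => n _.
have : \sum_(i < n) c i <= sup S.
  by apply: ub_le_sup; [case: hS|exists n].
move: hm; rewrite -/S; lra.
Qed.

Lemma circ_sum_block I a m n r t : (m <= n)%N ->
  circ_sum I (fun i => if (m <= i)%N then a i else 0) n r t =
  circ_sum I a n r t - circ_sum I a m r t.
Proof.
move=> mn; rewrite /circ_sum -(sum_tail (fun i => r ^+ i *: (expI I (i%:R * t) * a i)))//.
by apply: eq_bigr => i _; case: ifP => // _; rewrite mulr0 scaler0.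
Qed.

Lemma normq_sum_block a m n : (m <= n)%N ->
  \sum_(i < n) `|if (m <= i)%N then a i else 0| ^+ 2 =
  \sum_(i < n) `|a i| ^+ 2 - \sum_(i < m) `|a i| ^+ 2.
Proof.
move=> mn; rewrite -(sum_tail (fun i => `|a i| ^+ 2))//.
by apply: eq_bigr => i _; case: ifP => // _; rewrite normr0 expr0n.
Qed.

(** Integrate x <= d/2 + x^2/(2d) and apply Parseval. *)
Lemma circ_sum_L1 I a N (d c : R) : imag_units I -> 0 < d ->
  \sum_(n < N) `|a n| ^+ 2 <= d ^+ 2 ->
  itg c (c + 2 * pi) (fun t => `|circ_sum I a N 1 t|) <= 2 * pi * d.
Proof.
move=> I2 d0 ad; have pi0 := @pi_gt0 R.
have cS : continuous (fun t => `|circ_sum I a N 1 t|).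
  by apply: cts_normq; exact: cts_circ_sum.
have c2 : continuous (fun t => `|circ_sum I a N 1 t| ^+ 2) by exact: cts_exp.
have c3 : continuous (fun t => (2 * d)^-1 * `|circ_sum I a N 1 t| ^+ 2).
  by apply: ctsM => //; exact: cts_cst.
apply: (@le_trans _ _ (itg c (c + 2 * pi) (fun t => d / 2 + (2 * d)^-1 * `|circ_sum I a N 1 t| ^+ 2))).
  apply: le_itg => //; first by apply: ctsD => //; exact: cts_cst.
  move=> t _; move: `|_| => x.
  have -> : d / 2 + (2 * d)^-1 * x ^+ 2 = x + (2 * d)^-1 * (x - d) ^+ 2.
    by field; rewrite gt_eqF.
  by rewrite lerDl mulr_ge0 ?sqr_ge0// invr_ge0 mulr_ge0// ltW.
rewrite itgD//; last exact: cts_cst.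
rewrite itg_cst ?itgZ ?parseval//; last lra.
have -> : 2 * pi * d = d / 2 * (c + 2 * pi - c) + (2 * d)^-1 * (2 * pi * d ^+ 2).
  by field; rewrite gt_eqF.
by rewrite lerD2l ler_wpM2l ?invr_ge0 ?ler_wpM2l// mulr_ge0// ltW.
Qed.

Lemma circ_sum_L1_window I a N (d : R) (m : nat) : imag_units I -> 0 < d ->
  \sum_(n < N) `|a n| ^+ 2 <= d ^+ 2 -> forall c,
  itg c (c + m%:R * (2 * pi)) (fun t => `|circ_sum I a N 1 t|) <= m%:R * (2 * pi * d).
Proof.
move=> I2 d0 ad; have pi0 := @pi_gt0 R; have cS : continuous (fun t => `|circ_sum I a N 1 t|).
  by apply: cts_normq; exact: cts_circ_sum.
elim: m => [|m IH] c; first by rewrite !mul0r addr0 /itg set_itv1 Rintegral_set1.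
have m0 : 0 <= m%:R * (2 * pi) :> R by rewrite !mulr_ge0 ?pi_ge0.
rewrite (@itg_cat _ (c + 2 * pi))//; last by rewrite -natr1; apply/andP; split; lra.
have -> : c + m.+1%:R * (2 * pi) = c + 2 * pi + m%:R * (2 * pi) by rewrite -natr1; ring.
have := IH (c + 2 * pi); have := circ_sum_L1 c I2 d0 ad; rewrite -natr1; lra.
Qed.

(** The maximal function is taken on the line, where a periodic function has infinite mass. The
    function is therefore cut off to [-A, A] and evaluated only at angles well inside. *)
Lemma window_locally_integrable (g : R -> R) (A : R) : continuous g ->
  locally_integrable setT (g \_ (win A)).
Proof.
move=> cg; apply: open_integrable_locally; first exact: openT.
rewrite -restrict_EFin; apply: (iffLR (integrable_mkcond _ _)) => //.
exact: itg_integrable.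
Qed.

Lemma HL_window (g : R -> R) (A t d c : R) : continuous g -> (forall s, 0 <= g s) ->
  0 < d -> `|t| + d <= A -> (HL_maximal (g \_ (win A)) t <= c%:E)%E ->
  itg (t - d) (t + d) g <= 2 * d * c.
Proof.
move=> cg g0 d0 tA; have := ler_norm t; have := ler_norm (- t); rewrite normrN => tn tp.
move=> /(le_trans (ereal_sup_ubound _)) => /(_ (iavg (g \_ (win A)) (ball t d))).
have h : [set iavg (g \_ (win A)) (ball t r) | r in `]0, +oo[%classic] (iavg (g \_ (win A)) (ball t d)).
  by exists d => //=; rewrite in_itv/= d0.
move=> /(_ h); rewrite /iavg lebesgue_measure_ball ?(ltW d0)//.
have -> : (\int[mu]_(y in ball t d) `|((g \_ (win A)) y)%:E| = (itg (t - d) (t + d) g)%:E)%E.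
  rewrite -itgE// ball_itv.
  under eq_integral => y yb.
    have -> : ((g \_ (win A)) y)%:E = (g y)%:E.
      rewrite patchE mem_set//=; move: yb; rewrite inE/= !in_itv/= => /andP[y1 y2].
      by apply/andP; split; lra.
    rewrite gee0_abs ?lee_fin//; over.
  rewrite -(@integral_itv_bndoo _ _ _ _ true false)//.
  by apply/measurable_EFinP; apply: measurable_funTS; exact: continuous_measurable_fun.
rewrite inver mulrn_eq0/= (gt_eqF d0)/= -EFinM lee_fin mulrC.
rewrite ler_pdivrMr ?pmulrn_lgt0// => /le_trans; apply.
by have -> : c * (d *+ 2) = 2 * d * c by rewrite -mulr_natl; ring.
Qed.

Lemma geo_rev n : \sum_(j < n.+1) (2^-1 : R) ^+ (n - j) <= 2.
Proof.
have : \sum_(j < n.+1) (2^-1 : R) ^+ (n - j) = 2 - 2^-1 ^+ n.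
  elim: n => [|n IH]; first by rewrite big_ord1 expr0; ring.
  rewrite big_ord_recr/= subnn expr0.
  under eq_bigr => j _ do rewrite subSn ?exprS -1?ltnS//.
  by rewrite -mulr_sumr IH exprS; field.
by move=> ->; rewrite gerBl exprn_ge0.
Qed.

(** The Poisson integral is split dyadically into window averages around [t], each at most [c] by
    the maximal function. The weights 2^-(n-k) sum to at most 2, which with the factor 16 of
    [poisson_dyadic] gives 32. *)
Lemma circ_sum_maximal I a N (A t c r : R) : imag_units I -> 0 <= r < 1 ->
  `|t| + pi <= A -> 0 <= c ->
  (HL_maximal ((fun s => `|circ_sum I a N 1 s|)%R \_ (win A)) t <= c%:E)%E ->
  `|circ_sum I a N r t| <= 32 * c.
Proof.
move=> I2 r01 tA c0 hHL; have pi0 := @pi_gt0 R.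
have cS : continuous (fun t => `|circ_sum I a N 1 t|).
  by apply: cts_normq; exact: cts_circ_sum.
have cSt : continuous (fun s => `|circ_sum I a N 1 (s + t)|).
  apply: (@cts_comp _ _ (fun s => `|circ_sum I a N 1 s|) (fun s => s + t)) => //.
  by apply: ctsD; [exact: cts_id|exact: cts_cst].
have [n hn] := dyadic_scale r01.
have := circ_sum_poisson_le a N t I2 r01.
move=> /le_trans /(_ (poisson_dyadic r01 hn cSt (fun s => normr_ge0 _))).
move=> h; rewrite -(@ler_pM2l _ (2 * pi)); last by rewrite mulr_gt0.
apply: le_trans h _.
have -> : 2 * pi * (32 * c) = 16 * (2 * (2 * pi * c)) by ring.
rewrite ler_wpM2l//; apply: le_trans (_ : \sum_(k < n.+1) 2^-1 ^+ (n - k) * (2 * pi * c) <= _); last first.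
  by rewrite -mulr_suml ler_wpM2r ?geo_rev// !mulr_ge0// ltW.
apply: ler_sum => k _; set d := pi * _.
have d0 : 0 < d by rewrite mulr_gt0// exprn_gt0.
have dpi : d <= pi by rewrite ger_pMr// exprn_ile1//; lra.
have := @HL_window _ A t d c cS (fun s => normr_ge0 _) d0 _ hHL.
have -> : `|t| + d <= A by lra.
move=> /(_ isT).
rewrite -[t - d]addrC -[t + d]addrC itg_shift//; last lra.
move=> h.
have k0 : (2 : R) ^+ k * 2^-1 ^+ k = 1 by rewrite -exprMn mulfV ?expr1n.
apply: (@le_trans _ _ (2 ^+ k * 2^-1 ^+ (n - k) * (2 * d * c))).
  by rewrite ler_wpM2l// mulr_ge0// exprn_ge0.
have -> : 2 ^+ k * 2^-1 ^+ (n - k) * (2 * d * c) =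
  (2 ^+ k * 2^-1 ^+ k) * (2^-1 ^+ (n - k) * (2 * pi * c)) by rewrite /d; ring.
by rewrite k0 mul1r.
Qed.

(* Splitting the coefficients into blocks of L2-norm at most 4^-k, the maximal
   inequality and Borel-Cantelli make the blocks uniformly small in the radius
   at almost every angle. *)
Lemma radial_cvg_window I f a M (m : nat) : imag_units I ->
  (forall n, \sum_(i < n) `|a i| ^+ 2 <= M) -> has_expansion f a ->
  mu.-negligible [set t | `|t| <= m%:R /\
     ~ (exists l : H, f (r *: expI I t) @[r --> 1^'-] --> l)].
Proof.
move=> I2 aM fa; have pi0 := @pi_gt0 R; have pi2 := @pi_ge2 R.
have a20 i : 0 <= `|a i| ^+ 2 by rewrite exprn_ge0.
have eps k : 0 < (4^-1 ^+ k.+1 : R) ^+ 2 by rewrite !exprn_gt0.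
have /choice[m_ hm_] k := bounded_sum_tail a20 aM (eps k).
(* Strictly increasing block boundaries; beyond [N_ k] the remaining squares sum to at most
   16^-(k+1). *)
pose N_ := fix N_ k := if k is k'.+1 then maxn (N_ k').+1 (m_ k) else m_ 0%N.
have mN k : (m_ k <= N_ k)%N by case: k => //= k; exact: leq_maxr.
have NS k : (N_ k <= N_ k.+1)%N by rewrite /= (leq_trans (leqnSn _))// leq_maxl.
have Nk k : (k <= N_ k)%N by elim: k => // k IH; rewrite /= leq_max ltnS IH.
pose d k i := if (N_ k <= i)%N then a i else 0.
pose D k := (fun s => `|circ_sum I (d k) (N_ k.+1) 1 s|).
have cD k : continuous (D k) by apply: cts_normq; exact: cts_circ_sum.
pose L : R := (2 * m.+1)%:R * (2 * pi).
pose A : R := m.+1%:R * (2 * pi).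
have LA : - A + L = A by rewrite /A /L natrM; ring.
have L0 : 0 <= L by rewrite !mulr_ge0// ltW.
have hd k : \sum_(i < N_ k.+1) `|d k i| ^+ 2 <= (4^-1 ^+ k.+1) ^+ 2.
  rewrite normq_sum_block//; have := hm_ k (N_ k.+1) (leq_trans (mN _) (NS _)).
  apply: le_trans; rewrite lerD2l lerN2 -subr_ge0 -(sum_tail (fun i => `|a i| ^+ 2))//.
  by apply: sumr_ge0 => i _; case: ifP.
pose F k := [set t | ((2^-1 ^+ k)%:E < HL_maximal (D k \_ (win A)) t)%E].
have lD k := window_locally_integrable A (cD k).
have mF k : measurable (F k).
  rewrite /F -[X in measurable X]setTI; apply: emeasurable_fun_o_infty => //.
  exact: measurable_HL_maximal.
(* The weak-type inequality with constant 3 at height 2^-k, for an L1 norm at most L 4^-(k+1), gives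
   3 L 2^k 4^-(k+1), which is summable. *)
have muF k : (mu (F k) <= (3 * L / 2 / (2 ^ k.+1)%:R)%:E)%E.
  have k0 : 0 < (2^-1 : R) ^+ k by rewrite exprn_gt0.
  apply: le_trans (maximal_inequality (lD k) k0) _.
  have -> : (\int[mu]_(y in setT) `|((D k \_ (win A)) y)%:E| = (itg (- A) A (D k))%:E)%E.
    rewrite -itgE// [RHS]integral_mkcond; apply: eq_integral => y _.
    rewrite !patchE; case: ifP => _; last by rewrite abse0.
    by rewrite gee0_abs// lee_fin normr_ge0.
  rewrite -EFinM lee_fin -{2}LA.
  have c0 : 0 < (4^-1 : R) ^+ k.+1 by rewrite exprn_gt0.
  have := circ_sum_L1_window (2 * m.+1) I2 c0 (hd k) (- A).
  have -> : (2 * m.+1)%:R * (2 * pi * 4^-1 ^+ k.+1) = L * 4^-1 ^+ k.+1 by rewrite /L mulrA.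
  rewrite -/L -/(D k) => h.
  apply: (@le_trans _ _ (3 / 2^-1 ^+ k * (L * 4^-1 ^+ k.+1))).
    by rewrite ler_wpM2l// divr_ge0// ltW.
  have -> : (4^-1 : R) ^+ k.+1 = 2^-1 ^+ k * 2^-1 ^+ k / 4.
    have -> : (4^-1 : R) = 2^-1 * 2^-1 by field.
    by rewrite exprMn !exprS; field.
  have -> : ((2 ^ k.+1)%:R : R) = 2 / 2^-1 ^+ k.
    by rewrite natrX exprS exprVn invrK.
  move: (2^-1 ^+ k) k0 => x x0.
  by rewrite le_eqVlt; apply/orP; left; apply/eqP; field; rewrite gt_eqF.
exists (lim_sup_set F); split.
- apply: bigcapT_measurable => n; apply: bigcup_measurable => j _; exact: mF.
- apply: lim_sup_set_cvg0 => //.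
  have := @epsilon_trick0 R (3 * L / 2) predT.
  have -> : 0 <= 3 * L / 2 by rewrite divr_ge0// mulr_ge0.
  move=> /(_ isT) h; apply: le_lt_trans (ltry (3 * L / 2)); apply: le_trans h.
  by apply: lee_nneseries => // k _; exact: muF.
move=> t [tm ncvg]; apply: contrapT => nlim; apply: ncvg.
have [n0 hn0] : exists n0, forall k, (n0 <= k)%N ->
    (HL_maximal (D k \_ (win A)) t <= (2^-1 ^+ k)%:E)%E.
  apply: contrapT => h; apply: nlim => n _.
  apply: contrapT => h2; apply: h; exists n => k nk.
  by rewrite leNgt; apply/negP => h3; apply: h2; exists k.
have tA : `|t| + pi <= A.
  rewrite /A -natr1; have : (m%:R : R) <= m%:R * (2 * pi) by rewrite ler_peMr//; lra.
  lra.
have blk k r : (n0 <= k)%N -> 0 <= r < 1 ->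
    `|circ_sum I a (N_ k.+1) r t - circ_sum I a (N_ k) r t| <= 32 * 2^-1 ^+ k.
  move=> nk r01; rewrite -circ_sum_block//.
  by apply: circ_sum_maximal (hn0 _ nk) => //; rewrite exprn_ge0.
have blks k j r : (n0 <= k)%N -> 0 <= r < 1 ->
    `|circ_sum I a (N_ (k + j)%N) r t - circ_sum I a (N_ k) r t| <=
    64 * (2^-1 ^+ k - 2^-1 ^+ (k + j)).
  move=> nk r01; elim: j => [|j IH]; first by rewrite addn0 !subrr normr0 mulr0.
  rewrite addnS.
  have h := blk (k + j)%N r (leq_trans nk (leq_addr _ _)) r01.
  rewrite -(subrKA (circ_sum I a (N_ (k + j)%N) r t)).
  apply: le_trans (ler_normD _ _) _; apply: le_trans (lerD h IH) _.
  by rewrite [2^-1 ^+ (k + j).+1]exprS; lra.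
have tail k r : (n0 <= k)%N -> 0 <= r < 1 ->
    `|f (r *: expI I t) - circ_sum I a (N_ k) r t| <= 64 * 2^-1 ^+ k.
  move=> nk /[dup] r01 /andP[r0 r1]; apply/ler_addgt0Pl => e e0.
  have q1 : `|r *: expI I t : H| < 1 by rewrite normrZ normq_expI// mulr1 ger0_norm.
  have /cvgrPdist_le/(_ e e0)[n1 _ hn1] := fa _ q1.
  have := hn1 (N_ (k + n1)%N) (leq_trans (leq_addl k n1) (Nk _)).
  have -> : series (fun n => (r *: expI I t) ^+ n * a n) (N_ (k + n1)%N) =
      circ_sum I a (N_ (k + n1)%N) r t.
    by rewrite /series/= big_mkord; apply: eq_bigr => i _; rewrite expI_powE.
  move=> h; rewrite -(subrKA (circ_sum I a (N_ (k + n1)%N) r t)).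
  apply: le_trans (ler_normD _ _) _; apply: lerD h _.
  apply: le_trans (blks k n1 r nk r01) _.
  by rewrite ler_wpM2l// gerBl exprn_ge0.
apply: quat_cauchy => e e0.
have [K nK hK] : exists2 K, (n0 <= K)%N & 64 * (2^-1 : R) ^+ K < e / 2.
  have h : `|2^-1 : R| < 1 by rewrite gtr0_norm; lra.
  have /cvgrPdist_lt/(_ (e / 128)) := cvg_expr h.
  have -> : 0 < e / 128 by rewrite divr_gt0.
  move=> /(_ isT)[n1 _ hn1]; exists (n0 + n1)%N; first exact: leq_addr.
  have := hn1 (n0 + n1)%N (leq_addl _ _).
  rewrite /= sub0r normrN ger0_norm ?exprn_ge0//; lra.
exists (circ_sum I a (N_ K) 1 t).
have e20 : 0 < e / 2 by lra.
have := @cts_circ_sum_r R I a (N_ K) t 1.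
move=> /(@cvg_at_left_filter R H) /cvgrPdist_lt /(_ _ e20) h.
near=> r.
have r01 : 0 <= r < 1.
  apply/andP; split; first by near: r; exact: nbhs_left_ge.
  by near: r; exact: nbhs_left_lt.
have h1 := tail K r nK r01.
have h2 : `|circ_sum I a (N_ K) 1 t - circ_sum I a (N_ K) r t| < e / 2 by near: r.
rewrite /= -(subrKA (circ_sum I a (N_ K) r t)).
apply: le_lt_trans (ler_normD _ _) _; rewrite [X in _ + X]distrC; lra.
Unshelve. all: by end_near. Qed.

Lemma radial_cvg I f a M : imag_units I ->
  (forall n, \sum_(i < n) `|a i| ^+ 2 <= M) -> has_expansion f a ->
  {ae mu, forall t, exists l : H, f (r *: expI I t) @[r --> 1^'-] --> l}.
Proof.
move=> I2 aM fa.
have := negligible_bigcup (fun m => radial_cvg_window m I2 aM fa).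
apply: negligibleS => t /= nt.
exists (Num.bound `|t|) => //=; split=> //.
by rewrite ltW// (le_lt_trans _ (archi_boundP _))// ler_norm.
Qed.

End RadialLimits.

(** * Continuity on slices, measurability of radial limits, and Fatou's lemma *)

Section BoundaryValues.
Context {R : realType}.
Local Notation H := (quat R).
Local Notation mu := (@lebesgue_measure R).
Implicit Types (p q I : H) (a : nat -> H) (f : H -> H).

Lemma ler_dist3 (V : normedModType R) (x y z w : V) :
  `|x - w| <= `|x - y| + `|y - z| + `|w - z|.
Proof.
apply: le_trans (ler_distD z x w) _; rewrite [`|w - z|]distrC lerD2r.
exact: ler_distD.
Qed.

Lemma norm_slice I (r t : R) : imag_units I -> 0 <= r -> `|r *: expI I t| = r.
Proof. by move=> I2 r0; rewrite normrZ normq_expI// mulr1 ger0_norm. Qed.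

Lemma series_circ_sum I a N (r t : R) : imag_units I ->
  series (fun n => (r *: expI I t) ^+ n * a n) N = circ_sum I a N r t.
Proof.
by move=> I2; rewrite /series/= big_mkord; apply: eq_bigr => i _; rewrite expI_powE.
Qed.

Lemma circ_sum_cvg I f a (r t : R) : imag_units I -> has_expansion f a -> 0 <= r < 1 ->
  (fun N => circ_sum I a N r t) @ \oo --> f (r *: expI I t).
Proof.
move=> I2 fa /andP[r0 r1].
have := fa (r *: expI I t); rewrite norm_slice// => /(_ r1).
by rewrite (_ : series _ = (fun N => circ_sum I a N r t))//; apply/funext => N;
  rewrite series_circ_sum.
Qed.

Lemma coef_growth f a (s : R) : has_expansion f a -> 0 <= s < 1 ->
  exists2 M, 0 <= M & forall n, s ^+ n * `|a n| <= M.
Proof.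
move=> fa /andP[s0 s1]; have q1 : `|s%:A : H| < 1 by rewrite normrZ normq1 mulr1 ger0_norm.
have /cvgP/cvg_series_cvg_0/cvgP/cvg_seq_bounded := fa _ q1.
move=> /pinfty_ex_gt0[M M0 bM]; exists M; first exact: ltW.
move=> n; have := bM n Logic.I.
by rewrite /= exprZn expr1n -scalerAl mul1r normrZ ger0_norm// exprn_ge0.
Qed.

Lemma geo_tail (y : R) m n : 0 <= y < 1 ->
  \sum_(i < n) (if (m <= i)%N then y ^+ i else 0) <= y ^+ m / (1 - y).
Proof.
move=> /andP[y0 y1]; rewrite ler_pdivlMr ?subr_gt0//.
elim: n => [|n IH]; first by rewrite big_ord0 mul0r exprn_ge0.
have [mn|nm] := leqP m n.
  have -> : \sum_(i < n.+1) (if (m <= i)%N then y ^+ i else 0) =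
      \sum_(i < n.+1) y ^+ i - \sum_(i < m) y ^+ i.
    by rewrite -(sum_tail (fun i => y ^+ i))// (leq_trans mn).
  have geo k : (\sum_(i < k) y ^+ i) * (1 - y) = 1 - y ^+ k.
    elim: k => [|k IHk]; first by rewrite big_ord0 mul0r expr0 subrr.
    by rewrite big_ord_recr/= mulrDl IHk exprS; ring.
  by rewrite mulrBl !geo; have := exprn_ge0 n.+1 y0; lra.
rewrite big1 ?mul0r ?exprn_ge0// => i _.
by rewrite leqNgt (leq_trans (ltn_ord i))//=.
Qed.

(** For s halfway between rho and 1 the numbers s^n |a_n| are bounded, so on radii up to rho the
    tail is dominated by a geometric series of ratio rho/s. *)
Lemma circ_sum_uniform I f a (rho e : R) : imag_units I -> has_expansion f a ->
  0 < rho < 1 -> 0 < e -> exists N0, forall N, (N0 <= N)%N ->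
  forall r t, 0 <= r <= rho -> `|f (r *: expI I t) - circ_sum I a N r t| <= e.
Proof.
move=> I2 fa /andP[p0 p1] e0.
pose s := (1 + rho) / 2; have s01 : 0 <= s < 1 by apply/andP; split; rewrite /s; lra.
have [M M0 hM] := coef_growth fa s01.
have s0 : 0 < s by rewrite /s; lra.
pose y := rho / s.
have y01 : 0 <= y < 1.
  by apply/andP; split; [rewrite divr_ge0// ltW|rewrite ltr_pdivrMr// /s; lra].
have [y0 y1] := andP y01.
have [N0 hN0] : exists N0, forall N, (N0 <= N)%N -> M * (y ^+ N / (1 - y)) <= e.
  have h : `|y| < 1 by rewrite ger0_norm.
  have d0 : 0 < e * (1 - y) / (M + 1) by rewrite divr_gt0 ?mulr_gt0 ?subr_gt0// ltr_wpDl.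
  have /cvgrPdist_le/(_ _ d0)[N0 _ hN0] := cvg_expr h; exists N0 => N /hN0/=.
  rewrite sub0r normrN ger0_norm ?exprn_ge0// ler_pdivlMr ?ltr_wpDl// => hh.
  rewrite mulrA ler_pdivrMr ?subr_gt0//; apply: le_trans hh.
  by rewrite mulrC ler_wpM2l ?exprn_ge0// lerDl.
exists N0 => N nN r t /andP[r0 rr]; apply/ler_addgt0Pl => e' e'0.
have r01 : 0 <= r < 1 by apply/andP; split=> //; lra.
have /cvgrPdist_le/(_ e' e'0)[n1 _ hn1] := circ_sum_cvg (t := t) I2 fa r01.
have := hn1 (N + n1)%N (leq_addl _ _) => h.
rewrite -(subrKA (circ_sum I a (N + n1) r t)).
apply: le_trans (ler_normD _ _) _; apply: lerD h _.
apply: le_trans (hN0 N nN); rewrite -circ_sum_block ?leq_addr//.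
apply: le_trans (ler_norm_sum _ _ _) _.
apply: le_trans (ler_wpM2l M0 (geo_tail N (N + n1) y01)); rewrite mulr_sumr.
apply: ler_sum => i _; case: ifP => _; last by rewrite mulr0 scaler0 normr0 mulr0.
rewrite normrZ normqM normq_expI// mul1r ger0_norm ?exprn_ge0//.
rewrite /y expr_div_n mulrA ler_pdivlMr ?exprn_gt0//.
have := hM i; move: `|a i| (normr_ge0 (a i)) => x x0 hx.
have : r ^+ i <= rho ^+ i by rewrite lerXn2r ?nnegrE// ltW.
have := exprn_ge0 i r0; have := exprn_ge0 i (ltW s0).
move: (r ^+ i) (s ^+ i) (rho ^+ i) hx => u v w hx v0 u0 uw.
have : u * (v * x) <= u * M by rewrite ler_wpM2l.
have : u * M <= w * M by rewrite ler_wpM2r.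
lra.
Qed.

Lemma cts_slice I f a (r : R) : imag_units I -> has_expansion f a -> 0 <= r < 1 ->
  continuous (fun t => f (r *: expI I t)).
Proof.
move=> I2 fa /andP[r0 r1] t; apply/cvgrPdist_le => e e0.
have h : 0 < (1 + r) / 2 < 1 by apply/andP; split; lra.
have e3 : 0 < e / 3 by lra.
have [N hN] := circ_sum_uniform I2 fa h e3.
have rr : 0 <= r <= (1 + r) / 2 by apply/andP; split; lra.
have /cvgrPdist_le/(_ _ e3) := @cts_circ_sum R I a N r t.
apply: filterS => s hs; have := hN N (leqnn N) r s rr; have := hN N (leqnn N) r t rr.
move=> h1 h2.
apply: le_trans (ler_dist3 _ (circ_sum I a N r t) (circ_sum I a N r s) _) _; lra.
Qed.

Lemma cts_radius I f a (r t : R) : imag_units I -> has_expansion f a -> 0 < r < 1 ->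
  f (s *: expI I t) @[s --> r] --> f (r *: expI I t).
Proof.
move=> I2 fa /andP[r0 r1]; apply/cvgrPdist_le => e e0.
have h : 0 < (1 + r) / 2 < 1 by apply/andP; split; lra.
have e3 : 0 < e / 3 by lra.
have [N hN] := circ_sum_uniform I2 fa h e3.
have rr : 0 <= r <= (1 + r) / 2 by apply/andP; split; lra.
have /cvgrPdist_le/(_ _ e3) hc := @cts_circ_sum_r R I a N t r.
have d0 : 0 < Num.min r ((1 - r) / 2) by rewrite lt_min r0/=; lra.
near=> s.
have ss : 0 <= s <= (1 + r) / 2.
  have : `|r - s| < Num.min r ((1 - r) / 2).
    by near: s; apply/nbhs_ballP; exists (Num.min r ((1 - r) / 2)) => //= y; rewrite -ball_normE.
  rewrite lt_min => /andP[]; rewrite !ltr_norml => /andP[_ ?] /andP[? _].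
  by apply/andP; split; lra.
have h1 := hN N (leqnn N) r t rr; have h2 := hN N (leqnn N) s t ss.
have h3 : `|circ_sum I a N r t - circ_sum I a N s t| <= e / 3 by near: s.
apply: le_trans (ler_dist3 _ (circ_sum I a N r t) (circ_sum I a N s t) _) _; lra.
Unshelve. all: by end_near. Qed.

Definition rseq (j : nat) : R := 1 - (j.+2)%:R^-1.

Lemma rseq01 j : 0 < rseq j < 1.
Proof.
have h : 0 < (j.+2%:R : R)^-1 by rewrite invr_gt0.
have h2 : (j.+2%:R : R)^-1 < 1 by rewrite invf_lt1// ltr1n.
by rewrite /rseq; move: (_^-1) h h2 => x h h2; apply/andP; split; lra.
Qed.

Lemma rseq_cvg1 : rseq @ \oo --> (1 : R).
Proof.
rewrite -[X in _ --> X](subr0 1); apply: cvgB; first exact: cvg_cst.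
by have := @cvg_harmonic R; rewrite -(cvg_shiftS (@harmonic R)).
Qed.

Lemma rseq_cvg : rseq @ \oo --> (1 : R)^'-.
Proof.
move=> A hA; have h : \oo [set j | rseq j < 1 -> A (rseq j)] := rseq_cvg1 hA.
change (\oo [set j | A (rseq j)]); apply: filterS h => j; apply.
by case/andP: (rseq01 j).
Qed.

Lemma bdry_cvg_seq I f t : (exists l : H, f (r *: expI I t) @[r --> 1^'-] --> l) ->
  (fun j => f (rseq j *: expI I t)) @ \oo --> bdry f I t.
Proof.
move=> [l hl]; have -> : bdry f I t = l by apply: cvg_lim => //; exact: norm_hausdorff.
exact: cvg_comp rseq_cvg hl.
Qed.

Lemma measurable_normq_le (G : R -> H) (c : R) : continuous G ->
  measurable [set t | `|G t| <= c].
Proof.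
move=> cG; rewrite (_ : [set t | _] = setT `&` (fun t => `|G t|) @^-1` `]-oo, c]%classic).
  by apply: continuous_measurable_fun => //; exact: cts_normq.
by apply/seteqP; split=> t /=; rewrite in_itv/=; [|case].
Qed.

(** The Cauchy criterion at radius 1 is restricted to rational radii, which makes it a countable
    combination of closed conditions on the angle; continuity in the radius recovers all radii. *)
Lemma measurable_radial_limit I f a : imag_units I -> has_expansion f a ->
  measurable [set t | exists l : H, f (r *: expI I t) @[r --> 1^'-] --> l].
Proof.
move=> I2 fa.
pose ok (j : nat) (p : rat) := (1 - harmonic j < (ratr p : R)) && (0 < (ratr p : R) < 1).
(* [k] ranges over codes of pairs of rational radii; a number that codes no pair of admissible radii
   imposes no condition. *)
pose B (m j k : nat) := if (unpickle k : option (rat * rat)) is Some pq then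
   if ok j pq.1 && ok j pq.2 then
     [set t | `|f ((ratr pq.1 : R) *: expI I t) - f ((ratr pq.2 : R) *: expI I t)| <= harmonic m]
   else setT else setT.
rewrite (_ : [set t | _] = \bigcap_m \bigcup_j \bigcap_k B m j k); last first.
  apply/seteqP; split=> t.
    move=> [l hl] m _; have e0 : 0 < (harmonic m : R) / 2 by rewrite divr_gt0// /harmonic/= invr_gt0.
    move/cvgrPdist_le: hl => /(_ _ e0)[d /= d0 hd].
    have [j hj] : exists j, (harmonic j : R) < d.
      have /cvgrPdist_lt/(_ _ d0)[j _ hj] := @cvg_harmonic R; exists j.
      by have := hj j (leqnn j); rewrite sub0r normrN ger0_norm// /harmonic/= invr_ge0.
    exists j => // k _; rewrite /B; case: (unpickle k) => // -[p q] /=.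
    case: ifP => // /andP[/andP[p1 /andP[p2 p3]] /andP[h1 /andP[h2 h3]]] /=.
    have hp : `|l - f ((ratr p : R) *: expI I t)| <= harmonic m / 2.
      by apply: hd => //; rewrite /ball_/= ger0_norm; lra.
    have hq : `|l - f ((ratr q : R) *: expI I t)| <= harmonic m / 2.
      by apply: hd => //; rewrite /ball_/= ger0_norm; lra.
    rewrite -(subrKA l); apply: le_trans (ler_normD _ _) _.
    rewrite [X in X + _]distrC.
    have -> : (m.+1%:R^-1 : R) = harmonic m by [].
    lra.
  move=> ht; apply: quat_cauchy => e e0.
  have [m hm] : exists m, (harmonic m : R) < e / 2.
    have e20 : 0 < e / 2 by lra.
    have /cvgrPdist_lt/(_ _ e20)[m _ hm] := @cvg_harmonic R; exists m.
    by have := hm m (leqnn m); rewrite sub0r normrN ger0_norm// /harmonic/= invr_ge0.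
  have [j _ hj] := ht m Logic.I.
  have j1 : (harmonic j : R) <= 1 by rewrite /harmonic/= invf_le1// ler1n.
  have j0 : 0 < (harmonic j : R) by rewrite /harmonic/= invr_gt0.
  have rat_ex x y : x < y -> exists p : rat, x < (ratr p : R) < y.
    by move=> /rat_in_itvoo[p]; rewrite in_itv/= => hp; exists p.
  have [q hq] : exists q : rat, 1 - harmonic j < (ratr q : R) < 1 by apply: rat_ex; lra.
  have okq : ok j q by move: hq => /andP[h1 h2]; rewrite /ok h1 h2 !andbT/=; lra.
  exists (f ((ratr q : R) *: expI I t)).
  near=> r.
  have rj : 1 - harmonic j < r by near: r; apply: nbhs_left_gt; lra.
  have r1 : r < 1 by near: r; exact: nbhs_left_lt.
  have r01 : 0 < r < 1 by apply/andP; split; lra.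
  have e4 : 0 < e / 4 by lra.
  have /cvgrPdist_le/(_ _ e4)[d /= d0 hd] := cts_radius (t := t) I2 fa r01.
  have [p hp] : exists p : rat, Num.max (1 - harmonic j) (r - d) < (ratr p : R) < r.
    by apply: rat_ex; rewrite gt_max rj/=; lra.
  move: hp; rewrite gt_max => /andP[/andP[p1 p2] p3].
  have h1 : `|f (r *: expI I t) - f ((ratr p : R) *: expI I t)| <= e / 4.
    by apply: hd; rewrite /= ger0_norm; lra.
  have okp : ok j p by apply/andP; split=> //; apply/andP; split; lra.
  have := hj (pickle (p, q)) Logic.I; rewrite /B pickleK /= okp okq/=.
  have -> : (m.+1%:R^-1 : R) = harmonic m by [].
  move=> h2.
  rewrite /= -(subrKA (f ((ratr p : R) *: expI I t))).
  by apply: le_lt_trans (ler_normD _ _) _; lra.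
apply: bigcapT_measurable => m; apply: bigcupT_measurable => j.
apply: bigcapT_measurable => k; rewrite /B; case: (unpickle k) => [[p q]|//] /=.
case: ifP => // /andP[/andP[_ /andP[p1 p2]] /andP[_ /andP[h1 h2]]].
apply: measurable_normq_le; apply: ctsHB.
  by apply: cts_slice I2 fa _; rewrite (ltW p1).
by apply: cts_slice I2 fa _; rewrite (ltW h1).
Unshelve. all: by end_near. Qed.

Lemma measurable_bdry_q1 I f a c : imag_units I -> has_expansion f a ->
  measurable_fun setT (fun t => q1 (bdry f I t * c)).
Proof.
move=> I2 fa; set E := [set t | exists l : H, f (r *: expI I t) @[r --> 1^'-] --> l].
have mE : measurable E by exact: measurable_radial_limit I2 fa.
rewrite -(setUv E); apply/measurable_funU => //; first exact: measurableC.
split.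
  apply: (@measurable_fun_cvg _ _ _ _ (fun j t => q1 (f (rseq j *: expI I t) * c))).
    move=> j; apply: measurable_funTS; apply: continuous_measurable_fun.
    apply: cts_comp_q1; apply: ctsHMr; apply: cts_slice I2 fa _.
    by have /andP[/ltW -> ->] := rseq01 j.
  move=> t Et; apply: cvg_comp_q1; apply: cvg_mulqr.
  exact: bdry_cvg_seq.
(* Where no radial limit exists, [lim] is the default value [point], so the function is constant
   there. *)
apply: (eq_measurable_fun (cst (q1 ((point : H) * c)))); last exact: measurable_cst.
move=> t; rewrite inE => nE; rewrite /cst; congr (q1 (_ * c)).
apply/esym/getPN => l hl; apply: nE; exists l; exact: hl.
Qed.

Lemma measurable_normq_bdryB I f a (c : R -> H) : imag_units I -> has_expansion f a ->
  continuous c -> measurable_fun setT (fun t => `|bdry f I t - c t|).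
Proof.
move=> I2 fa cc.
have m1 u : measurable_fun setT (fun t => q1 ((bdry f I t - c t) * u)).
  under eq_fun do rewrite mulrBl q1B.
  apply: measurable_funB => //; first exact: measurable_bdry_q1 I2 fa.
  by apply: continuous_measurable_fun; apply: (@cts_comp_q1 R _ (fun t => c t * u)); exact: ctsHMr.
under eq_fun do rewrite normq_sqrtE qi_q1 qj_q1 qk_q1 -[X in X ^+ 2 + _]mulr1.
apply: (@measurableT_comp _ _ _ _ _ _ (@Num.sqrt R)); last first.
  have h1 := m1 1; rewrite (_ : (fun t => _) = (fun t => q1 (bdry f I t - c t))) in h1; last first.
    by apply/funext => t; rewrite mulr1.
  by do 3 (apply: measurable_funD; last exact: measurable_funX); under eq_fun do rewrite mulr1;
    apply: measurable_funX.
by apply: continuous_measurable_fun; exact: sqrt_continuous.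
Qed.

Lemma measurable_normq_bdry I f a c : imag_units I -> has_expansion f a ->
  measurable_fun setT (fun t => `|bdry f I t - c|).
Proof. by move=> I2 fa; apply: measurable_normq_bdryB I2 fa _; exact: ctsH_cst. Qed.

Lemma fatou_circ (G : nat -> R -> R) (g : R -> R) (u v K : R) :
  (forall j, continuous (G j)) -> (forall j t, 0 <= G j t) ->
  measurable_fun setT g -> (forall t, 0 <= g t) ->
  {ae mu, forall t, (fun j => G j t) @ \oo --> g t} ->
  (forall j, itg u v (G j) <= K) ->
  (\int[mu]_(t in `[u, v]) (g t)%:E <= K%:E)%E.
Proof.
move=> cG G0 mg g00 gcv GK.
pose F (j : nat) t : \bar R := (G j t)%:E.
have mF j : measurable_fun `[u, v] (F j).
  apply/measurable_EFinP; apply: measurable_funTS; exact: continuous_measurable_fun.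
have F0 j t : `[u, v]%classic t -> (0 <= F j t)%E by move=> _; rewrite lee_fin.
(* The lower limit is minus the upper limit of [- F], whose measurability is available. *)
have mL : measurable_fun `[u, v] (fun t => limn_einf (F ^~ t)).
  have h := @measurable_fun_limn_esup _ _ R `[u, v]%classic (fun j t => (- F j t)%E)
    (fun j => measurableT_comp (@oppe_measurable R setT) (mF j)).
  exact: measurableT_comp (@oppe_measurable R setT) h.
have L0 t : `[u, v]%classic t -> (0 <= limn_einf (F ^~ t))%E.
  move=> _; rewrite limn_einf_lim; apply: lime_ge; first exact: is_cvg_einfs.
  by apply: nearW => n; apply: le_ereal_inf_tmp => _ [k _ <-]; rewrite lee_fin.
have g0 : {ae mu, forall t, `[u, v]%classic t -> ((g t)%:E <= limn_einf (F ^~ t))%E}.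
  case: gcv => N [mN N0 hN]; exists N; split=> // t /= /not_implyP[tuv ht]; apply: hN => /= gt.
  apply: ht.
  have h : (fun j => F j t) @ \oo --> (g t)%:E by apply: cvg_EFin gt; apply: nearW.
  by rewrite is_cvg_limn_einfE ?(cvg_lim _ h)//; apply/cvg_ex; eexists; exact: h.
apply: (@le_trans _ _ (\int[mu]_(t in `[u, v]) limn_einf (F ^~ t))%E).
  apply: ae_ge0_le_integral => //; first by move=> t _; rewrite lee_fin.
  by apply/measurable_EFinP; apply: measurable_funTS.
have h : (\int[mu]_(t in `[u, v]) limn_einf (F ^~ t) <=
    limn_einf (fun j => \int[mu]_(t in `[u, v]) F j t))%E by apply: fatou.
apply: le_trans h _.
rewrite limn_einf_lim; apply: lime_le; first exact: is_cvg_einfs.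
apply: nearW => n; apply: le_trans (ereal_inf_lbound _) _; first by exists n => //=.
by rewrite /F itgE// lee_fin.
Qed.

End BoundaryValues.

(** * From functionals to bounded mean oscillation *)

Section FunctionalToBMOA.
Context {R : realType}.
Local Notation H := (quat R).
Local Notation mu := (@lebesgue_measure R).
Implicit Types (p q I : H) (a b : nat -> H) (f : H -> H).

Lemma itg_opp (g : R -> R) (c : R) : 0 <= c -> continuous g ->
  itg (- c) c (fun t => g (- t)) = itg (- c) c g.
Proof.
move=> c0 cg; rewrite /itg /Rintegral; congr fine.
have := @integration_by_substitution_oppr R g (- c) c.
rewrite opprK => <-//; first lra.
exact: continuous_subspaceT.
Qed.

Lemma circle_meanE f a I (r : R) : imag_units I -> has_expansion f a -> 0 <= r < 1 ->
  circle_mean f I r = ((2 * pi)^-1 * itg (- pi) pi (fun t => `|f (r *: expI I t)|))%:E.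
Proof.
move=> I2 fa r01; rewrite /circle_mean itgE//.
by apply: cts_normq; exact: cts_slice I2 fa r01.
Qed.

Lemma has_expansionD f g a b : has_expansion f a -> has_expansion g b ->
  has_expansion (fun q => f q + g q) (fun n => a n + b n).
Proof.
move=> fa gb q q1; rewrite (_ : series _ = series (fun n => q ^+ n * a n) +
   series (fun n => q ^+ n * b n)); first by apply: cvgD; [exact: fa|exact: gb].
apply/funext => n; rewrite /series /= fctE -big_split/=; apply: eq_bigr => i _.
by rewrite mulrDr.
Qed.

Lemma has_expansionMr f a p : has_expansion f a ->
  has_expansion (fun q => f q * p) (fun n => a n * p).
Proof.
move=> fa q q1; rewrite (_ : series _ = (fun N => series (fun n => q ^+ n * a n) N * p)).
  by apply: cvg_mulqr; exact: fa.
by apply/funext => n; rewrite /series /= mulr_suml; apply: eq_bigr => i _; rewrite mulrA.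
Qed.

Lemma has_expansion_monomial k p :
  has_expansion (fun q => q ^+ k * p) (fun n => if n == k then p else 0).
Proof.
move=> q q1; apply: cvg_near_cst; exists k.+1 => // N /= kN.
rewrite /series/= big_mkord (bigD1 (Ordinal kN))//= eqxx big1 ?addr0//.
by move=> i /negbTE; rewrite -val_eqE/= => ->; rewrite mulr0.
Qed.

Lemma cvg_sqr (T : Type) (F : set_system T) (g : T -> R) (l : R) : Filter F ->
  g @ F --> l -> (fun t => g t ^+ 2) @ F --> l ^+ 2.
Proof. by move=> FF h; under eq_cvg do rewrite expr2; rewrite expr2; exact: cvgM. Qed.

(** A polynomial given as a list of monomials with repeated exponents allowed: the test function is
    naturally a double sum, and linearity of [L] is used by induction on the list. *)
Definition mono_sum (s : seq (nat * H)) : H -> H := fun q => \sum_(x <- s) q ^+ x.1 * x.2.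

Lemma mono_sum_regular s : regular (mono_sum s).
Proof.
elim: s => [|[k p] s [a ha]].
  exists (fun=> 0) => q _; rewrite /mono_sum big_nil.
  rewrite (_ : series _ = cst 0); first exact: cvg_cst.
  by apply/funext => n; rewrite /series/= big1// => i _; rewrite mulr0.
exists (fun n => (if n == k then p else 0) + a n).
have := has_expansionD (@has_expansion_monomial k p) ha.
by rewrite (_ : (fun q => _) = mono_sum ((k, p) :: s))//; apply/funext => q; rewrite /mono_sum big_cons.
Qed.

Lemma mono_sum_le s q : `|q| <= 1 -> `|mono_sum s q| <= \sum_(x <- s) `|x.2|.
Proof.
move=> q1; apply: le_trans (ler_norm_sum _ _ _) _; apply: ler_sum => x _.
rewrite normqM ler_piMl//; elim: x.1 => [|n IH]; first by rewrite expr0 normq1.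
by rewrite exprS normqM mulr_ile1.
Qed.

(** With real radius and angle, the value on the slice of [K] is A + K B where A and B do not depend
    on [K]. On the slice of [I], 2A and 2IB are the sum and the difference of the values at t and
    -t. *)
Lemma mono_sum_slice s I K (r t : R) : imag_units I -> imag_units K ->
  `|mono_sum s (r *: expI K t)| <=
  `|mono_sum s (r *: expI I t)| + `|mono_sum s (r *: expI I (- t))|.
Proof.
move=> I2 K2.
pose A := \sum_(x <- s) (r ^+ x.1 * cos (x.1%:R * t)) *: x.2.
pose B := \sum_(x <- s) (r ^+ x.1 * sin (x.1%:R * t)) *: x.2.
have h J (u : R) : imag_units J -> mono_sum s (r *: expI J u) =
    \sum_(x <- s) (r ^+ x.1 * cos (x.1%:R * u)) *: x.2 +
    J * \sum_(x <- s) (r ^+ x.1 * sin (x.1%:R * u)) *: x.2.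
  move=> J2; rewrite mulr_sumr -big_split/=; apply: eq_bigr => x _.
  rewrite expI_powE// /expI mulrDl scalerDr -!scalerAl mul1r -scalerAr !scalerA.
  by [].
have hA : A *+ 2 = mono_sum s (r *: expI I t) + mono_sum s (r *: expI I (- t)).
  rewrite !h// -/A -/B.
  rewrite (_ : \sum_(x <- s) (r ^+ x.1 * cos _) *: x.2 = A); last first.
    by apply: eq_bigr => x _; rewrite mulrN cosN.
  rewrite (_ : \sum_(x <- s) (r ^+ x.1 * sin (x.1%:R * - t)) *: x.2 = - B); last first.
    by rewrite -sumrN; apply: eq_bigr => x _; rewrite mulrN sinN mulrN scaleNr.
  by rewrite mulrN addrACA subrr addr0 mulr2n.
have hB : (I * B) *+ 2 = mono_sum s (r *: expI I t) - mono_sum s (r *: expI I (- t)).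
  rewrite !h// -/A -/B.
  rewrite (_ : \sum_(x <- s) (r ^+ x.1 * cos (x.1%:R * - t)) *: x.2 = A); last first.
    by apply: eq_bigr => x _; rewrite mulrN cosN.
  rewrite (_ : \sum_(x <- s) (r ^+ x.1 * sin (x.1%:R * - t)) *: x.2 = - B); last first.
    by rewrite -sumrN; apply: eq_bigr => x _; rewrite mulrN sinN mulrN scaleNr.
  by rewrite mulrN opprD opprK addrACA subrr add0r mulr2n.
rewrite h// -/A -/B; move: (mono_sum s _) (mono_sum s _) hA hB => x y hA hB.
have nA : `|A| * 2 <= `|x| + `|y|.
  by rewrite [`|x| + _]addrC mulr_natr -normrMn hA ler_normD.
have nB : `|B| * 2 <= `|x| + `|y|.
  have -> : `|B| = `|I * B| by rewrite normqM norm_imag_units// mul1r.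
  by rewrite [`|x| + _]addrC mulr_natr -normrMn hB ler_normB.
apply: le_trans (ler_normD _ _) _; rewrite normqM norm_imag_units// mul1r; lra.
Qed.

Lemma cts_mono_sum s I (r : R) : imag_units I -> continuous (fun t => mono_sum s (r *: expI I t)).
Proof.
rewrite /mono_sum => I2; under eq_fun do under eq_bigr do rewrite expI_powE//.
apply: ctsH_sum => x; apply: ctsHZ; first exact: cts_cst.
apply: ctsHMr; apply: cts_expI; apply: ctsM; [exact: cts_cst|exact: cts_id].
Qed.

Lemma mono_sum_H1_norm s I (k : R) : imag_units I ->
  (forall r, 0 < r < 1 -> itg (- pi) pi (fun t => `|mono_sum s (r *: expI I t)|) <= 2 * pi * k) ->
  (H1_norm (mono_sum s) <= (2 * k)%:E)%E.
Proof.
move=> I2 hk; have pi0 := @pi_gt0 R.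
apply: ge_ereal_sup => _ [[K r] [/= K2 +] <-]; rewrite in_itv/= => r01.
have [a ha] := mono_sum_regular s.
rewrite (circle_meanE K2 ha); last by move: r01 => /andP[/ltW -> ->].
have c1 J : imag_units J -> continuous (fun t => `|mono_sum s (r *: expI J t)|).
  by move=> J2; apply: cts_normq; exact: cts_mono_sum.
have c2 : continuous (fun t => `|mono_sum s (r *: expI I (- t))|).
  by apply: (@cts_comp _ _ (fun t => `|mono_sum s (r *: expI I t)|)); [exact: c1|exact: ctsN cts_id].
rewrite lee_fin mulrC ler_pdivrMr ?mulr_gt0//.
apply: le_trans (_ : itg (- pi) pi (fun t => `|mono_sum s (r *: expI I t)| +
   `|mono_sum s (r *: expI I (- t))|) <= _).
  apply: le_itg; [exact: c1|by apply: ctsD => //; exact: c1|].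
  by move=> t _; exact: mono_sum_slice.
rewrite itgD//; last exact: c1.
rewrite (itg_opp (ltW pi0) (c1 I I2)); have := hk r r01; lra.
Qed.

Lemma mono_sum_in_H1 s : in_H1 (mono_sum s).
Proof.
split; first exact: mono_sum_regular.
have I2 : imag_units (Quat 0 1 0 0 : H) by apply: quatP => /=; ring.
have pi0 := @pi_gt0 R.
apply: le_lt_trans (mono_sum_H1_norm (k := \sum_(x <- s) `|x.2|) I2 _) (ltry _).
move=> r /andP[r0 r1].
have -> : 2 * pi * \sum_(x <- s) `|x.2| = itg (- pi) pi (fun=> \sum_(x <- s) `|x.2|).
  by rewrite itg_cst; [ring|lra].
apply: le_itg; [by apply: cts_normq; exact: cts_mono_sum|exact: cts_cst|].
by move=> t _; apply: mono_sum_le; rewrite norm_slice// ltW.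
Qed.

Section Functional.
Variables (L : (H -> H) -> H) (C : R).
Hypothesis Llin : forall f g (c : H), in_H1 f -> in_H1 g ->
  L (fun q => f q * c + g q) = L f * c + L g.
Hypothesis C0 : 0 < C.
Hypothesis LC : forall f, in_H1 f -> (`|L f|%:E <= C%:E * H1_norm f)%E.

Definition dual_coef (n : nat) : H := conjq (L (fun q => q ^+ n)).

Lemma functional_mono_sum s : L (mono_sum s) = \sum_(x <- s) conjq (dual_coef x.1) * x.2.
Proof.
have h0 : mono_sum [::] = fun=> 0 by apply/funext => q; rewrite /mono_sum big_nil.
have L0 : L (fun=> 0) = 0.
  have := Llin 1 (mono_sum_in_H1 [::]) (mono_sum_in_H1 [::]); rewrite h0.
  rewrite (_ : (fun q : H => 0 * 1 + 0) = (fun=> 0)); last by apply/funext => q; rewrite mul0r addr0.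
  by rewrite mulr1 => /eqP; rewrite -subr_eq0 opprD addNKr oppr_eq0 => /eqP.
elim: s => [|[k p] s IH]; first by rewrite h0 L0 big_nil.
have h1 : (fun q : H => q ^+ k) = mono_sum [:: (k, 1)].
  by apply/funext => q; rewrite /mono_sum big_seq1 mulr1.
have := Llin p (mono_sum_in_H1 [:: (k, 1)]) (mono_sum_in_H1 s).
rewrite -h1 big_cons -IH /dual_coef conjqK => <-; congr L.
by apply/funext => q; rewrite /mono_sum big_cons.
Qed.

Lemma functional_mono_sum_le s I (k : R) : imag_units I ->
  (forall r, 0 < r < 1 -> itg (- pi) pi (fun t => `|mono_sum s (r *: expI I t)|) <= 2 * pi * k) ->
  `|\sum_(x <- s) conjq (dual_coef x.1) * x.2| <= 2 * C * k.
Proof.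
move=> I2 hk; rewrite -functional_mono_sum.
have := LC (mono_sum_in_H1 s) => /le_trans /(_ (lee_wpmul2l _ (mono_sum_H1_norm I2 hk))).
have -> : (0 <= C%:E)%E by rewrite lee_fin ltW.
by move=> /(_ isT); rewrite -EFinM lee_fin; have -> : C * (2 * k) = 2 * C * k by ring.
Qed.

(* The coefficients of (F - F(rho)) / (z - rho) for F = sum z^n a_n are the
   numbers [shift_sum a rho M (j + 1)] with M infinite. *)
Definition shift_sum a (rho : R) M j : H := \sum_(k < M) rho ^+ k *: a (j + k)%N.

(* Testing on z G(z) / (1 - rho z), where G = (F - F(rho)) / (z - rho), gives
   the squared norm of G on the left and at most a multiple of the norm of G
   on the right. *)
Lemma dual_coef_shift_sum I (phi s rho : R) M a : imag_units I ->
  a = (fun n => s ^+ n *: (expI I (n%:R * phi) * dual_coef n)) ->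
  0 <= s <= 1 -> 0 <= rho < 1 ->
  (1 - rho ^+ 2) * \sum_(j < M) `|shift_sum a rho M j.+1| ^+ 2 <= 4 * C ^+ 2.
Proof.
move=> I2 aE /andP[s0 s1] /andP[rho0 rho1]; have pi0 := @pi_gt0 R.
pose g j := shift_sum a rho M j.+1.
(* The monomials of z G(z) times the truncated series of 1/(1 - rho z), dilated by [s] and rotated
   by [phi]. Paired with the dual coefficients they recombine into rho^k conj(a_(j+k+1)) g_j, whose
   sum over [k] is |g_j|^2. *)
pose x (j k : nat) : nat * H := ((j + k).+1,
  s ^+ (j + k).+1 *: (expI I (- ((j + k).+1%:R * phi)) * (rho ^+ k *: g j))).
pose l := [seq x j k | j <- iota 0 M, k <- iota 0 M].
set S := \sum_(j < M) _.
have sumE (V : zmodType) (F : nat * H -> V) : \sum_(y <- l) F y = \sum_(j < M) \sum_(k < M) F (x j k).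
  rewrite big_allpairs_dep/= -(big_mkord predT (fun j => \sum_(k < M) F (x j k))) /index_iota subn0.
  by apply: eq_bigr => j _; rewrite -(big_mkord predT (fun k => F (x j k))) /index_iota subn0.
have hS : \sum_(y <- l) conjq (dual_coef y.1) * y.2 = S%:A.
  rewrite sumE /S scaler_suml; apply: eq_bigr => j _.
  rewrite -conjq_mul -/(g j).
  have -> : conjq (g j) = \sum_(k < M) rho ^+ k *: conjq (a (j.+1 + k)%N).
    by rewrite /g /shift_sum conjq_sum; apply: eq_bigr => k _; rewrite conjqZ.
  rewrite mulr_suml; apply: eq_bigr => k _ /=.
  rewrite addSn aE conjqZ conjqM conj_expI// -!scalerAr -!scalerAl !scalerA mulrA.
  by rewrite [s ^+ _ * _]mulrC.
have T0 : 0 < 1 - rho ^+ 2 by rewrite subr_gt0 expr_lt1.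
pose T := (1 - rho ^+ 2)^-1.
have hT r : 0 <= r <= 1 -> \sum_(k < M) `|(r ^+ k *: (rho ^+ k)%:A : H)| ^+ 2 <= T.
  move=> /andP[r0 r1].
  apply: (@le_trans _ _ (\sum_(k < M) (if (0 <= k)%N then (rho ^+ 2) ^+ k else 0))).
    apply: ler_sum => k _; rewrite scalerA normrZ normq1 mulr1 normrM exprMn !ger0_norm ?exprn_ge0//.
    rewrite -[rho ^+ 2 ^+ k]exprM [(2 * k)%N]mulnC exprM ler_piMl ?exprn_ge0// -exprM.
    by rewrite exprn_ile1.
  have h : 0 <= rho ^+ 2 < 1 by rewrite exprn_ge0//= expr_lt1.
  by have := geo_tail 0 M h; rewrite expr0 mul1r.
have hG r : 0 <= r <= 1 -> \sum_(j < M) `|r ^+ j *: g j| ^+ 2 <= S.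
  move=> /andP[r0 r1]; apply: ler_sum => j _.
  rewrite normrZ exprMn ler_piMl ?exprn_ge0// ger0_norm ?exprn_ge0// -exprM.
  by rewrite exprn_ile1.
(* On the circle |KG| <= C |K|^2 + |G|^2 / (4C), where the mean of |K|^2 is at most [T] and that of
   |G|^2 at most [S]. Times the bound 2C of the functional this is 2 C^2 T + S/2, and half of [S] is
   absorbed on the left. *)
have := functional_mono_sum_le (s := l) (k := (2 * C * T + S / (2 * C)) / 2) I2.
have S0 : 0 <= S by apply: sumr_ge0 => j _; rewrite exprn_ge0.
rewrite hS normrZ normq1 mulr1 (ger0_norm S0) => h.
have : S <= 4 * C ^+ 2 * T.
  suff : S <= 2 * C * ((2 * C * T + S / (2 * C)) / 2).
    have -> : 2 * C * ((2 * C * T + S / (2 * C)) / 2) = 2 * C ^+ 2 * T + S / 2.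
      by field; rewrite gt_eqF.
    lra.
  apply: h => r /andP[r0 r1].
  have rs : 0 <= r * s <= 1 by rewrite mulr_ge0 ?(ltW r0)//= mulr_ile1// ltW.
  pose K t := circ_sum I (fun k => (rho ^+ k)%:A) M (r * s) t.
  pose G t := circ_sum I g M (r * s) t.
  have e t : `|mono_sum l (r *: expI I t)| = (r * s) * `|K (t - phi)| * `|G (t - phi)|.
    have -> : r * s = `|(r * s) *: expI I (t - phi)|.
      by rewrite normrZ normq_expI// mulr1 ger0_norm//; case/andP: rs.
    rewrite -!normqM; congr `|_|.
    rewrite /mono_sum sumE {1}/G /circ_sum mulr_sumr; apply: eq_bigr => j _.
    rewrite /K /circ_sum mulr_sumr mulr_suml; apply: eq_bigr => k _ /=.
    rewrite expI_powE// -!scalerAr -!scalerAl -?scalerAr -?scalerAl -?scalerAr !scalerA mulr1.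
    rewrite !mulrA -!expID//; congr (_ *: (expI I _ * _)).
      by rewrite !exprS !exprD !exprMn; ring.
    by rewrite -natr1 natrD; ring.
  under eq_itg do rewrite e.
  have cK : continuous K by exact: cts_circ_sum.
  have cG : continuous G by exact: cts_circ_sum.
  pose F u := C * `|K u| ^+ 2 + (4 * C)^-1 * `|G u| ^+ 2.
  have cF1 : continuous (fun u => C * `|K u| ^+ 2).
    by apply: ctsM; [exact: cts_cst|apply: cts_exp; exact: cts_normq].
  have cF2 : continuous (fun u => (4 * C)^-1 * `|G u| ^+ 2).
    by apply: ctsM; [exact: cts_cst|apply: cts_exp; exact: cts_normq].
  have cF : continuous F by exact: ctsD.
  have csh : continuous (fun t : R => t - phi) by apply: ctsB; [exact: cts_id|exact: cts_cst].
  apply: (@le_trans _ _ (itg (- pi) pi (fun t => F (t - phi)))).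
    apply: le_itg.
    - apply: ctsM; first (apply: ctsM; first exact: cts_cst);
      by apply: (@cts_comp _ _ (fun u => `|_ u|)) => //; exact: cts_normq.
    - exact: cts_comp.
    move=> t _; rewrite /F; move: (K _) (G _) => k' g'.
    have := normr_ge0 k'; have := normr_ge0 g'; move: `|k'| `|g'| => u v v0 u0.
    apply: (@le_trans _ _ (u * v)).
      by rewrite -mulrA ler_piMl ?mulr_ge0//; case/andP: rs.
    have -> : C * u ^+ 2 + (4 * C)^-1 * v ^+ 2 = u * v + (4 * C)^-1 * (2 * C * u - v) ^+ 2.
      by field; rewrite gt_eqF.
    by rewrite lerDl mulr_ge0 ?sqr_ge0// invr_ge0 mulr_ge0// ltW.
  rewrite -itg_shift//; last lra.
  have -> : pi - phi = (- pi - phi) + 2 * pi by ring.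
  have eK u : `|K u| = `|circ_sum I (fun k => (r * s) ^+ k *: (rho ^+ k)%:A) M 1 u|.
    by rewrite /K circ_sum_radius.
  have eG u : `|G u| = `|circ_sum I (fun k => (r * s) ^+ k *: g k) M 1 u|.
    by rewrite /G circ_sum_radius.
  rewrite itgD// !itgZ; try by apply: cts_exp; exact: cts_normq.
  under eq_itg do rewrite eK.
  under [X in _ + _ * X]eq_itg do rewrite eG.
  rewrite !parseval//.
  have h1 := hT _ rs; have h2 := hG _ rs.
  have -> : 2 * pi * ((2 * C * T + S / (2 * C)) / 2) =
     C * (2 * pi * T) + (4 * C)^-1 * (2 * pi * S) by field; rewrite gt_eqF.
  have pi2 : 0 <= 2 * pi :> R by lra.
  by apply: lerD; rewrite ler_wpM2l ?invr_ge0 ?mulr_ge0 ?(ltW C0)// ler_wpM2l.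
by rewrite /T ler_pdivlMr// mulrC.
Qed.

(** The case rho = 0, where [shift_sum] collapses to the single coefficient of index j + 1, gives 4
    C^2. The coefficient of index 0 is missed by that test and contributes another (2C)^2, from the
    constant function 1. *)
Lemma dual_coef_l2 N : \sum_(n < N) `|dual_coef n| ^+ 2 <= 8 * C ^+ 2.
Proof.
have I2 : imag_units (Quat 0 1 0 0 : H) by apply: quatP => /=; ring.
have pi0 := @pi_gt0 R.
have c0 : `|dual_coef 0| <= 2 * C.
  have := functional_mono_sum_le (s := [:: (0%N, 1)]) (k := 1) I2.
  rewrite big_seq1/= (mulr1 (conjq _)) norm_conjq (mulr1 (2 * C)); apply=> r _.
  under eq_itg do rewrite /mono_sum big_seq1/= expr0 mulr1 normq1.
  by rewrite itg_cst; lra.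
have h : \sum_(j < N) `|dual_coef j.+1| ^+ 2 <= 4 * C ^+ 2.
  case: N => [|N]; first by rewrite big_ord0 mulr_ge0// sqr_ge0.
  have := @dual_coef_shift_sum (Quat 0 1 0 0) 0 1 0 N.+1 dual_coef I2 _.
  rewrite expr0n subr0 mul1r !lexx ler01 ltr01 => /(_ _ isT isT) h.
  apply: le_trans (h _); last first.
    by apply/funext => n; rewrite mulr0 expI0 mul1r expr1n scale1r.
  rewrite le_eqVlt; apply/orP; left; apply/eqP; apply: eq_bigr => j _.
  rewrite /shift_sum big_ord_recl expr0 scale1r addn0 big1 ?addr0//.
  by move=> i _; rewrite expr0n scale0r.
have : \sum_(n < N) `|dual_coef n| ^+ 2 <= \sum_(n < N.+1) `|dual_coef n| ^+ 2.
  by rewrite big_ord_recr/= lerDl exprn_ge0.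
rewrite big_ord_recl/= => h2; apply: le_trans h2 _.
have : `|dual_coef 0| ^+ 2 <= (2 * C) ^+ 2 by rewrite lerXn2r ?nnegrE// mulr_ge0// ltW.
rewrite exprMn; under eq_bigr do rewrite /bump/= add1n; lra.
Qed.

Lemma shift_sum_step a rho M j :
  rho *: shift_sum a rho M j.+1 = shift_sum a rho M j - a j + rho ^+ M *: a (j + M)%N.
Proof.
have : \sum_(k < M.+1) rho ^+ k *: a (j + k)%N = a j + rho *: shift_sum a rho M j.+1.
  rewrite big_ord_recl expr0 scale1r addn0 /shift_sum scaler_sumr; congr (_ + _).
  by apply: eq_bigr => k _; rewrite scalerA -exprS lift0 addnS addSn.
rewrite big_ord_recr/= -/(shift_sum a rho M j) => h.
by rewrite addrAC h addrAC subrr add0r.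
Qed.

(** The identity (z - rho) G(z) = F(z) - F(rho) for truncated sums. The two additional terms come
    from the truncation and involve only coefficients of index at least [M]. *)
Lemma shift_sum_mul I a rho M t : imag_units I ->
  (expI I t - rho%:A) * circ_sum I (fun j => shift_sum a rho M j.+1) M 1 t =
  circ_sum I a M 1 t - shift_sum a rho M 0 + expI I (M%:R * t) * shift_sum a rho M M -
  \sum_(j < M) rho ^+ M *: (expI I (j%:R * t) * a (j + M)%N).
Proof.
move=> I2; pose c j := shift_sum a rho M j.
have e (j : nat) : (expI I t - rho%:A) * (expI I (j%:R * t) * c j.+1) =
   (expI I (j.+1%:R * t) * c j.+1 - expI I (j%:R * t) * c j) +
   expI I (j%:R * t) * a j - rho ^+ M *: (expI I (j%:R * t) * a (j + M)%N).
  rewrite mulrBl mulrA -expID//.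
  have -> : t + j%:R * t = j.+1%:R * t by rewrite -natr1; ring.
  rewrite -scalerAl mul1r scalerAr shift_sum_step -/(c j) mulrDr mulrBr -scalerAr.
  by rewrite opprD opprB -!addrA; congr (_ + _); rewrite !addrA; congr (_ - _); rewrite addrC.
rewrite /circ_sum mulr_sumr.
under eq_bigr do rewrite expr1n scale1r e.
rewrite sumrB big_split/=; congr (_ - _).
under [X in _ = X - _ + _]eq_bigr do rewrite expr1n scale1r.
rewrite -(big_mkord predT (fun j => expI I (j.+1%:R * t) * c j.+1 - expI I (j%:R * t) * c j)).
rewrite (telescope_sumr (fun j => expI I (j%:R * t) * c j))// mul0r expI0 mul1r.
by rewrite addrC addrA addrAC -/(c 0%N).
Qed.

(** Since |e^(it) - rho|^2 is the denominator of the Poisson kernel, the truncated integrand equals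
    (1 - rho^2) |G|^2, which Parseval and [dual_coef_shift_sum] control. Dilating by s < 1 makes the
    truncation terms decay geometrically, and Fatou's lemma removes the truncation. *)
Lemma garsia_dual I f (phi s rho : R) : imag_units I -> has_expansion f dual_coef ->
  0 < s < 1 -> 0 <= rho < 1 ->
  itg (- pi) pi (fun t => poisson rho t *
    `|f (s *: expI I (t + phi)) - f ((rho * s) *: expI I phi)| ^+ 2) <= 2 * pi * (4 * C ^+ 2).
Proof.
move=> I2 fb /andP[s0 s1] rho01; have pi0 := @pi_gt0 R.
have s01 : 0 <= s < 1 by rewrite (ltW s0).
have [rho0 rho1] := andP rho01.
have rs01 : 0 <= rho * s < 1.
  by rewrite mulr_ge0 ?(ltW s0)//= (le_lt_trans _ s1)// ler_piMl ?(ltW s0)// ltW.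
pose a n := s ^+ n *: (expI I (n%:R * phi) * dual_coef n).
pose g M j := shift_sum a rho M j.+1.
set c := f ((rho * s) *: expI I phi).
pose F t := f (s *: expI I (t + phi)).
have [B B0 hB] : exists2 B, 0 <= B & forall n, `|dual_coef n| <= B.
  exists (1 + 8 * C ^+ 2); first by rewrite addr_ge0// mulr_ge0// sqr_ge0.
  move=> n; have := dual_coef_l2 n.+1; rewrite big_ord_recr/=.
  have : 0 <= \sum_(i < n) `|dual_coef i| ^+ 2 by apply: sumr_ge0 => i _; rewrite exprn_ge0.
  have := sqr_ge0 (`|dual_coef n| - 1).
  have := normr_ge0 (dual_coef n); move: `|_| => x x0 h1 h2 h3; nra.
have aB n : `|a n| <= B * s ^+ n.
  rewrite /a normrZ normqM normq_expI// mul1r ger0_norm ?exprn_ge0 ?(ltW s0)//.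
  by rewrite mulrC ler_wpM2r// exprn_ge0// ltW.
have cF : continuous F.
  move=> t; apply: (@continuous_comp _ _ _ (fun t => t + phi) (fun t => f (s *: expI I t))).
    by apply: ctsD; [exact: cts_id|exact: cts_cst].
  exact: cts_slice I2 fb s01 _.
have tail M : \sum_(k < M) `|a (M + k)%N| <= B * (s ^+ M / (1 - s)).
  have h : \sum_(k < M) `|a (M + k)%N| <= B * s ^+ M * \sum_(k < M) (if (0 <= k)%N then s ^+ k else 0).
    by rewrite mulr_sumr; apply: ler_sum => k _ /=; rewrite -mulrA -exprD.
  apply: le_trans h _; rewrite -mulrA ler_wpM2l// ler_wpM2l ?exprn_ge0 ?(ltW s0)//.
  by have := geo_tail 0 M s01; rewrite expr0 mul1r.
pose X M t := (expI I t - rho%:A) * circ_sum I (g M) M 1 t.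
have hX t : X ^~ t @ \oo --> F t - c.
  have h1 : (fun M => circ_sum I a M 1 t - shift_sum a rho M 0) @ \oo --> F t - c.
    apply: cvgB.
      rewrite (_ : (fun M => _) = (fun M => circ_sum I dual_coef M s (t + phi))).
        exact: circ_sum_cvg.
      apply/funext => M; apply: eq_bigr => n _.
      by rewrite expr1n scale1r mulrDr expID// /a -scalerAr mulrA.
    rewrite (_ : (fun M => _) = (fun M => circ_sum I dual_coef M (rho * s) phi)).
      exact: circ_sum_cvg.
    apply/funext => M; apply: eq_bigr => n _.
    by rewrite /a add0n scalerA exprMn.
  apply/cvgrPdist_le => e e0; have e2 : 0 < e / 2 by lra.
  move/cvgrPdist_le: h1 => /(_ _ e2) h1.
  have hs : `|s| < 1 by rewrite ger0_norm// ltW.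
  have d0 : 0 < e * (1 - s) / (4 * (B + 1)).
    by rewrite divr_gt0 ?mulr_gt0 ?subr_gt0// ltr_wpDl.
  have /cvgrPdist_le/(_ _ d0) h2 := cvg_expr hs.
  near=> M.
  have k1 : `|F t - c - (circ_sum I a M 1 t - shift_sum a rho M 0)| <= e / 2 by near: M.
  have k2 : `|0 - s ^+ M| <= e * (1 - s) / (4 * (B + 1)) by near: M.
  have k3 : B * (s ^+ M / (1 - s)) <= e / 4.
    move: k2; rewrite sub0r normrN ger0_norm ?exprn_ge0 ?(ltW s0)//.
    rewrite ler_pdivlMr ?mulr_gt0 ?ltr_wpDl// => k2.
    rewrite mulrA ler_pdivrMr ?subr_gt0//.
    have := exprn_ge0 M (ltW s0); move: (s ^+ M) k2 => x k2 x0.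
    have : 0 <= x * B by rewrite mulr_ge0.
    lra.
  rewrite /X shift_sum_mul//.
  set u := expI I (M%:R * t) * _; set v := \sum_(j < M) rho ^+ M *: _.
  have ut : `|u| <= e / 4.
    apply: le_trans k3; apply: le_trans (tail M).
    rewrite normqM normq_expI// mul1r; apply: le_trans (ler_norm_sum _ _ _) _.
    apply: ler_sum => k _; rewrite normrZ ler_piMl// ger0_norm ?exprn_ge0//.
    by rewrite exprn_ile1// ltW.
  have vt : `|v| <= e / 4.
    apply: le_trans k3; apply: le_trans (tail M).
    apply: le_trans (ler_norm_sum _ _ _) _.
    apply: ler_sum => k _; rewrite normrZ normqM normq_expI// mul1r addnC.
    by rewrite ler_piMl// ger0_norm ?exprn_ge0// exprn_ile1// ltW.
  move: k1; set w := F t - c; set y := circ_sum I a M 1 t - _ => k1.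
  have -> : w - (y + u - v) = (w - y) - u + v by rewrite opprB addrCA opprD [w + (_ - u)]addrA [LHS]addrC.
  apply: le_trans (ler_normD _ _) _; apply: le_trans (lerD (ler_normB _ _) (lexx _)) _; lra.
have T0 : 0 < 1 - rho ^+ 2 by rewrite subr_gt0 expr_lt1.
have nE t : `|expI I t - rho%:A| ^+ 2 = 1 - 2 * rho * cos t + rho ^+ 2.
  rewrite normqD_sqr normq_expI// normrN normrZ normq1 mulr1 real_normK ?num_real//.
  rewrite /dotq conj_expI// /expI -scaleNr -scalerAr mulr1 q1Z q1D !q1Z /= cosN.
  have : q1 I = 0 by have := imag_units_conj I2; case: (I) => ? ? ? ? [] /=; lra.
  by move=> ->; ring.
have PX M t : poisson rho t * `|X M t| ^+ 2 = (1 - rho ^+ 2) * `|circ_sum I (g M) M 1 t| ^+ 2.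
  rewrite /X normqM exprMn nE /poisson mulrA divfK//.
  by rewrite gt_eqF// poisson_den_gt0.
have cP := cts_poisson rho01.
have cR : continuous (fun t => poisson rho t * `|F t - c| ^+ 2).
  by apply: ctsM => //; apply: cts_exp; apply: cts_normq; apply: ctsHB => //; exact: ctsH_cst.
rewrite -lee_fin -itgE//.
apply: (@fatou_circ _ (fun M t => poisson rho t * `|X M t| ^+ 2)).
- move=> M; under eq_fun do rewrite PX.
  apply: ctsM; first exact: cts_cst.
  by apply: cts_exp; apply: cts_normq; exact: cts_circ_sum.
- by move=> M t; rewrite mulr_ge0 ?poisson_ge0 ?exprn_ge0.
- exact: continuous_measurable_fun.
- by move=> t; rewrite mulr_ge0 ?poisson_ge0 ?exprn_ge0.
- apply: aeW => t; apply: cvgM; first exact: cvg_cst.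
  by apply: cvg_sqr; apply: cvg_norm; exact: hX.
move=> M; under eq_itg do rewrite PX.
rewrite itgZ ?parseval_circ//; last first.
  by apply: cts_exp; apply: cts_normq; exact: cts_circ_sum.
have := @dual_coef_shift_sum I phi s rho M a I2 erefl.
rewrite (ltW s0) (ltW s1) rho01 => /(_ isT isT); rewrite -/(g M).
move=> h; rewrite mulrCA ler_wpM2l// mulr_ge0// ltW.
Unshelve. all: by end_near. Qed.

(** On the arc of half-length d the kernel at radius 1 - d/4 is at least 4/(17 d), so [garsia_dual]
    bounds the integral by (17 d / 4) * 8 pi C^2 with 2 d = v - u. Fatou's lemma passes from dilates
    to boundary values. *)
Lemma arc_oscillation I f (u v : R) : imag_units I -> has_expansion f dual_coef ->
  u < v -> v - u <= 2 * pi ->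
  exists c : H, (\int[mu]_(t in `[u, v]) (`|bdry f I t - c| ^+ 2)%:E <=
    (17 * pi * C ^+ 2 * (v - u))%:E)%E.
Proof.
move=> I2 fb uv uv2; have pi0 := @pi_gt0 R.
have pi4 : pi < 4 :> R by have := @pihalf_lt2 R; lra.
pose phi := (u + v) / 2; pose d := (v - u) / 2; pose rho := 1 - d / 4.
have d0 : 0 < d by rewrite divr_gt0// subr_gt0.
have dpi : d <= pi by rewrite /d; lra.
have rho01 : 0 < rho < 1 by rewrite /rho; apply/andP; split; lra.
have [rho0 rho1] := andP rho01.
have rho01' : 0 <= rho < 1 by rewrite ltW.
exists (f (rho *: expI I phi)).
have arc s : 0 < s < 1 ->
    itg u v (fun t => `|f (s *: expI I t) - f ((rho * s) *: expI I phi)| ^+ 2) <=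
    17 * pi * C ^+ 2 * (v - u).
  move=> s01; have := garsia_dual phi I2 fb s01 rho01'.
  set c := f ((rho * s) *: expI I phi).
  pose g t := `|f (s *: expI I t) - c| ^+ 2.
  have cg : continuous g.
    apply: cts_exp; apply: cts_normq; apply: ctsHB; last exact: ctsH_cst.
    by apply: cts_slice I2 fb _; move: s01 => /andP[/ltW -> ->].
  have csh : continuous (fun t : R => t + phi) by apply: ctsD; [exact: cts_id|exact: cts_cst].
  have cgs : continuous (fun t => g (t + phi)) by exact: (@cts_comp _ _ g (fun t => t + phi)).
  have -> : itg u v (fun t => `|f (s *: expI I t) - c| ^+ 2) = itg (- d) d (fun t => g (t + phi)).
    rewrite -itg_shift//; last lra.
    by congr itg; rewrite /d /phi; field.
  have cPg : continuous (fun t => poisson rho t * g (t + phi)).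
    by apply: ctsM => //; exact: cts_poisson.
  have g0 t : 0 <= g t by rewrite exprn_ge0.
  have Pg0 t : 0 <= poisson rho t * g (t + phi) by rewrite mulr_ge0// poisson_ge0.
  change (itg (- pi) pi (fun t => poisson rho t * g (t + phi)) <= 2 * pi * (4 * C ^+ 2) ->
    itg (- d) d (fun t => g (t + phi)) <= 17 * pi * C ^+ 2 * (v - u)).
  rewrite (@itg_cat _ (- d) _ (- pi) pi)//; last by apply/andP; split; lra.
  rewrite (@itg_cat _ d _ (- d) pi)//; last by apply/andP; split; lra.
  have h1 : 0 <= itg (- pi) (- d) (fun t => poisson rho t * g (t + phi)) by exact: itg_ge0.
  have h2 : 0 <= itg d pi (fun t => poisson rho t * g (t + phi)) by exact: itg_ge0.
  have h3 : 4 / (17 * d) * itg (- d) d (fun t => g (t + phi)) <=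
      itg (- d) d (fun t => poisson rho t * g (t + phi)).
    rewrite -itgZ//; apply: le_itg => //; first by apply: ctsM => //; exact: cts_cst.
    move=> t td; rewrite ler_wpM2r//; apply: poisson_ge => //; first exact: ltW.
    by rewrite ler_norml.
  move=> h4.
  have : 4 / (17 * d) * itg (- d) d (fun t => g (t + phi)) <= 2 * pi * (4 * C ^+ 2) by lra.
  have d17 : 0 < 17 * d by lra.
  rewrite mulrAC ler_pdivrMr// => h5.
  have -> : v - u = 2 * d by rewrite /d; field.
  lra.
apply: (@fatou_circ _ (fun j t => `|f (rseq j *: expI I t) - f ((rho * rseq j) *: expI I phi)| ^+ 2)).
- move=> j; apply: cts_exp; apply: cts_normq; apply: ctsHB; last exact: ctsH_cst.
  by apply: cts_slice I2 fb _; have /andP[/ltW -> ->] := @rseq01 R j.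
- by move=> j t; rewrite exprn_ge0.
- by apply: measurable_funX; exact: measurable_normq_bdry I2 fb.
- by move=> t; rewrite exprn_ge0.
- have [N [mN N0 hN]] := radial_cvg I2 dual_coef_l2 fb; exists N; split=> // t /= nt.
  apply: hN => /= ht; apply: nt.
  apply: cvg_sqr; apply: cvg_norm; apply: cvgB; first exact: bdry_cvg_seq.
  have h : (fun j => rho * rseq j) @ \oo --> rho.
    by rewrite -[X in _ --> X]mulr1; apply: cvgM; [exact: cvg_cst|exact: rseq_cvg1].
  exact: cvg_comp h (cts_radius I2 fb rho01).
by move=> j; apply: arc; exact: rseq01.
Qed.

End Functional.
End FunctionalToBMOA.

(** * The function representing a functional belongs to BMOA *)

Section FunctionalOfBoundedOscillation.
Context {R : realType}.
Local Notation H := (quat R).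
Local Notation mu := (@lebesgue_measure R).
Implicit Types (p q I : H) (a b : nat -> H) (f : H -> H).

Lemma coef_unique f a : has_expansion f a -> coef f = a.
Proof.
move=> fa; apply: (@has_expansion_inj R f _ _ _ fa).
by apply: (@getPex _ (has_expansion f)); exists a.
Qed.

Lemma has_expansion_coef f : regular f -> has_expansion f (coef f).
Proof. by move=> [a fa]; rewrite (coef_unique fa). Qed.

Lemma power_series_exists a (B : R) : (forall n, `|a n| <= B) -> exists f, has_expansion f a.
Proof.
move=> aB; have h q : exists l : H, `|q| < 1 -> series (fun n => q ^+ n * a n) @ \oo --> l.
  have [q1|q1] := ltP `|q| 1; last by exists 0.
  have xu n : `|q ^+ n * a n| <= geometric B `|q| n.
    rewrite /geometric/= normqM mulrC; apply: ler_pM => //.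
    elim: n => [|n IH]; first by rewrite !expr0 normq1.
    by rewrite !exprS normqM ler_pM.
  have cu : cvgn (series (geometric B `|q|)) by apply: is_cvg_geometric_series; rewrite normr_id.
  have [l hl] := quat_series_cvg xu cu.
  by exists l.
by have [f hf] := choice h; exists f.
Qed.

Lemma circle_L2 I f a (M c r : R) : imag_units I -> has_expansion f a ->
  (forall N, \sum_(n < N) `|a n| ^+ 2 <= M) -> 0 <= r < 1 ->
  itg c (c + 2 * pi) (fun t => `|f (r *: expI I t)| ^+ 2) <= 2 * pi * M.
Proof.
move=> I2 fa aM r01; have pi0 := @pi_gt0 R.
have cf : continuous (fun t => `|f (r *: expI I t)| ^+ 2).
  by apply: cts_exp; apply: cts_normq; exact: cts_slice I2 fa r01.
rewrite -lee_fin -itgE//.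
apply: (@fatou_circ _ (fun N t => `|circ_sum I a N r t| ^+ 2)).
- by move=> N; apply: cts_exp; apply: cts_normq; exact: cts_circ_sum.
- by move=> N t; rewrite exprn_ge0.
- exact: continuous_measurable_fun.
- by move=> t; rewrite exprn_ge0.
- by apply: aeW => t; apply: cvg_sqr; apply: cvg_norm; exact: circ_sum_cvg.
move=> N; under eq_itg do rewrite circ_sum_radius.
rewrite parseval// ler_wpM2l ?mulr_ge0 ?(ltW pi0)//.
apply: le_trans (aM N); apply: ler_sum => n _.
move: r01 => /andP[r0 r1].
rewrite normrZ exprMn ler_piMl ?exprn_ge0// ger0_norm ?exprn_ge0// -exprM.
by rewrite exprn_ile1// ltW.
Qed.

Lemma L2_in_H1 f a (M : R) : has_expansion f a ->
  (forall N, \sum_(n < N) `|a n| ^+ 2 <= M) -> in_H1 f.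
Proof.
move=> fa aM; have pi0 := @pi_gt0 R; split; first by exists a.
apply: le_lt_trans (ltry (1 + M)).
apply: ge_ereal_sup => _ [[I r] [/= I2 +] <-]; rewrite in_itv/= => /andP[r0 r1].
have r01 : 0 <= r < 1 by rewrite ltW.
rewrite (circle_meanE I2 fa r01) lee_fin mulrC ler_pdivrMr ?mulr_gt0//.
have cf : continuous (fun t => `|f (r *: expI I t)|).
  by apply: cts_normq; exact: cts_slice I2 fa r01.
have := circle_L2 (- pi) I2 fa aM r01; have -> : - pi + 2 * pi = pi :> R by ring.
move=> h; apply: le_trans (_ : itg (- pi) pi (fun t => 1 + `|f (r *: expI I t)| ^+ 2) <= _).
  apply: le_itg => //; first by apply: ctsD; [exact: cts_cst|exact: cts_exp].
  move=> t _; move: `|_| => x; have := sqr_ge0 (x - 2^-1); lra.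
rewrite itgD; [|exact: cts_cst|exact: cts_exp].
rewrite itg_cst; lra.
Qed.

Lemma integral_norm_le_sqr (u v K : R) (g : R -> R) : u <= v ->
  measurable_fun setT g -> (forall t, 0 <= g t) ->
  (\int[mu]_(t in `[u, v]) (g t ^+ 2)%:E <= K%:E)%E ->
  (\int[mu]_(t in `[u, v]) (g t)%:E <= (v - u + K)%:E)%E.
Proof.
move=> uv mg g0 hK.
have m1 : measurable_fun `[u, v] (fun t => (g t)%:E).
  by apply/measurable_EFinP; apply: measurable_funTS.
have m2 : measurable_fun `[u, v] (fun t => (g t ^+ 2)%:E).
  by apply/measurable_EFinP; apply: measurable_funTS; exact: measurable_funX.
apply: (@le_trans _ _ (\int[mu]_(t in `[u, v]) ((1 : R)%:E + (g t ^+ 2)%:E))%E).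
  apply: ge0_le_integral => //.
  - by move=> t _; rewrite lee_fin.
  - by apply: emeasurable_funD.
  by move=> t _; rewrite -EFinD lee_fin; have := sqr_ge0 (g t - 2^-1); lra.
rewrite ge0_integralD//; last by move=> t _; rewrite lee_fin sqr_ge0.
rewrite EFinD leeD// (_ : (\int[mu]_(t in `[u, v]) 1%:E)%E = (itg u v (fun=> 1))%:E).
  by rewrite itg_cst// mul1r.
by rewrite itgE//; exact: cts_cst.
Qed.

(** Each of the four real components of the mean differs from that of [c] by at most K/(v - u).
    Replacing [c] by the mean thus adds at most 4K to the integral, whence 5K. *)
Lemma mean_osc_le f a I (u v K : R) c : imag_units I -> has_expansion f a -> u < v ->
  (\int[mu]_(t in `[u, v]) (`|bdry f I t - c|)%:E <= K%:E)%E ->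
  (mean_osc f I u v <= (5 * K / (v - u))%:E)%E.
Proof.
move=> I2 fa uv hK; have vu0 : 0 < v - u by rewrite subr_gt0.
pose F := bdry f I.
have mF c' : measurable_fun setT (fun t => `|F t - c'|) by exact: measurable_normq_bdry I2 fa.
have iF : mu.-integrable `[u, v] (EFin \o (fun t => `|F t - c|)).
  apply/integrableP; split; first by apply/measurable_EFinP; apply: measurable_funTS; exact: mF.
  by under eq_integral do rewrite /= normr_id; exact: le_lt_trans hK (ltry _).
have K0 : 0 <= K.
  by rewrite -lee_fin; apply: le_trans hK; apply: integral_ge0 => t _; rewrite lee_fin.
pose x (w : H) t := q1 ((F t - c) * w).
have mq w : measurable_fun setT (fun t => q1 (F t * w)) by exact: measurable_bdry_q1 I2 fa.
have mx w : measurable_fun setT (x w).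
  rewrite (_ : x w = (fun t => q1 (F t * w) - q1 (c * w))).
    by apply: measurable_funB.
  by apply/funext => t; rewrite /x mulrBl q1B.
have ix w : `|w| <= 1 -> mu.-integrable `[u, v] (EFin \o x w).
  move=> w1; apply: le_integrable iF => //.
    by apply/measurable_EFinP; apply: measurable_funTS; exact: mx.
  move=> t _; rewrite /= lee_fin normr_id (le_trans (norm_q1_le _))// normqM.
  by rewrite ler_piMr.
have Rx w : `|w| <= 1 -> `|\int[mu]_(t in `[u, v]) x w t| <= K.
  move=> w1; rewrite -lee_fin EFin_normr_Rintegral//; last exact: ix.
  apply: le_trans (le_abse_integral _ _ _) _ => //.
    by apply/measurable_EFinP; apply: measurable_funTS; exact: mx.
  apply: le_trans hK; apply: ge0_le_integral => //.
  - by apply: measurableT_comp => //; apply/measurable_EFinP; apply: measurable_funTS; exact: mx.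
  - by apply/measurable_EFinP; apply: measurable_funTS; exact: mF.
  move=> t _; rewrite /= lee_fin (le_trans (norm_q1_le _))// normqM.
  by rewrite ler_piMr.
have RE w : `|w| <= 1 ->
    \int[mu]_(t in `[u, v]) q1 (F t * w) = \int[mu]_(t in `[u, v]) x w t + q1 (c * w) * (v - u).
  move=> w1; rewrite -(itg_cst _ (ltW uv)) /itg -RintegralD//; last 2 first.
  - exact: ix.
  - by apply: itg_integrable; exact: cts_cst.
  by apply: eq_Rintegral => t _; rewrite /x mulrBl q1B subrK.
pose wi : H := Quat 0 (-1) 0 0; pose wj : H := Quat 0 0 (-1) 0; pose wk : H := Quat 0 0 0 (-1).
have [n1 ni nj nk] : [/\ `|1 : H| <= 1, `|wi| <= 1, `|wj| <= 1 & `|wk| <= 1].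
  by rewrite normq1 !normq_sqrtE /wi /wj /wk /= sqrrN expr1n !expr0n/= !(addr0, add0r) sqrtr1.
have mc : `|mean f I u v - c| <= 4 * K / (v - u).
  rewrite -(@ler_pM2l _ (v - u))// -[X in X * _ <= _]gtr0_norm// -normrZ.
  have -> : (v - u) * (4 * K / (v - u)) = 4 * K by field; rewrite gt_eqF.
  rewrite scalerBr /mean scalerA mulfV ?gt_eqF// scale1r.
  have r1 := RE _ n1; have ri := RE _ ni; have rj := RE _ nj; have rk := RE _ nk.
  rewrite (_ : (fun t => q1 (F t * 1)) = (fun t => q1 (F t))) in r1; last first.
    by apply/funext => t; rewrite mulr1.
  rewrite (_ : (fun t => q1 (F t * wi)) = (fun t => qi (F t))) in ri; last first.
    by apply/funext => t; rewrite qi_q1.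
  rewrite (_ : (fun t => q1 (F t * wj)) = (fun t => qj (F t))) in rj; last first.
    by apply/funext => t; rewrite qj_q1.
  rewrite (_ : (fun t => q1 (F t * wk)) = (fun t => qk (F t))) in rk; last first.
    by apply/funext => t; rewrite qk_q1.
  rewrite -qi_q1 in ri; rewrite -qj_q1 in rj; rewrite -qk_q1 in rk; rewrite mulr1 in r1.
  rewrite /qRintegral r1 ri rj rk; apply: le_trans (normq_le_comp _) _ => /=.
  rewrite ![(v - u) * _]mulrC !addrK.
  have -> : 4 * K = K + K + K + K by ring.
  by rewrite !lerD// Rx.
rewrite /mean_osc -/F.
have -> : (5 * K / (v - u)) = (v - u)^-1 * (5 * K) by rewrite mulrC.
rewrite EFinM lee_wpmul2l ?lee_fin ?invr_ge0 ?(ltW vu0)//.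
apply: (@le_trans _ _ (\int[mu]_(t in `[u, v]) ((`|F t - c|)%:E + (4 * K / (v - u))%:E))%E).
  apply: ge0_le_integral => //.
  - by apply/measurable_EFinP; apply: measurable_funTS; exact: mF.
  - by apply: emeasurable_funD => //; apply/measurable_EFinP; apply: measurable_funTS; exact: mF.
  move=> t _; rewrite -EFinD lee_fin; apply: le_trans (ler_distD c _ _) _.
  by rewrite lerD2l distrC.
rewrite ge0_integralD//; last 2 first.
- by apply/measurable_EFinP; apply: measurable_funTS; exact: mF.
- by move=> t _; rewrite lee_fin divr_ge0 ?mulr_ge0// ltW.
have -> : (\int[mu]_(t in `[u, v]) (4 * K / (v - u))%:E)%E = (4 * K)%:E.
  rewrite (itgE _ _ (@cts_cst _ _ _)) itg_cst ?(ltW uv)//.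
  by congr EFin; field; rewrite gt_eqF.
have -> : 5 * K = K + 4 * K by ring.
by rewrite EFinD leeD.
Qed.

Lemma poly_fun_mono_sum (h : {poly H}) :
  poly_fun h = mono_sum [seq (n, h`_n) | n <- iota 0 (size h)].
Proof.
apply/funext => q; rewrite /poly_fun /mono_sum big_map.
by rewrite -(big_mkord predT (fun n => q ^+ n * h`_n)) /index_iota subn0.
Qed.

Lemma functional_to_BMOA (L : (H -> H) -> H) : bounded_right_linear L ->
  exists b : H -> H, BMOA b /\ forall h : {poly H}, L (poly_fun h) = H2_pairing h b.
Proof.
move=> [Llin [C0 LC0]]; pose C := `|C0| + 1.
have C1 : 0 < C by rewrite ltr_wpDl.
have LC f : in_H1 f -> (`|L f|%:E <= C%:E * H1_norm f)%E.
  move=> f1; apply: le_trans (LC0 f f1) _; apply: lee_wpmul2r; last first.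
    by rewrite lee_fin /C (le_trans (ler_norm _))// lerDl.
  have I2 : imag_units (Quat 0 1 0 0 : H) by apply: quatP => /=; ring.
  apply: le_trans (ereal_sup_ubound _); last first.
    by exists (Quat 0 1 0 0, 2^-1) => //=; split=> //=; rewrite in_itv/=; apply/andP; split; lra.
  rewrite /circle_mean /= mule_ge0//; last by apply: integral_ge0 => t _; rewrite lee_fin.
  by rewrite lee_fin invr_ge0 mulr_ge0// pi_ge0.
have l2 := dual_coef_l2 Llin C1 LC.
have bB n : `|dual_coef L n| <= 1 + 8 * C ^+ 2.
  have := l2 n.+1; rewrite big_ord_recr/=.
  have : 0 <= \sum_(i < n) `|dual_coef L i| ^+ 2 by apply: sumr_ge0 => i _; rewrite exprn_ge0.
  have := sqr_ge0 (`|dual_coef L n| - 2^-1); move: `|_| => x; lra.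
have [b hb] := power_series_exists bB.
exists b; split; last first.
  move=> h; rewrite poly_fun_mono_sum (functional_mono_sum Llin) big_map /H2_pairing (coef_unique hb)/=.
  by rewrite -[RHS](big_mkord predT (fun n => conjq (dual_coef L n) * h`_n)) /index_iota subn0.
split; first exact: L2_in_H1 hb l2.
apply: le_lt_trans (ltry (5 * (1 + 17 * pi * C ^+ 2))).
apply: ge_ereal_sup => _ [I [u [v [I2 uv uv2 ->]]]].
have [c hc] := arc_oscillation Llin C1 LC I2 hb uv uv2.
have vu0 : 0 < v - u by rewrite subr_gt0.
have h := integral_norm_le_sqr (ltW uv) (measurable_normq_bdry c I2 hb) (fun t => normr_ge0 _) hc.
have -> : 5 * (1 + 17 * pi * C ^+ 2) = 5 * (v - u + 17 * pi * C ^+ 2 * (v - u)) / (v - u).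
  by field; rewrite gt_eqF.
exact: mean_osc_le I2 hb uv h.
Qed.

End FunctionalOfBoundedOscillation.

(** * Complex factorization on the circle *)

Section ComplexSlice.
Variable R : realType.
Local Notation H := (quat R).
Local Notation C := R[i].
Implicit Types (x y z : C) (p u v h : {poly C}).

(** Besides identifying the complex numbers with the slice of [i], this gives a real-valued modulus
    [|cq z|]; the norm on [R[i]] takes complex values. *)
Definition cq z : H := Quat (complex.Re z) (complex.Im z) 0 0.

Fact cq_zmod : zmod_morphism cq.
Proof. by case=> [a b] [c d]; apply: quatP => /=; ring. Qed.
Fact cq_monoid : monoid_morphism cq.
Proof. by split=> [|[a b] [c d]]; apply: quatP => /=; ring. Qed.
HB.instance Definition _ := GRing.isZmodMorphism.Build C H cq cq_zmod.
HB.instance Definition _ := GRing.isMonoidMorphism.Build C H cq cq_monoid.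

Lemma cq_conj z : cq (z^*) = conjq (cq z).
Proof. by case: z => [a b]; apply: quatP => /=; ring. Qed.

Lemma cq_inj : injective cq.
Proof. by move=> [a b] [c d] [-> ->]. Qed.

Lemma norm_cqM x y : `|cq (x * y)| = `|cq x| * `|cq y|.
Proof. by rewrite rmorphM normqM. Qed.

Lemma norm_cqX x n : `|cq (x ^+ n)| = `|cq x| ^+ n.
Proof. by elim: n => [|n IH]; rewrite ?expr0 ?rmorph1 ?normq1// !exprS norm_cqM IH. Qed.

Lemma norm_cq_conj x : `|cq x^*| = `|cq x|.
Proof. by rewrite cq_conj norm_conjq. Qed.

Lemma norm_cq_sum (I : Type) (s : seq I) (F : I -> C) :
  `|cq (\sum_(i <- s) F i)| <= \sum_(i <- s) `|cq (F i)|.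
Proof. by rewrite rmorph_sum; exact: ler_norm_sum. Qed.

Lemma norm_cq_eq0 x : `|cq x| = 0 -> x = 0.
Proof. by move/eqP; rewrite normr_eq0 => /eqP h; apply: cq_inj; rewrite h rmorph0. Qed.

Lemma norm_cqV x : x != 0 -> `|cq x^-1| = `|cq x|^-1.
Proof.
move=> x0; have h : `|cq x| != 0 by apply: contraNneq x0 => /norm_cq_eq0 ->.
by apply: (mulfI h); rewrite -norm_cqM !divff// rmorph1 normq1.
Qed.

Lemma norm_cq_real (r : R) : `|cq (r%:C)%C| = `|r|.
Proof. by rewrite normq_sqrtE -sqrtr_sqr; congr Num.sqrt => /=; ring. Qed.

Lemma norm_cq2V : `|cq 2^-1| = 2^-1.
Proof.
have h : (2 : C) != 0 by rewrite pnatr_eq0.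
rewrite norm_cqV// (_ : 2 = (2 : R)%:C%C); last by apply/eqP; rewrite eq_complex /= ?addr0 !eqxx.
by rewrite norm_cq_real ger0_norm.
Qed.

Lemma mul_conj_cq x : cq (x * x^*) = (`|cq x| ^+ 2)%:A.
Proof. by rewrite rmorphM/= cq_conj mul_conjq. Qed.

(** A fixed point x of this iteration satisfies (1 - x)^2 = 1 - y, so the iterates are polynomials
    in [y] approximating 1 - sqrt(1 - y). The type is generic because the real iteration at [y = 1]
    serves as majorant of the complex one. *)
Fixpoint half_iter (K : unitRingType) (y : K) n : K :=
  if n is k.+1 then (y + half_iter y k ^+ 2) * 2^-1 else 0.

Lemma half_iter01 n : 0 <= half_iter (1 : R) n <= 1.
Proof. by elim: n => [|n /andP[IH0 IH1]] /=; apply/andP; split; try lra; nra. Qed.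

(** One step takes the gap g to g - g^2/2. *)
Lemma half_iter_gap n : 1 - half_iter (1 : R) n <= 2 / n.+2%:R.
Proof.
elim: n => [|n] /=; first by lra.
have /andP[] := half_iter01 n; move: (half_iter _ n) => x x0 x1.
have n0 : 0 <= (n%:R : R) by rewrite ler0n.
rewrite -[n.+3]addn3 -[n.+2]addn2 !natrD; move: (n%:R : R) n0 => m m0.
rewrite !ler_pdivlMr; try lra. move=> h; nra.
Qed.

Lemma norm_half_iter y n : `|cq y| <= 1 -> `|cq (half_iter y n)| <= half_iter 1 n.
Proof.
move=> y1; elim: n => [|n IH] /=; first by rewrite rmorph0 normr0.
rewrite norm_cqM norm_cq2V ler_pM2r// rmorphD; apply: le_trans (ler_normD _ _) _.
by rewrite lerD// norm_cqX lerXn2r ?nnegrE//; case/andP: (half_iter01 n).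
Qed.

Lemma norm_half_iter_step y n : `|cq y| <= 1 ->
  `|cq (half_iter y n.+1 - half_iter y n)| <= half_iter 1 n.+1 - half_iter 1 n.
Proof.
move=> y1; elim: n => [|n IH].
  rewrite (_ : half_iter y 1 - half_iter y 0 = y * 2^-1); last by rewrite /=; ring.
  by rewrite norm_cqM norm_cq2V /=; lra.
have e (K : fieldType) (x : K) : half_iter x n.+2 - half_iter x n.+1 =
    (half_iter x n.+1 - half_iter x n) * (half_iter x n.+1 + half_iter x n) * 2^-1.
  rewrite -[LHS]/((x + half_iter x n.+1 ^+ 2) * 2^-1 - (x + half_iter x n ^+ 2) * 2^-1); ring.
rewrite !e !norm_cqM norm_cq2V ler_pM2r//; apply: ler_pM => //.
rewrite rmorphD; apply: le_trans (ler_normD _ _) _.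
by rewrite lerD// norm_half_iter.
Qed.

(** For an iterate x of [half_iter], (1 - x)^2 - (1 - y) is twice the next increment, which is
    dominated by the increment at y = 1. The bound is uniform on the closed disc, branch point y = 1
    included, as roots on the unit circle require. *)
Lemma poly_sqrt (e : R) : 0 < e -> exists s : {poly C}, forall y, `|cq y| <= 1 ->
  `|cq (s.[y] ^+ 2 - (1 - y))| <= e.
Proof.
move=> e0; have [n hn] : exists n : nat, 4 / n.+2%:R <= e.
  exists (Num.truncn (4 / e)); rewrite ler_pdivrMr// mulrC -ler_pdivrMr//.
  by rewrite (le_trans (ltW (truncnS_gt _)))// ler_nat.
have [p hp] : exists p : {poly C}, forall y, p.[y] = half_iter y n.
  elim: n {hn} => [|n [p hp]]; first by exists 0 => y; rewrite horner0.
  by exists (2^-1 *: ('X + p ^+ 2)) => y; rewrite !hornerE hp /= mulrC.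
exists (1 - p) => y y1; rewrite !hornerE hp.
have -> : (1 - half_iter y n) ^+ 2 - (1 - y) = 2 * (half_iter y n.+1 - half_iter y n).
  by rewrite /=; field.
have h2 : `|cq 2| = 2.
  by rewrite (_ : 2 = (2 : R)%:C%C) ?norm_cq_real ?ger0_norm//; apply/eqP; rewrite eq_complex /= ?addr0 !eqxx.
rewrite norm_cqM h2; have := norm_half_iter_step n y1; have := half_iter_gap n => /=.
have /andP[] := half_iter01 n; move: (half_iter (1 : R) n) => x x0 x1 g h.
have : 4 / n.+2%:R = 2 * (2 / n.+2%:R) :> R by ring.
move: hn g; move: (4 / _) (2 / _) => A B; nra.
Qed.

(** The approximate form of h = uv with |u|^2 = |v|^2 = |h| on the circle; square roots are
    polynomial only up to an error. The property is multiplicative in [h], which reduces it to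
    linear factors. *)
Definition circle_factorable h := forall e : R, 0 < e -> exists u v : {poly C},
  forall z, `|cq z| = 1 -> [/\ `|cq (u.[z] * v.[z] - h.[z])| <= e,
    `| `|cq u.[z]| ^+ 2 - `|cq h.[z]| | <= e & `| `|cq v.[z]| ^+ 2 - `|cq h.[z]| | <= e].

Lemma poly_circle_bound h : exists2 M : R, 0 <= M & forall z, `|cq z| = 1 -> `|cq h.[z]| <= M.
Proof.
exists (\sum_(i < size h) `|cq h`_i|) => [|z z1]; first by rewrite sumr_ge0.
rewrite horner_coef; apply: le_trans (norm_cq_sum _ _) _; apply: ler_sum => i _.
by rewrite norm_cqM norm_cqX z1 expr1n mulr1.
Qed.

Lemma dist_mul_le (A B P Q M e : R) : 0 <= e <= 1 -> `|P| <= M -> `|Q| <= M ->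
  `|A - P| <= e -> `|B - Q| <= e -> `|A * B - P * Q| <= e * (2 * M + 1).
Proof.
move=> /andP[e0 e1] PM QM AP BQ.
rewrite (_ : _ - _ = (A - P) * (B - Q) + (A - P) * Q + P * (B - Q)); last by ring.
apply: le_trans (ler_normD _ _) _; rewrite normrM.
have := ler_normD ((A - P) * (B - Q)) ((A - P) * Q); rewrite !normrM.
have h1 : `|A - P| * `|B - Q| <= e * 1 by apply: ler_pM => //; exact: le_trans e1.
have h2 : `|A - P| * `|Q| <= e * M by apply: ler_pM.
have h3 : `|P| * `|B - Q| <= M * e by apply: ler_pM.
lra.
Qed.

Lemma norm_cq_mul_le (a b x y : C) (M e : R) : 0 <= e <= 1 -> `|cq x| <= M -> `|cq y| <= M ->
  `|cq (a - x)| <= e -> `|cq (b - y)| <= e -> `|cq (a * b - x * y)| <= e * (2 * M + 1).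
Proof.
move=> /andP[e0 e1] PM QM AP BQ.
rewrite (_ : _ - _ = (a - x) * (b - y) + (a - x) * y + x * (b - y)); last by ring.
rewrite 2!rmorphD; apply: le_trans (ler_normD _ _) _; rewrite norm_cqM.
have := ler_normD (cq ((a - x) * (b - y))) (cq ((a - x) * y)); rewrite !norm_cqM.
have h1 : `|cq (a - x)| * `|cq (b - y)| <= e * 1 by apply: ler_pM => //; exact: le_trans e1.
have h2 : `|cq (a - x)| * `|cq y| <= e * M by apply: ler_pM.
have h3 : `|cq x| * `|cq (b - y)| <= M * e by apply: ler_pM.
lra.
Qed.

Lemma circle_factorableM h g :
  circle_factorable h -> circle_factorable g -> circle_factorable (h * g).
Proof.
move=> fh fg e e0.
have [M1 M10 hM1] := poly_circle_bound h; have [M2 M20 hM2] := poly_circle_bound g.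
pose M := M1 + M2; have M0 : 0 <= M by rewrite addr_ge0.
pose d := Num.min 1 (e / (2 * M + 1)).
have d0 : 0 < d by rewrite lt_min ltr01 divr_gt0//; lra.
have d1 : 0 <= d <= 1 by rewrite ltW//= ge_min lexx.
have dM : d * (2 * M + 1) <= e by rewrite -ler_pdivlMr; [rewrite ge_min lexx orbT|lra].
have [u1 [v1 h1]] := fh d d0; have [u2 [v2 h2]] := fg d d0.
exists (u1 * u2), (v1 * v2) => z z1; have [a1 a2 a3] := h1 z z1; have [b1 b2 b3] := h2 z z1.
have n1 : `|cq h.[z]| <= M by apply: le_trans (hM1 z z1) _; rewrite lerDl.
have n2 : `|cq g.[z]| <= M by apply: le_trans (hM2 z z1) _; rewrite lerDr.
rewrite !hornerM !norm_cqM !exprMn; split; apply: le_trans dM.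
- by rewrite mulrACA norm_cq_mul_le.
- by rewrite dist_mul_le// normr_id.
- by rewrite dist_mul_le// normr_id.
Qed.

Lemma circle_factorableC (c : C) : circle_factorable c%:P.
Proof.
move=> e e0; exists (sqrtC c)%:P, (sqrtC c)%:P => z _; rewrite !hornerC -expr2 sqrtCK subrr rmorph0.
by rewrite -norm_cqX sqrtCK subrr !normr0; split; exact: ltW.
Qed.

(** Here z - a = -a (1 - z/a) with |z/a| <= 1 on the circle, so both factors can be the same
    approximate square root. *)
Lemma circle_factorable_outer (a : C) : 1 <= `|cq a| -> circle_factorable ('X - a%:P).
Proof.
move=> a1 e e0; have a0 : a != 0.
  by apply: contraTneq a1 => ->; rewrite rmorph0 normr0 -ltNge.
have [s hs] := poly_sqrt (divr_gt0 e0 (lt_le_trans ltr01 a1)).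
pose u := sqrtC (- a) *: (s \Po (a^-1 *: 'X)).
have hu z : `|cq z| = 1 -> `|cq (u.[z] ^+ 2 - ('X - a%:P).[z])| <= e.
  move=> z1; rewrite !hornerE horner_comp !hornerE exprMn sqrtCK.
  rewrite (_ : _ - _ = - a * (s.[a^-1 * z] ^+ 2 - (1 - a^-1 * z))); last by field.
  rewrite norm_cqM rmorphN normrN mulrC -ler_pdivlMr ?(lt_le_trans ltr01)//; apply: hs.
  by rewrite norm_cqM z1 mulr1 norm_cqV// invf_le1// (lt_le_trans ltr01).
exists u, u => z z1; have := hu z z1; rewrite -expr2 => h; split=> //.
  by apply: le_trans h; rewrite -norm_cqX rmorphB; exact: ler_dist_dist.
by apply: le_trans h; rewrite -norm_cqX rmorphB; exact: ler_dist_dist.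
Qed.

(* The reflected root contributes [1 - a^* z], which has the same modulus on the
   circle; the Blaschke factor is expanded as a geometric series. *)
Lemma circle_factorable_inner (a : C) : `|cq a| < 1 -> circle_factorable ('X - a%:P).
Proof.
move=> a1 e e0; set q := `|cq a|; have q0 : 0 <= q by exact: normr_ge0.
have q1 : q < 1 by []; pose g := 1 - q; have g0 : 0 < g by rewrite subr_gt0.
have g1 : g <= 1 by rewrite gerBl.
(* The second modulus estimate [e2] needs 4 (3 d + 4 d) = 28 d to be at most e g^2. *)
pose d := Num.min 1 (e * g ^+ 2 / 28).
have g20 : 0 < g ^+ 2 by rewrite exprn_gt0.
have d0 : 0 < d by rewrite lt_min ltr01 divr_gt0// mulr_gt0.
have d1 : d <= 1 by rewrite ge_min lexx.
have d28 : d * 28 <= e * g ^+ 2 by rewrite -ler_pdivlMr// ge_min lexx orbT.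
have [s hs] := poly_sqrt d0.
have [K hK] : exists K, q ^+ K <= d.
  have : `|q| < 1 by rewrite ger0_norm.
  move/cvg_expr/cvgrPdist_le => /(_ d d0)[K _ hK]; exists K; have := hK K (leqnn K).
  by rewrite sub0r normrN ger0_norm// exprn_ge0.
pose G : {poly C} := \sum_(k < K) a^* ^+ k *: 'X^k.
pose v := s \Po (a^* *: 'X).
(* [G] approximates 1/(1 - a^* z) and [v] a square root of 1 - a^* z: the first factor is nearly the
   unimodular Blaschke factor times [v], so both have the same modulus up to the error. *)
exists (('X - a%:P) * G * v), v => z z1.
set w := a^* * z; have wq : `|cq w| = q by rewrite norm_cqM norm_cq_conj z1 mulr1.
have Gz : (1 - w) * G.[z] = 1 - w ^+ K.
  have -> : 1 - w ^+ K = (1 - w) * \sum_(i < K) w ^+ i by rewrite -[LHS]opprB subrX1 -mulNr opprB.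
  rewrite /G horner_sum.
  by congr (_ * _); apply: eq_bigr => i _; rewrite !hornerE exprMn.
set Gv := G.[z] in Gz *; set D := z - a.
have w1 : 1 - w != 0.
  apply: contraTneq a1 => /eqP; rewrite subr_eq0 => /eqP h.
  by rewrite -leNgt -/q -wq -h rmorph1 normq1.
have nD : `|cq (1 - w)| = `|cq D|.
  have zz : z * z^* = 1 by apply: cq_inj; rewrite mul_conj_cq z1 expr1n scale1r rmorph1.
  rewrite -[1]zz /w mulrC -mulrBl norm_cqM z1 mulr1 -rmorphB norm_cq_conj//.
have gw : g <= `|cq (1 - w)|.
  by rewrite /g -wq rmorphB rmorph1 -[1 in leLHS]normq1; exact: lerB_dist.
have D2 : `|cq D| <= 2.
  by rewrite rmorphB; apply: le_trans (ler_normB _ _) _; rewrite z1 -/q; lra.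
have eta : `|cq (w ^+ K)| <= d by rewrite norm_cqX wq.
have Gn : `|cq Gv| <= 2 / g.
  rewrite ler_pdivlMr// mulrC; apply: le_trans (_ : `|cq (1 - w)| * `|cq Gv| <= _).
    by rewrite ler_wpM2r.
  rewrite -norm_cqM Gz rmorphB rmorph1; apply: le_trans (ler_normB _ _) _; rewrite normq1; lra.
have sw : `|cq (s.[w] ^+ 2 - (1 - w))| <= d by apply: hs; rewrite wq ltW.
set sv := s.[w] in sw *.
have vz : v.[z] = sv by rewrite horner_comp !hornerE.
have uz : (('X - a%:P) * G * v).[z] = D * Gv * sv by rewrite !hornerM vz !hornerE.
have g2 : 2 / g * g = 2 by rewrite divfK ?gt_eqF.
have bound1 : `|cq (- w ^+ K + Gv * (sv ^+ 2 - (1 - w)))| <= d + 2 / g * d.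
  rewrite rmorphD; apply: le_trans (ler_normD _ _) _; rewrite rmorphN normrN norm_cqM.
  by apply: lerD => //; apply: ler_pM.
have dg : (d + 2 / g * d) * g <= 3 * d.
  by rewrite mulrDl mulrAC g2; nra.
have e1 : 2 * (d + 2 / g * d) <= e.
  rewrite -(ler_pM2r g20) expr2 mulrA; move: (2 / g) dg d28 => y; rewrite expr2; nra.
have e2 : 4 * (d * (2 + d) / g + (2 / g) ^+ 2 * d) <= e.
  rewrite -(ler_pM2r g20).
  have -> : 4 * (d * (2 + d) / g + (2 / g) ^+ 2 * d) * g ^+ 2 = 4 * (d * (2 + d) * g + 4 * d).
    by field; rewrite gt_eqF.
  have : d * (2 + d) * g <= d * 3 * 1 by apply: ler_pM => //; nra.
  lra.
rewrite uz vz !hornerE -/D; split.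
- rewrite (_ : _ - _ = D * (- w ^+ K + Gv * (sv ^+ 2 - (1 - w)))).
    by rewrite norm_cqM; apply: le_trans e1; apply: ler_pM.
  have -> : w ^+ K = 1 - (1 - w) * Gv by rewrite Gz; ring.
  by ring.
- have -> : `|cq D| = `|cq (D ^+ 2 / (1 - w))|.
    rewrite norm_cqM norm_cqX norm_cqV// nD expr2 mulfK// -nD.
    by apply: contraNneq w1 => /norm_cq_eq0 ->.
  rewrite -norm_cqX; apply: le_trans (ler_dist_dist _ _) _; rewrite -rmorphB.
  rewrite (_ : _ - _ = D ^+ 2 * ((w ^+ K * (w ^+ K - 2)) / (1 - w) + Gv ^+ 2 * (sv ^+ 2 - (1 - w)))).
    rewrite norm_cqM norm_cqX; apply: le_trans e2; apply: ler_pM; rewrite ?exprn_ge0//.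
      by apply: le_trans (lerXn2r 2 _ _ D2) _; rewrite ?nnegrE//; lra.
    rewrite rmorphD; apply: le_trans (ler_normD _ _) _; rewrite !norm_cqM norm_cqX norm_cqV// -expr2.
    apply: lerD.
      apply: ler_pM; rewrite ?mulr_ge0// ?invr_ge0//; last by rewrite lef_pV2// posrE// (lt_le_trans g0).
      apply: ler_pM; rewrite ?exprn_ge0// ?wq// rmorphB.
      apply: le_trans (ler_normB _ _) _; rewrite addrC.
      apply: lerD => //; rewrite (_ : 2 = (2 : R)%:C%C) ?norm_cq_real ?ger0_norm//.
      by apply/eqP; rewrite eq_complex /= ?addr0 !eqxx.
    by apply: ler_pM; rewrite ?exprn_ge0// lerXn2r ?nnegrE// divr_ge0// ltW.
  have -> : w ^+ K = 1 - (1 - w) * Gv by rewrite Gz; ring.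
  by field.
- have g21 : g ^+ 2 <= 1 by rewrite expr_le1// ltW.
  have de : d <= e by move: (g ^+ 2) g20 g21 d28 => y; nra.
  apply: le_trans de; apply: le_trans sw; rewrite -nD -norm_cqX [leRHS](_ : _ = `|cq (sv ^+ 2) - cq (1 - w)|) -?rmorphB// rmorphB.
  exact: ler_dist_dist.
Qed.

Lemma poly_circle_factor h : circle_factorable h.
Proof.
have [r ->] := closed_field_poly_normal h; rewrite -mul_polyC.
apply: circle_factorableM; first exact: circle_factorableC.
elim: r => [|a r IH]; first by rewrite big_nil; exact: circle_factorableC.
rewrite big_cons; apply: circle_factorableM => //.
by have [a1|a1] := leP 1 `|cq a|; [exact: circle_factorable_outer|exact: circle_factorable_inner].
Qed.

End ComplexSlice.

(** * A Bellman function for products *)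

Section Bellman.
Variable R : realType.
Local Notation C := R[i].
Local Notation B := {poly {poly C}}.
Implicit Types (x y z : C) (p q u v h F : {poly C}) (U V : B).

Definition cis (t : R) : C := (cos t +i* sin t)%C.

Lemma cq_cis t : cq (cis t) = expI (Quat 0 1 0 0) t.
Proof. by apply: quatP => /=; ring. Qed.

Lemma norm_cis t : `|cq (cis t)| = 1.
Proof. by rewrite cq_cis normq_expI//; apply: quatP => /=; ring. Qed.

Lemma cisD s t : cis (s + t) = cis s * cis t.
Proof. by rewrite /cis sinD cosD; apply/eqP; rewrite eq_complex/=; apply/andP; split; apply/eqP; ring. Qed.

Lemma cis0 : cis 0 = 1.
Proof. by rewrite /cis sin0 cos0. Qed.

Lemma cisX t n : cis t ^+ n = cis (n%:R * t).
Proof.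
elim: n => [|n IH]; first by rewrite expr0 mul0r cis0.
by rewrite exprSr IH -cisD -natr1 mulrDl mul1r.
Qed.

Lemma conj_cis t : (cis t)^* = cis (- t).
Proof. by rewrite /cis sinN cosN; apply/eqP; rewrite eq_complex/= !eqxx. Qed.

Lemma cis2pi n : cis (n%:R * (2 * pi)) = 1.
Proof. by rewrite -cis0 /cis -(add0r (n%:R * _)) cosD2pin sinD2pin. Qed.

Lemma cis_neq1 t : 0 < t < 2 * pi -> cis t != 1.
Proof.
move=> /andP[t0 t1]; apply/eqP => -[h _].
have : 0 < sin (t / 2) by apply: sin_gt0_pi; rewrite ?divr_gt0// ltr_pdivrMr// mulrC.
have := cosD (t / 2) (t / 2); rewrite -splitr h.
have := cos2Dsin2 (t / 2); move: (cos _) (sin _) => a b; nra.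
Qed.

Lemma conj_norm_cq z : z * z^* = ((`|cq z| ^+ 2)%:C)%C.
Proof. by case: z => a b; rewrite normq_sqr; apply/eqP; rewrite eq_complex/=; apply/andP; split; apply/eqP; ring. Qed.

Lemma cis_sum_unity M (a b : nat) : (a < M)%N -> (b < M)%N ->
  \sum_(k < M) cis (k%:R * (2 * pi / M%:R)) ^+ a * (cis (k%:R * (2 * pi / M%:R)))^* ^+ b =
  if a == b then M%:R else 0.
Proof.
move=> aM bM; have M0 : (0 < M)%N by exact: leq_ltn_trans aM.
have MR : (0 : R) < M%:R by rewrite ltr0n.
have pi0 := @pi_gt0 R.
have [<-|ab] := eqVneq.
  rewrite (eq_bigr (fun=> 1)) ?sumr_const ?card_ord// => k _.
  by rewrite -exprMn conj_norm_cq norm_cis expr1n /= expr1n.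
wlog : a b aM bM ab / (a < b)%N => [hw|lab].
  have [lab|lba] := ltnP a b; first exact: hw.
  apply: (can_inj conjCK); rewrite rmorph0 rmorph_sum -[RHS](hw b a)//.
  - by apply: eq_bigr => k _; rewrite rmorphM !rmorphXn /= conjCK mulrC.
  - by rewrite eq_sym.
  - by rewrite ltn_neqAle eq_sym ab.
pose w := cis (- ((b - a)%:R * (2 * pi / M%:R))).
rewrite (eq_bigr (fun k : 'I_M => w ^+ k)) => [|k _]; last first.
  rewrite conj_cis !cisX -cisD; congr cis; rewrite natrB 1?ltnW//; ring.
have w1 : w != 1.
  rewrite /w -conj_cis; apply: contra_neq (cis_neq1 (t := (b - a)%:R * (2 * pi / M%:R)) _).
    by move/(congr1 Num.conj); rewrite conjCK rmorph1.
  rewrite mulr_gt0 ?ltr0n ?subn_gt0 ?divr_gt0// ?mulr_gt0//=.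
  rewrite mulrA ltr_pdivrMr// mulrC ltr_pM2l ?mulr_gt0// ltr_nat.
  by rewrite (leq_ltn_trans (leq_subr _ _)).
have wM : w ^+ M = 1.
  rewrite /w -conj_cis -rmorphXn cisX.
  rewrite (_ : _ * _ = (b - a)%:R * (2 * pi)) ?cis2pi ?rmorph1//.
  by field; rewrite gt_eqF.
by apply: (mulfI (x := w - 1)); rewrite ?subr_eq0// -subrX1 wM subrr mulr0.
Qed.

Local Notation dX := (@deriv {poly C}).
(** Bivariate polynomials are evaluated at (z, conj z), so this is the derivative in conj z, and
    [dX (dY U)] is a quarter of the Laplacian. *)
Definition dY U : B := swapXY (swapXY U)^`().

Lemma horner2_coef_wide M U x y : (size U <= M)%N -> (sizeY U <= M)%N ->
  U.[x, y] = \sum_(a < M) \sum_(b < M) U`_a`_b * (x ^+ a * y ^+ b).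
Proof.
move=> UM UM'; rewrite (horner_coef_wide _ UM) horner_sum; apply: eq_bigr => a _.
rewrite -polyC_exp hornerM hornerC (horner_coef_wide _ (leq_trans (max_size_coefXY _ _) UM')) mulr_suml.
by apply: eq_bigr => b _; rewrite mulrAC mulrA.
Qed.

(** As all exponents are below [M], the average over the M-th roots of unity keeps exactly the
    monomials with equal exponents, as integration over the circle would. *)
Lemma circle_average M U (rho : C) : (0 < M)%N -> (size U <= M)%N -> (sizeY U <= M)%N ->
  \sum_(k < M) U.[rho * cis (k%:R * (2 * pi / M%:R)), rho * (cis (k%:R * (2 * pi / M%:R)))^*] =
  M%:R * \sum_(a < M) U`_a`_a * rho ^+ a.*2.
Proof.
move=> M0 UM UM'; under eq_bigr => k _ do rewrite (horner2_coef_wide _ _ UM UM').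
rewrite exchange_big mulr_sumr/=; apply: eq_bigr => a _.
rewrite exchange_big/= (bigD1 a)//= [X in _ + X]big1 ?addr0 => [|b ba].
- under eq_bigr => k _ do rewrite !exprMn mulrACA -exprD addnn.
  by rewrite -!mulr_sumr cis_sum_unity// eqxx mulrA mulrC.
- under eq_bigr => k _ do rewrite !exprMn mulrACA -exprD.
  by rewrite -!mulr_sumr cis_sum_unity// eq_sym (negbTE ba : (b == a :> nat) = false) !mulr0.
Qed.

Lemma Re_sum (T : Type) (r : seq T) (P : pred T) (f : T -> C) :
  complex.Re (\sum_(i <- r | P i) f i) = \sum_(i <- r | P i) complex.Re (f i).
Proof. by apply: (big_morph (@complex.Re R)) => // -[? ?] [? ?]. Qed.

Lemma Re_natM n (z : C) : complex.Re (n%:R * z) = n%:R * complex.Re z.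
Proof.
elim: n => [|n IH]; first by rewrite !mul0r.
by rewrite -!natr1 !mulrDl !mul1r -IH raddfD.
Qed.

(* Averaging over circles only sees the diagonal coefficients [w_n] of the
   polynomial; the hypothesis makes [x |-> x A'(x)] nondecreasing on the unit
   interval for [A(x) = sum_n w_n x^n], hence [A 0 <= A 1]. *)
Lemma subharmonic_diag M U : (0 < M)%N -> (size U <= M)%N -> (sizeY U <= M)%N ->
  (forall z, `|cq z| < 1 -> 0 <= complex.Re (dX (dY U)).[z, z^*]) ->
  complex.Re U`_0`_0 <= \sum_(n < M) complex.Re U`_n`_n.
Proof.
move=> M0 UM UM' hU; set D := dX (dY U).
have Dn n : D`_n`_n = (n.+1 ^ 2)%:R * U`_n.+1`_n.+1.
  rewrite /D coef_deriv coefMn /dY coef_swapXY coef_deriv coefMn coef_swapXY.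
  by rewrite -mulrnA mulr_natl mulnn.
have DM : (size D <= M)%N.
  apply/leq_sizeP => i iM; apply/polyP => j.
  rewrite coef0 coef_deriv coefMn coef_swapXY coef_deriv coefMn coef_swapXY.
  by rewrite (leq_sizeP _ _ UM) ?coef0 ?mul0rn// leqW.
have DM' : (sizeY D <= M)%N.
  rewrite sizeYE; apply/leq_sizeP => i iM; apply/polyP => j.
  rewrite coef0 coef_swapXY coef_deriv coefMn coef_swapXY coef_deriv coefMn.
  by move: UM'; rewrite sizeYE => /leq_sizeP -> //; rewrite ?coef0 ?mul0rn// leqW.
pose A : {poly R} := \poly_(n < M) complex.Re U`_n`_n.
have A1 : \sum_(n < M) complex.Re U`_n`_n = A.[1].
  by rewrite horner_poly; apply: eq_bigr => n _; rewrite expr1n mulr1.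
have A0 : complex.Re U`_0`_0 = A.[0].
  by rewrite horner_coef0 coef_poly M0.
(* Its coefficients are (n+1)^2 w_(n+1), so Q(x) is the mean of the real part of [D] over the circle
   of radius sqrt x, hence nonnegative. *)
rewrite A1 A0; pose Q := ('X * A^`())^`().
have Q0 (x : R) : 0 <= x < 1 -> 0 <= Q.[x].
  move=> /andP[x0 x1]; pose s := Num.sqrt x.
  have s2 : s ^+ 2 = x by rewrite sqr_sqrtr.
  have sz k : `|cq ((s%:C)%C * cis (k%:R * (2 * pi / M%:R)))| < 1.
    rewrite norm_cqM norm_cis mulr1 norm_cq_real ger0_norm ?sqrtr_ge0//.
    by rewrite -(expr_lt1 (n := 2)) ?sqrtr_ge0// s2.
  have := circle_average (s%:C)%C M0 DM DM' => /(congr1 (@complex.Re R)).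
  rewrite Re_sum Re_natM => h.
  have : 0 <= M%:R * complex.Re (\sum_(a < M) D`_a`_a * s%:C%C ^+ a.*2).
    rewrite -h sumr_ge0// => k _; have := hU _ (sz k).
    have sc : ((s%:C)%C : C)^* = (s%:C)%C by apply/eqP; rewrite eq_complex/= oppr0 !eqxx.
    set w := cis _; have -> : (s%:C%C * w)^* = s%:C%C * w^* by rewrite rmorphM; congr (_ * _).
    by [].
  rewrite pmulr_rge0 ?ltr0n// Re_sum.
  have -> : Q.[x] = \sum_(a < M) Q`_a * x ^+ a.
    apply: horner_coef_wide; apply/leq_sizeP => i iM.
    by rewrite coef_deriv coefXM coef_deriv coef_poly ltnNge (leqW iM) !mul0rn.
  congr (_ <= _); apply: eq_bigr => a _.
  rewrite Dn coef_deriv coefXM coef_deriv /= coef_poly.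
  have -> : s%:C%C ^+ a.*2 = ((x ^+ a)%:C)%C :> C by rewrite -mul2n exprM -!rmorphXn /= s2.
  rewrite -mulrA Re_natM.
  have -> : (if (a.+1 < M)%N then complex.Re U`_a.+1`_a.+1 else 0) = complex.Re U`_a.+1`_a.+1.
    by case: ltnP => // aM; rewrite (leq_sizeP _ _ UM)// coef0.
  case: (U`_a.+1`_a.+1) => c d /=.
  by rewrite mulr0 subr0 -mulrnA mulnn -[c *+ _]mulr_natl mulrA.
have P0 (x : R) : 0 < x <= 1 -> 0 <= ('X * A^`()).[x].
  move=> /andP[x0 x1]; have [c] := poly_mvt ('X * A^`()) x0.
  rewrite in_itv/= => /andP[c0 cx]; rewrite !hornerM !hornerX mul0r !subr0 => ->.
  by rewrite mulr_ge0 ?Q0// ?(ltW c0) ?(lt_le_trans cx)// ltW.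
have [c] := poly_mvt A (ltr01 : (0 : R) < 1); rewrite in_itv/= => /andP[c0 c1] h.
rewrite -subr_ge0 h subr0 mulr1 -(pmulr_rge0 _ c0).
by have := P0 c; rewrite hornerM hornerX; apply; rewrite c0 ltW.
Qed.

Definition hol p : B := p^:P.
Definition anti p : B := (map_poly Num.conj p)%:P.

Lemma hol_eval p z w : (hol p).[z, w] = p.[z].
Proof. by rewrite /hol horner_map hornerC. Qed.

Lemma anti_eval p z w : (anti p).[w, z^*] = p.[z]^*.
Proof. by rewrite /anti hornerC horner_map. Qed.

Lemma dX_hol p : dX (hol p) = hol p^`().
Proof. by rewrite /hol deriv_map. Qed.

Lemma dX_anti p : dX (anti p) = 0.
Proof. exact: derivC. Qed.

Lemma dY_hol p : dY (hol p) = 0.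
Proof. by rewrite /dY /hol swapXY_map_polyC derivC rmorph0. Qed.

Lemma dY_anti p : dY (anti p) = anti p^`().
Proof. by rewrite /dY /anti swapXY_polyC deriv_map swapXY_map_polyC deriv_map. Qed.

Lemma dY_const (c : C) : dY c%:P%:P = 0.
Proof. by rewrite /dY swapXY_polyC map_polyC /= derivC rmorph0. Qed.

Lemma dYD U V : dY (U + V) = dY U + dY V.
Proof. by rewrite /dY rmorphD derivD rmorphD. Qed.

Lemma dYM U V : dY (U * V) = dY U * V + U * dY V.
Proof. by rewrite /dY rmorphM derivM rmorphD !rmorphM /= !swapXYK. Qed.

(** The expression is the mixed derivative of the Bellman function, with [a] = F' and [p] the
    z-derivative of t. Completing squares with p u + (t + 1/2) u' uses up the terms in [p]; the
    squares |a conj(u) conj(c) - v'|^2 and |a conj(v) conj(c) - u'|^2 absorb the products with [c].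
    What remains is 2 t |a|^2 (|u|^2 + |v|^2) and a multiple of |u'|^2 + |v'|^2 by 6 - 1/2 - 1 - t -
    t^2, which is positive. *)
Lemma bellman_form (a u v u' v' p c : C) (t : R) : 0 <= t <= 1 -> c * c^* = 1 ->
  0 <= complex.Re ((2 * (t%:C)%C + 1) * (a * a^*) * (u * u^* + v * v^*) +
    2 * (p * p^*) * (u * u^* + v * v^*) +
    (2 * (t%:C)%C + 1) * (p * (u * u'^* + v * v'^*) + p^* * (u' * u^* + v' * v^*)) +
    ((t%:C)%C ^+ 2 + (t%:C)%C + 6) * (u' * u'^* + v' * v'^*) -
    c * ((u' * v + u * v') * a^*) - c^* * (a * (u'^* * v^* + u^* * v'^*))).
Proof.
move=> /andP[t0 t1] cc; set tau : C := (t%:C)%C.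
have tt : tau^* = tau by apply/eqP; rewrite eq_complex/= oppr0 !eqxx.
have hh : (2^-1 : C)^* = 2^-1 by rewrite rmorphV ?unitfE ?pnatr_eq0// rmorph_nat.
have [N [N0 NE]] : exists N : C -> R, (forall z, 0 <= N z) /\ forall z, ((N z)%:C)%C = z * z^*.
  exists (fun z => `|cq z| ^+ 2); split=> z; first by rewrite exprn_ge0.
  by rewrite conj_norm_cq.
rewrite [X in complex.Re X](_ : _ = ((2 * N (p * u + (tau + 2^-1) * u') +
   2 * N (p * v + (tau + 2^-1) * v') + N (a * u^* * c^* - v') + N (a * v^* * c^* - u') +
   2 * t * (N a * (N u + N v)) + (9 / 2 - t ^+ 2 - t) * (N u' + N v'))%:C)%C).
  have h1 : 0 <= 9 / 2 - t ^+ 2 - t by nra.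
  have h2 : 0 <= 2 * t by lra.
  by rewrite [complex.Re _]/= !addr_ge0// !mulr_ge0// addr_ge0.
have rD (x y : R) : ((x + y)%:C)%C = (x%:C)%C + (y%:C)%C :> C by exact: rmorphD.
have rN (x : R) : ((- x)%:C)%C = - (x%:C)%C :> C by exact: rmorphN.
have r1 : ((1 : R)%:C)%C = 1 :> C by [].
have rM (x y : R) : ((x * y)%:C)%C = (x%:C)%C * (y%:C)%C :> C by exact: rmorphM.
have rX (x : R) : ((x ^+ 2)%:C)%C = (x%:C)%C ^+ 2 :> C by exact: rmorphXn.
have rn n : ((n%:R : R)%:C)%C = n%:R :> C by exact: rmorph_nat.
have rV : (((2^-1 : R))%:C)%C = 2^-1 :> C.
  have h2 : (2 : C) != 0 by rewrite pnatr_eq0.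
  by apply: (mulfI h2); rewrite -[in LHS](rn 2) -rM !mulfV ?pnatr_eq0.
rewrite !(rD, rM, rN, rX, r1, rn, rV, NE) -/tau.
rewrite !(rmorphD, rmorphN, rmorphM) /= !conjCK tt hh.
have e (x w : C) : (a * x^* * c^* - w) * (a^* * x * c - w^*) =
    a * a^* * (x * x^*) - a * x^* * c^* * w^* - w * (a^* * x * c) + w * w^*.
  by rewrite -[a * a^* * (x * x^*)]mulr1 -cc; ring.
by rewrite !e; field.
Qed.

Section Defect.
Variable N : nat.

(** When [N] bounds the size of [p] or of [q], this is the analytic part, constant term included, of
    the Poisson extension of q conj(p). In [defect] the constant occurs in both [mixed] terms and is
    subtracted once. *)
Definition mixed p q : {poly C} := \sum_(j < N) (p`_j)^* *: drop_poly j q.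

(* The value at [z] is [(1 - |z|^2) sum_j g_j(h)(z) conj(g_j(F)(z))]; the present
   form shows that its mixed derivative is [- h' conj(F')]. *)
Definition defect p q : B :=
  hol (mixed p q) + anti (mixed q p) - (\sum_(j < N) q`_j * (p`_j)^*)%:P%:P - hol q * anti p.

Lemma drop_poly_step p j z : (drop_poly j p).[z] = z * (drop_poly j.+1 p).[z] + p`_j.
Proof.
rewrite [in LHS](_ : drop_poly j p = 'X * drop_poly j.+1 p + (p`_j)%:P); first by rewrite !hornerE.
apply/polyP => -[|i]; rewrite coefD coefXM coefC !coef_drop_poly /=.
  by rewrite add0r add0n.
by rewrite addr0 addSnnS.
Qed.

(** Expanding every [drop_poly j] by one Horner step telescopes the sum; the remainder is a product
    with a factor [drop_poly N] of a polynomial of size at most [N], hence zero. *)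
Lemma defect_eval p q z : (size p <= N)%N || (size q <= N)%N -> (defect p q).[z, z^*] =
  (1 - z * z^*) * \sum_(j < N) (drop_poly j.+1 q).[z] * (drop_poly j.+1 p).[z]^*.
Proof.
move=> hN; rewrite /defect !(hornerD, hornerN, hornerM) !hol_eval !anti_eval 2!hornerC /mixed !horner_sum.
rewrite rmorph_sum/=.
under eq_bigr => j _ do rewrite hornerZ.
under [X in _ + X - _ - _]eq_bigr => j _ do rewrite hornerZ rmorphM/= conjCK.
have h M : (1 - z * z^*) * \sum_(j < M) (drop_poly j.+1 q).[z] * (drop_poly j.+1 p).[z]^* =
  \sum_(j < M) (p`_j)^* * (drop_poly j q).[z] + \sum_(j < M) q`_j * (drop_poly j p).[z]^* -
  \sum_(j < M) q`_j * (p`_j)^* - q.[z] * p.[z]^* + (drop_poly M q).[z] * (drop_poly M p).[z]^*.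
  elim: M => [|M IH]; first by rewrite !big_ord0 !drop_poly0l; ring.
  rewrite !big_ord_recr /= mulrDr IH !(drop_poly_step _ M) !rmorphD !rmorphM /=; ring.
rewrite h; have -> : (drop_poly N q).[z] * (drop_poly N p).[z]^* = 0.
  by case/orP: hN => hN; rewrite (drop_poly_eq0 hN) horner0 ?conjC0 ?mulr0 ?mul0r.
by rewrite addr0.
Qed.

End Defect.

End Bellman.

(** * Mixed derivatives and the bilinear bound *)

Section BellmanBound.
Variable R : realType.
Local Notation C := R[i].
Local Notation B := {poly {poly C}}.
Implicit Types (x y z : C) (p q u v h F : {poly C}) (U V : B).
Local Notation dX := (@deriv {poly C}).

Lemma hornerB2 U V z w : (U - V).[z, w] = U.[z, w] - V.[z, w].
Proof. by rewrite hornerD hornerN hornerD hornerN. Qed.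

Lemma hornerD2 U V z w : (U + V).[z, w] = U.[z, w] + V.[z, w].
Proof. by rewrite !hornerD. Qed.

Lemma hornerM2 U V z w : (U * V).[z, w] = U.[z, w] * V.[z, w].
Proof. by rewrite !hornerM. Qed.

Lemma hornerC2 (c z w : C) : (c%:P%:P : B).[z, w] = c.
Proof. by rewrite !hornerC. Qed.

(** The value, the derivatives in z and in conj z, and the mixed derivative. These four numbers
    determine those of sums and products, so the Laplacian of the Bellman function is assembled by
    rules instead of expanding polynomials. *)
Definition jet z U (a ax ay axy : C) :=
  [/\ U.[z, z^*] = a, (dX U).[z, z^*] = ax, (dY U).[z, z^*] = ay & (dX (dY U)).[z, z^*] = axy].

Lemma jetD z U V a ax ay axy b bx b_y bxy : jet z U a ax ay axy -> jet z V b bx b_y bxy ->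
  jet z (U + V) (a + b) (ax + bx) (ay + b_y) (axy + bxy).
Proof.
move=> [<- <- <- <-] [<- <- <- <-]; split.
- exact: hornerD2.
- by rewrite derivD hornerD2.
- by rewrite dYD hornerD2.
- by rewrite dYD derivD hornerD2.
Qed.

Lemma jetM z U V a ax ay axy b bx b_y bxy : jet z U a ax ay axy -> jet z V b bx b_y bxy ->
  jet z (U * V) (a * b) (ax * b + a * bx) (ay * b + a * b_y)
    (axy * b + ay * bx + (ax * b_y + a * bxy)).
Proof.
move=> [<- <- <- <-] [<- <- <- <-]; split.
- exact: hornerM2.
- by rewrite derivM hornerD2 !hornerM2.
- by rewrite dYM hornerD2 !hornerM2.
- by rewrite dYM derivD !derivM 3!hornerD2 !hornerM2.
Qed.

Lemma horner02 z w : (0 : B).[z, w] = 0.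
Proof. by rewrite !horner0. Qed.

Lemma jet_hol z p : jet z (hol p) p.[z] p^`().[z] 0 0.
Proof. by split; rewrite ?dY_hol ?dX_hol ?linear0 ?horner02 ?hol_eval. Qed.

Lemma jet_anti z p : jet z (anti p) (p.[z]^*) 0 (p^`().[z]^*) 0.
Proof.
split; first exact: anti_eval.
- by rewrite dX_anti horner02.
- by rewrite dY_anti anti_eval.
- by rewrite dY_anti dX_anti horner02.
Qed.

Lemma jet_const z c : jet z c%:P%:P c 0 0 0.
Proof.
split; first exact: hornerC2.
- by rewrite derivC horner02.
- by rewrite dY_const horner02.
- by rewrite dY_const raddf0 horner02.
Qed.

Lemma jetN z U a ax ay axy : jet z U a ax ay axy -> jet z (- U) (- a) (- ax) (- ay) (- axy).
Proof.
move=> /(jetM (jet_const z (- 1))).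
by rewrite !rmorphN !rmorph1 !mulN1r !mul0r !add0r.
Qed.

Lemma jet_defect N z p q : (size p <= N)%N || (size q <= N)%N ->
  jet z (defect N p q)
    ((1 - z * z^*) * \sum_(j < N) (drop_poly j.+1 q).[z] * (drop_poly j.+1 p).[z]^*)
    ((mixed N p q)^`().[z] - q^`().[z] * p.[z]^*)
    ((mixed N q p)^`().[z]^* - q.[z] * p^`().[z]^*)
    (- (q^`().[z] * p^`().[z]^*)).
Proof.
move=> hN; rewrite -(defect_eval z hN).
have := jetD (jetD (jetD (jet_hol z (mixed N p q)) (jet_anti z (mixed N q p)))
  (jetN (jet_const z (\sum_(j < N) q`_j * (p`_j)^*)))) (jetN (jetM (jet_hol z q) (jet_anti z p))).
rewrite -/(defect N p q) => -[_ h1 h2 h3]; split=> //.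
- by rewrite h1; ring.
- by rewrite h2; ring.
- by rewrite h3; ring.
Qed.

(** On the circle the defects vanish, so t = 1 and [W] is 8 (|u|^2 + |v|^2), with mean given by the
    coefficients. At the centre the weight term is nonnegative and the rest is twice the left-hand
    side, so 8 halves to 4. The defect at 0 omits the product of constant terms, which is why
    indices start at 1. *)
Lemma bellman (N : nat) F u v (c : C) : (size F <= N)%N -> c * c^* = 1 ->
  (forall z, `|cq z| <= 1 ->
     (1 - `|cq z| ^+ 2) * \sum_(j < N) `|cq (drop_poly j.+1 F).[z]| ^+ 2 <= 1) ->
  complex.Re (c * \sum_(j < N) (u * v)`_j.+1 * (F`_j.+1)^*) <=
  4 * (\sum_(n < size u) `|cq u`_n| ^+ 2 + \sum_(n < size v) `|cq v`_n| ^+ 2).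
Proof.
move=> FN cc hS.
pose S z := (1 - `|cq z| ^+ 2) * \sum_(j < N) `|cq (drop_poly j.+1 F).[z]| ^+ 2.
have S0 z : `|cq z| <= 1 -> 0 <= S z.
  by move=> z1; apply: mulr_ge0; [rewrite subr_ge0 expr_le1|apply: sumr_ge0 => j _; exact: exprn_ge0].
pose T : B := 1%:P%:P - defect N F F.
have evT z : T.[z, z^*] = ((1 - S z)%:C)%C.
  rewrite /T hornerB2 hornerC2 defect_eval ?FN// rmorphB rmorph1; congr (_ - _).
  rewrite /S rmorphM rmorphB rmorph1 /= -conj_norm_cq rmorph_sum/=; congr (_ * _).
  by apply: eq_bigr => j _; rewrite conj_norm_cq.
pose Q : B := hol u * anti u + hol v * anti v.
pose K : B := c%:P%:P * defect N F (u * v) + (c^*)%:P%:P * defect N (u * v) F.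
pose W : B := (T * T + T + 6%:P%:P) * Q + K.
have evQ z : Q.[z, z^*] = ((`|cq u.[z]| ^+ 2 + `|cq v.[z]| ^+ 2)%:C)%C.
  by rewrite /Q hornerD2 !hornerM2 !hol_eval !anti_eval !conj_norm_cq -rmorphD.
have evK z : K.[z, z^*] = (1 - z * z^*) *
   (c * (\sum_(j < N) (drop_poly j.+1 (u * v)).[z] * (drop_poly j.+1 F).[z]^*) +
    c^* * (\sum_(j < N) (drop_poly j.+1 F).[z] * (drop_poly j.+1 (u * v)).[z]^*)).
  rewrite /K hornerD2 2!hornerM2 2!hornerC2 2?defect_eval ?FN ?orbT//.
  by rewrite mulrDr; congr (_ + _); rewrite mulrCA.
have evM z : (T * T + T + 6%:P%:P).[z, z^*] = (((1 - S z) * (1 - S z) + (1 - S z))%:C)%C + 6.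
  by rewrite 2!hornerD2 hornerM2 hornerC2 evT -rmorphM -rmorphD.
have pos z : `|cq z| < 1 -> 0 <= complex.Re (dX (dY W)).[z, z^*].
  move=> z1; have z1' := ltW z1.
  have t01 : 0 <= 1 - S z <= 1 by rewrite subr_ge0 gerBl S0// andbT; exact: hS.
  pose p := F^`().[z] * F.[z]^* - (mixed N F F)^`().[z].
  have := bellman_form F^`().[z] u.[z] v.[z] u^`().[z] v^`().[z] p t01 cc.
  have JT : jet z T ((1 - S z)%:C)%C p p^* (F^`().[z] * F^`().[z]^*).
    have h : (size F <= N)%N || (size F <= N)%N by rewrite FN.
    have [_ h1 h2 h3] := jetD (jet_const z 1) (jetN (jet_defect z h)).
    split; [exact: evT|rewrite h1 /p; ring|rewrite h2 /p|rewrite h3; ring].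
    by rewrite rmorphB rmorphM/= conjCK; ring.
  have h1 : (size F <= N)%N || (size (u * v)%R <= N)%N by rewrite FN.
  have h2 : (size (u * v)%R <= N)%N || (size F <= N)%N by rewrite FN orbT.
  have [_ _ _ ->] := jetD (jetM (jetD (jetD (jetM JT JT) JT) (jet_const z 6))
    (jetD (jetM (jet_hol z u) (jet_anti z u)) (jetM (jet_hol z v) (jet_anti z v))))
    (jetD (jetM (jet_const z c) (jet_defect z h1)) (jetM (jet_const z c^*) (jet_defect z h2))).
  congr (_ <= complex.Re _).
  rewrite derivM hornerD !hornerM rmorphD !rmorphM /=; ring.
pose M := (maxn (size W) (sizeY W) + maxn (size Q) (sizeY Q) + maxn (size u) (size v) + 1)%N.
have M0 : (0 < M)%N by rewrite /M addn1.
have MC : (M%:R : C) != 0 by rewrite pnatr_eq0 -lt0n.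
have [WM WM'] : (size W <= M)%N /\ (sizeY W <= M)%N.
  by split; rewrite /M -!addnA (leq_trans _ (leq_addr _ _)) ?leq_maxl ?leq_maxr.
have [QM QM'] : (size Q <= M)%N /\ (sizeY Q <= M)%N.
  by split; rewrite /M [X in (X + _ + _)%N]addnC -!addnA (leq_trans _ (leq_addr _ _)) ?leq_maxl ?leq_maxr.
have [uM vM] : (size u <= M)%N /\ (size v <= M)%N.
  by split; rewrite /M addnAC (leq_trans _ (leq_addl _ _)) ?leq_maxl ?leq_maxr.
have := subharmonic_diag M0 WM WM' pos.
have -> : \sum_(n < M) complex.Re W`_n`_n =
    8 * (\sum_(n < size u) `|cq u`_n| ^+ 2 + \sum_(n < size v) `|cq v`_n| ^+ 2).
  have eW : \sum_(a < M) W`_a`_a = 8 * \sum_(a < M) Q`_a`_a.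
    have := circle_average 1 M0 WM WM'; have := circle_average 1 M0 QM QM'.
    under [X in _ = _ * X -> _]eq_bigr => a _ do rewrite expr1n mulr1.
    under [X in _ -> _ = _ * X -> _]eq_bigr => a _ do rewrite expr1n mulr1.
    move=> hQ hW; apply: (mulfI MC); rewrite -hW mulrCA -hQ mulr_sumr.
    apply: eq_bigr => k _; rewrite !mul1r; set w := cis _.
    have w1 : `|cq w| = 1 := norm_cis _.
    rewrite /W hornerD2 hornerM2 evM evK.
    rewrite (_ : 1 - w * w^* = 0); last by rewrite conj_norm_cq w1 expr1n subrr.
    rewrite /S w1 expr1n subrr mul0r subr0 mul0r addr0; congr (_ * _).
    by rewrite mulr1 rmorphD rmorph1; ring.
  rewrite -Re_sum eW Re_natM Re_sum; congr (_ * _).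
  rewrite (big_ord_widen M (fun n => `|cq u`_n| ^+ 2))//.
  rewrite (big_ord_widen M (fun n => `|cq v`_n| ^+ 2))// [in RHS]big_mkcond [X in _ + X]big_mkcond.
  rewrite -big_split/=; apply: eq_bigr => n _.
  rewrite /Q !coefD /anti /hol !coefMC !coef_map !coefCM /= !coef_map !conj_norm_cq /=.
  by congr (_ + _); case: ltnP => // h; rewrite nth_default// rmorph0 normr0 expr0n.
have -> : W`_0`_0 = W.[0, 0^*] by rewrite conjC0 !horner_coef0.
rewrite /W hornerD2 hornerM2 evM evQ evK.
rewrite mul0r subr0 mul1r.
have d0 h n : (drop_poly n h).[0] = h`_n by rewrite horner_coef0 coef_drop_poly.
under eq_bigr => j _ do rewrite !d0.
under [X in _ + (_ + _ * X)]eq_bigr => j _ do rewrite !d0.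
set X := \sum_(j < N) (u * v)`_j.+1 * (F`_j.+1)^*.
have -> : \sum_(j < N) F`_j.+1 * ((u * v)`_j.+1)^* = X^*.
  by rewrite rmorph_sum/=; apply: eq_bigr => j _; rewrite rmorphM/= conjCK mulrC.
set q := `|cq _| ^+ 2 + _; set t := 1 - S 0.
have t01 : 0 <= t <= 1 by rewrite subr_ge0 gerBl S0 ?hS// rmorph0 normr0.
have q0 : 0 <= q by rewrite addr_ge0 ?exprn_ge0.
have -> : complex.Re (((t * t + t)%:C%C + 6) * q%:C%C + (c * X + c^* * X^*)) =
    (t * t + t + 6) * q + 2 * complex.Re (c * X).
  have -> : (6 : C) = ((6 : R)%:C)%C by rewrite rmorph_nat.
  rewrite -!rmorphD -!rmorphM; case: (c * X) => a b.
  by rewrite /=; ring.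
move: t01 => /andP[t0 t1] h.
have tt := mulr_ge0 t0 t0.
have : 0 <= (t * t + t + 6) * q by apply: mulr_ge0 => //; lra.
lra.
Qed.
End BellmanBound.

(** * John-Nirenberg and Garsia estimates *)

Section JohnNirenberg.
Variable R : realType.
Implicit Types (u v t c K : R).

Definition avg u v (f : R -> R) : R := (v - u)^-1 * itg u v f.

Definition osc_le K (f : R -> R) := forall u v, u < v -> v - u <= 2 * pi ->
  itg u v (fun t => `|f t - avg u v f|) <= K * (v - u).

Variables (f : R -> R) (cf : continuous f).

Let cfB c : continuous (fun t => f t - c).
Proof. by apply: ctsB => //; exact: cts_cst. Qed.

Let cfA c : continuous (fun t => `|f t - c|).
Proof. exact: cts_norm. Qed.

Let cfS c : continuous (fun t => (f t - c) ^+ 2).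
Proof. exact: cts_exp. Qed.

Lemma avgE u v : u < v -> itg u v f = (v - u) * avg u v f.
Proof. by move=> uv; rewrite /avg mulVKf// gt_eqF// subr_gt0. Qed.

Lemma itg_center u v c : u < v -> itg u v (fun t => f t - c) = (v - u) * (avg u v f - c).
Proof.
move=> uv; rewrite itgB//; last exact: cts_cst.
by rewrite avgE// itg_cst ?(ltW uv)//; ring.
Qed.

Lemma itg_sqr_center u v c : u < v -> itg u v (fun t => (f t - c) ^+ 2) =
  itg u v (fun t => (f t - avg u v f) ^+ 2) + (v - u) * (avg u v f - c) ^+ 2.
Proof.
move=> uv; set m := avg u v f.
have -> : itg u v (fun t => (f t - c) ^+ 2) =
    itg u v (fun t => (f t - m) ^+ 2 + (2 * (m - c) * (f t - m) + (m - c) ^+ 2)).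
  by apply: eq_itg => t _; ring.
rewrite itgD//; last by apply: ctsD; [apply: ctsM => //; exact: cts_cst|exact: cts_cst].
rewrite itgD; [|by apply: ctsM => //; exact: cts_cst|exact: cts_cst].
rewrite itgZ// itg_center// itg_cst ?(ltW uv)// -/m; ring.
Qed.

Lemma avg_dist_le u v c : u < v -> (v - u) * `|avg u v f - c| <= itg u v (fun t => `|f t - c|).
Proof.
move=> uv; have vu : 0 < v - u by rewrite subr_gt0.
by rewrite -[v - u in leLHS]gtr0_norm// -normrM -itg_center//; exact: itg_norm.
Qed.

Variable K : R.
Hypotheses (K0 : 0 < K) (fK : osc_le K f).

Lemma avg_half_dist u v w w' : u < v -> v - u <= 2 * pi -> w < w' -> u <= w -> w' <= v ->
  v - u = 2 * (w' - w) -> `|avg w w' f - avg u v f| <= 2 * K.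
Proof.
move=> uv uv2 ww uw wv e; have ww0 : 0 < w' - w by rewrite subr_gt0.
rewrite -(ler_pM2l ww0); apply: le_trans (avg_dist_le _ ww) _.
have h : itg u v (fun t => `|f t - avg u v f|) <= K * (v - u) by exact: fK.
apply: le_trans (_ : _ <= itg u v (fun t => `|f t - avg u v f|)) _; last first.
  by apply: le_trans h _; rewrite e; lra.
have wv' : w <= v by exact: le_trans (ltW ww) wv.
have uwv : u <= w <= v by rewrite uw.
have wwv : w <= w' <= v by rewrite (ltW ww).
rewrite (itg_cat (@cfA _) uwv) (itg_cat (@cfA _) wwv).
have := @itg_ge0 R (fun t => `|f t - avg u v f|) u w (fun t _ => normr_ge0 _).
have := @itg_ge0 R (fun t => `|f t - avg u v f|) w' v (fun t _ => normr_ge0 _).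
lra.
Qed.

Hypothesis fU : forall e : R, 0 < e -> exists2 d : R, 0 < d &
  forall s t, `|s - t| <= d -> `|f s - f t| <= e.

(* A maximal dyadic piece whose mean leaves the window of radius [2K] around
   [c] has mean within [4K] of [c]; elsewhere [|f - c| <= 3K]. *)
Let halving (N : R) c u v : (forall u v, u < v -> v - u <= 2 * pi ->
    itg u v (fun t => (f t - avg u v f) ^+ 2) <= N * (v - u)) -> 0 <= N ->
  u < v -> v - u <= 2 * pi -> `|avg u v f - c| <= 2 * K ->
  itg u v (fun t => (f t - c) ^+ 2) <= (N / (2 * K) + 4 * K) * itg u v (fun t => `|f t - c|).
Proof.
move=> hN N0; have K0' := K0; have [d d0 hd] := fU K0.
set kap := N / (2 * K) + 4 * K.
have NK0 : 0 <= N / (2 * K) by rewrite divr_ge0//; lra.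
have kap4 : 4 * K <= kap by rewrite /kap; lra.
move=> uv uv2 hc; have [n hn] : exists n : nat, v - u <= d * 2 ^+ n.
  exists (Num.truncn ((v - u) / d)).+1; rewrite mulrC -ler_pdivrMr//.
  apply: le_trans (ltW (truncnS_gt _)) _.
  by rewrite -natrX ler_nat ltnW// ltn_expl.
elim: n u v uv uv2 hc hn => [|n IH] u v uv uv2 hc hn.
  rewrite expr0 mulr1 in hn.
  rewrite -itgZ//; apply: le_itg => [//||t /andP[ut tv]]; first by apply: ctsM => //; exact: cts_cst.
  have tn : `|f t - c| <= 3 * K.
    have h : `|avg u v f - f t| <= K.
      have vu : 0 < v - u by rewrite subr_gt0.
      rewrite -(ler_pM2l vu); apply: le_trans (avg_dist_le _ uv) _.
      rewrite -[leRHS]mulrC -itg_cst ?(ltW uv)//; apply: le_itg => // [|s /andP[us sv]].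
        exact: cts_cst.
      by apply: hd; rewrite ler_norml; apply/andP; split; lra.
    have -> : f t - c = (avg u v f - c) - (avg u v f - f t) by ring.
    by apply: le_trans (ler_normB _ _) _; lra.
  rewrite -[(f t - c) ^+ 2]real_normK ?num_real// expr2 ler_wpM2r//; lra.
pose w := (u + v) / 2; have uw : u < w by rewrite /w; lra.
have wv : w < v by rewrite /w; lra.
have step a b : a < b -> u <= a -> b <= v -> v - u = 2 * (b - a) ->
    itg a b (fun t => (f t - c) ^+ 2) <= kap * itg a b (fun t => `|f t - c|).
  move=> ab ua bv e; have ba0 : 0 < b - a by rewrite subr_gt0.
  have hd2 := avg_half_dist uv uv2 ab ua bv e.
  have [h|h] := leP `|avg a b f - c| (2 * K).
    by apply: IH => //; [lra|rewrite exprS in hn; lra].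
  have h4 : `|avg a b f - c| <= 4 * K.
    have -> : avg a b f - c = (avg a b f - avg u v f) + (avg u v f - c) by ring.
    by apply: le_trans (ler_normD _ _) _; lra.
  rewrite itg_sqr_center//; have ab2 : b - a <= 2 * pi by lra.
  have h5 := hN a b ab ab2; have h6 := avg_dist_le c ab.
  have h7 : N * (b - a) <= N / (2 * K) * itg a b (fun t => `|f t - c|).
    rewrite -mulrA ler_wpM2l// -ler_pdivrMl ?invr_gt0; last lra.
    by rewrite invrK; apply: le_trans h6; rewrite mulrC ler_pM2l// ltW.
  rewrite -[(avg a b f - c) ^+ 2]real_normK ?num_real// expr2.
  have h8 : (b - a) * (`|avg a b f - c| * `|avg a b f - c|) <= 4 * K * itg a b (fun t => `|f t - c|).
    by rewrite mulrCA; apply: ler_pM => //; rewrite mulr_ge0// ltW.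
  by rewrite /kap mulrDl; lra.
have uwv : u <= w <= v by rewrite !ltW.
rewrite (itg_cat (@cfS c) uwv) (itg_cat (@cfA c) uwv) mulrDr.
by apply: lerD; apply: step => //; rewrite ?lexx ?(ltW uw) ?(ltW wv)//; rewrite /w; lra.
Qed.

(** A mean-square bound N valid on all arcs improves by [halving] to (N/(2K) + 4K) K = N/2 + 4 K^2,
    whose fixed point is 8 K^2. Boundedness of [f] supplies a first finite bound, which the
    iteration forgets geometrically; uniform continuity ends the bisection inside [halving]. *)
Lemma john_nirenberg (b : R) u v : (forall t, `|f t| <= b) -> u < v -> v - u <= 2 * pi ->
  itg u v (fun t => (f t - avg u v f) ^+ 2) <= 8 * K ^+ 2 * (v - u).
Proof.
move=> fb uv uv2; have K0' := K0.
have b0 : 0 <= b by apply: le_trans (fb 0).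
have hk k : forall u v, u < v -> v - u <= 2 * pi ->
    itg u v (fun t => (f t - avg u v f) ^+ 2) <=
    (8 * K ^+ 2 + 4 * b ^+ 2 * 2^-1 ^+ k) * (v - u).
  elim: k {u v uv uv2} => [|k IH] u v uv uv2.
    have vu : 0 < v - u by rewrite subr_gt0.
    have mb : `|avg u v f| <= b.
      rewrite -(ler_pM2l vu) -[avg u v f]subr0; apply: le_trans (avg_dist_le _ uv) _.
      rewrite mulrC -itg_cst ?(ltW uv)//; apply: le_itg => // [|t _]; first exact: cts_cst.
      by rewrite subr0.
    rewrite expr0 mulr1 -itg_cst ?(ltW uv)//; apply: le_itg => // [|t _]; first exact: cts_cst.
    apply: le_trans (_ : _ <= 4 * b ^+ 2) _; last by rewrite lerDr mulr_ge0// exprn_ge0// ltW.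
    rewrite -real_normK ?num_real//.
    have := le_trans (ler_normB (f t) (avg u v f)) (lerD (fb t) mb).
    by have := normr_ge0 (f t - avg u v f); move: `|_ - _| => x; nra.
  have e0 : `|avg u v f - avg u v f| <= 2 * K by rewrite subrr normr0; lra.
  set N := 8 * K ^+ 2 + _ in IH.
  have N0 : 0 <= N by rewrite addr_ge0 ?mulr_ge0 ?exprn_ge0// ltW.
  apply: le_trans (halving IH N0 uv uv2 e0) _.
  have kap0 : 0 <= N / (2 * K) + 4 * K by rewrite addr_ge0// ?divr_ge0//; lra.
  apply: le_trans (ler_wpM2l kap0 (fK uv uv2)) _; rewrite mulrA.
  rewrite ler_wpM2r ?subr_ge0 ?(ltW uv)//.
  have -> : (N / (2 * K) + 4 * K) * K = N / 2 + 4 * K ^+ 2 by field; rewrite gt_eqF.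
  by rewrite /N [2^-1 ^+ k.+1]exprS; lra.
have vu : 0 < v - u by rewrite subr_gt0.
rewrite -ler_pdivrMr//; apply/ler_addgt0Pr => e e0.
have [k hk'] : exists k, 4 * b ^+ 2 * 2^-1 ^+ k <= e.
  have h : `|2^-1 : R| < 1 by rewrite gtr0_norm; lra.
  have a0 : 0 < 4 * b ^+ 2 + 1 by rewrite ltr_wpDl// mulr_ge0// exprn_ge0.
  have /cvgrPdist_le/(_ (e / (4 * b ^+ 2 + 1)) (divr_gt0 e0 a0))[k _ kh] := cvg_expr h.
  exists k; have := kh k (leqnn k); rewrite /= sub0r normrN ger0_norm ?exprn_ge0// ler_pdivlMr//.
  have : 0 <= (2^-1 : R) ^+ k by rewrite exprn_ge0.
  by rewrite mulrC mulrDl mul1r; lra.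
by rewrite ler_pdivrMr//; apply: le_trans (hk k u v uv uv2) _; rewrite ler_pM2r// lerD2l.
Qed.

End JohnNirenberg.

(** * Garsia's bound from bounded oscillation *)

Section Garsia.
Variable R : realType.
Local Notation H := (quat R).
Local Notation C := R[i].
Implicit Types (f : R -> R) (u v t c K r : R).

Lemma osc_le_shift K f c : continuous f -> osc_le K f -> osc_le K (fun t => f (t + c)).
Proof.
move=> cf fK u v uv uv2; have uvc : u + c < v + c by rewrite ltrD2r.
have e : v + c - (u + c) = v - u by ring.
have ea : avg u v (fun t => f (t + c)) = avg (u + c) (v + c) f.
  by rewrite /avg e -itg_shift// ltW.
rewrite ea -(@itg_shift _ c (fun t => `|f t - _|)) ?(ltW uv)//.
  by rewrite -[v - u]e; apply: fK; rewrite ?e.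
by apply: cts_norm; apply: ctsB => //; exact: cts_cst.
Qed.

Lemma geo_sqr_sum n : \sum_(m < n) (2^-1 : R) ^+ m * (8 + 4 * m%:R ^+ 2) <= 40.
Proof.
have -> : \sum_(m < n) (2^-1 : R) ^+ m * (8 + 4 * m%:R ^+ 2) =
   40 - 2^-1 ^+ n * (8 * n%:R ^+ 2 + 16 * n%:R + 40).
  elim: n => [|n IH]; first by rewrite big_ord0 expr0; ring.
  by rewrite big_ord_recr/= IH [2^-1 ^+ n.+1]exprS -natr1; field.
by rewrite gerBl mulr_ge0 ?exprn_ge0// !addr_ge0 ?mulr_ge0 ?exprn_ge0.
Qed.

(** The constant is the average at scale 1 - r. Averages at consecutive dyadic scales differ by at
    most 2K, so window [k] has mean square at most 8 K^2 + (2 K (n-k))^2. The weights 2^-(n-k) sum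
    this to at most 40 K^2, and 16 * 2 pi * 40 = 1280 pi. *)
Lemma poisson_osc (K b r : R) f : continuous f -> 0 < K -> osc_le K f ->
  (forall e : R, 0 < e -> exists2 d : R, 0 < d & forall s t, `|s - t| <= d -> `|f s - f t| <= e) ->
  (forall t, `|f t| <= b) -> 0 <= r < 1 ->
  exists c, itg (- pi) pi (fun t => poisson r t * (f t - c) ^+ 2) <= 1280 * pi * K ^+ 2.
Proof.
move=> cf K0 fK fU fb r01; have pi0 := @pi_gt0 R.
have [n hn] := dyadic_scale r01.
pose a k : R := pi * 2^-1 ^+ k; pose m k := avg (- a k) (a k) f.
have h2 k : 0 < (2^-1 : R) ^+ k by rewrite exprn_gt0.
have a0 k : 0 < a k by rewrite mulr_gt0.
have api k : a k <= pi.
  by rewrite /a ler_piMr ?(ltW pi0)// exprn_ile1//; lra.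
have lt k : - a k < a k by have := a0 k; lra.
have le2 k : a k - - a k <= 2 * pi by have := api k; lra.
have aS k : a k = 2 * a k.+1 by rewrite /a exprS; field.
have step k : `|m k.+1 - m k| <= 2 * K.
  by apply: (avg_half_dist cf fK (lt k) (le2 k) (lt k.+1)); have := a0 k.+1; have := aS k; lra.
have dist j k : `|m k - m (k + j)%N| <= 2 * K * j%:R.
  elim: j => [|j IH]; first by rewrite addn0 subrr normr0 mulr0.
  have -> : m k - m (k + j.+1)%N = (m k - m (k + j)%N) - (m (k + j).+1 - m (k + j)%N).
    by rewrite addnS; ring.
  apply: le_trans (ler_normB _ _) _; rewrite -natr1; have := step (k + j)%N; lra.
exists (m n); have cS : continuous (fun t => (f t - m n) ^+ 2).
  by apply: cts_exp; apply: ctsB => //; exact: cts_cst.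
apply: le_trans (poisson_dyadic r01 hn cS (fun t => sqr_ge0 _)) _.
have bound (k : 'I_n.+1) : 2 ^+ k * 2^-1 ^+ (n - k) *
   itg (- (pi * 2^-1 ^+ k)) (pi * 2^-1 ^+ k) (fun t => (f t - m n) ^+ 2) <=
   2 * pi * K ^+ 2 * (2^-1 ^+ (n - k) * (8 + 4 * (n - k)%:R ^+ 2)).
  rewrite -/(a k) itg_sqr_center//.
  have kn : (k <= n)%N by rewrite -ltnS.
  have jn := john_nirenberg cf K0 fK fU fb (lt k) (le2 k).
  have d2 : (m k - m n) ^+ 2 <= (2 * K * (n - k)%:R) ^+ 2.
    rewrite -[leLHS]real_normK ?num_real// lerXn2r ?nnegrE// ?mulr_ge0//; first by lra.
    by have := dist (n - k)%N k; rewrite subnKC.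
  have ak : a k - - a k = 2 * pi * 2^-1 ^+ k by rewrite /a; ring.
  have e2 : 2 ^+ k * (2^-1 : R) ^+ k = 1 by rewrite -exprMn divff ?pnatr_eq0// expr1n.
  apply: le_trans (_ : _ <= 2 ^+ k * 2^-1 ^+ (n - k) *
     ((8 * K ^+ 2 + (2 * K * (n - k)%:R) ^+ 2) * (2 * pi * 2^-1 ^+ k))) _.
    rewrite ler_wpM2l ?mulr_ge0 ?exprn_ge0// -ak [leRHS]mulrDl; apply: lerD => //.
    rewrite mulrC ler_wpM2r// ak; by rewrite mulr_ge0 ?(ltW (h2 _))//; lra.
  have -> : 2 ^+ k * 2^-1 ^+ (n - k) *
     ((8 * K ^+ 2 + (2 * K * (n - k)%:R) ^+ 2) * (2 * pi * 2^-1 ^+ k)) =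
     (2 ^+ k * (2^-1 : R) ^+ k) * (2 * pi * K ^+ 2 * (2^-1 ^+ (n - k) * (8 + 4 * (n - k)%:R ^+ 2))) by ring.
  by rewrite e2 mul1r.
have h16 : (0 : R) <= 16 by [].
have := ler_wpM2l h16 (ler_sum _ (fun (k : 'I_n.+1) (_ : true) => bound k)).
move=> /(_ (index_enum _)) /le_trans; apply.
rewrite -mulr_sumr (reindex_inj rev_ord_inj)/=.
under eq_bigr => k _ do rewrite subSS (subKn (leq_ord k)).
have := geo_sqr_sum n.+1; set X := \sum_(i < _) _ => X40.
have y0 : 0 <= pi * K ^+ 2 by rewrite mulr_ge0 ?exprn_ge0 ?ltW.
have := ler_wpM2l y0 X40; lra.
Qed.

Lemma unit_cis (z : C) : `|cq z| = 1 -> exists t, z = cis t.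
Proof.
case: z => a b h.
have ab : a ^+ 2 + b ^+ 2 = 1.
  by have := normq_sqr (cq (a +i* b)%C); rewrite h /= expr1n => ->; ring.
have a1 : -1 <= a <= 1 by apply/andP; split; nra.
have s : Num.sqrt (1 - a ^+ 2) = `|b| by rewrite -sqrtr_sqr -ab; congr Num.sqrt; ring.
have [b0|b0] := leP 0 b.
  by exists (acos a); rewrite /cis acosK// sin_acos// s ger0_norm.
by exists (- acos a); rewrite /cis cosN sinN acosK// sin_acos// s ltr0_norm// opprK.
Qed.

Lemma polar (z : C) : exists r t, r = `|cq z| /\ z = (r%:C)%C * cis t.
Proof.
exists `|cq z|; have [z0|z0] := eqVneq `|cq z| 0.
  by exists 0; split=> //; rewrite z0 rmorph0 mul0r; exact: norm_cq_eq0.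
have [|t ht] := @unit_cis (z * ((`|cq z|^-1)%:C)%C).
  by rewrite norm_cqM norm_cq_real ger0_norm ?invr_ge0// divff.
exists t; split=> //; rewrite -ht mulrCA -rmorphM divff// rmorph1 mulr1//.
Qed.

Local Notation iH := (Quat 0 1 0 0 : H).

Lemma imag_units_i : imag_units iH.
Proof. by apply: quatP => /=; ring. Qed.

Lemma cq_horner_cis (p : {poly C}) N (r t : R) : (size p <= N)%N ->
  cq (p.[(r%:C)%C * cis t]) = circ_sum iH (fun n => cq p`_n) N r t.
Proof.
move=> pN; rewrite (horner_coef_wide _ pN) rmorph_sum; apply: eq_bigr => n _.
rewrite mulrC exprMn cisX -rmorphXn !rmorphM/= cq_cis -mulrA.
by rewrite (_ : cq ((r ^+ n)%:C)%C = (r ^+ n)%:A) -?scalerAl ?mul1r//; apply: quatP => /=; ring.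
Qed.

Lemma norm_cisB s t : `|cq (cis s - cis t)| <= `|s - t|.
Proof.
rewrite -ler_sqr ?nnegrE// normq_sqr real_normK ?num_real//=.
have := onem_cos_le (s - t); rewrite cosB.
have := cos2Dsin2 s; have := cos2Dsin2 t; nra.
Qed.

Lemma poly_circle_lipschitz (p : {poly C}) : exists2 L : R, 0 <= L &
  forall s t, `|cq (p.[cis s] - p.[cis t])| <= L * `|s - t|.
Proof.
exists (\sum_(n < size p) `|cq p`_n| * n%:R); first by apply: sumr_ge0 => n _; rewrite mulr_ge0.
move=> s t; rewrite !horner_coef -sumrB mulr_suml; apply: le_trans (norm_cq_sum _ _) _.
apply: ler_sum => n _; rewrite -mulrBr norm_cqM -mulrA ler_wpM2l// !cisX.
by apply: le_trans (norm_cisB _ _) _; rewrite -mulrBr normrM ger0_norm.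
Qed.

(** Thus the numbers [(drop_poly j.+1 F).[z]] are the coefficients in w of the difference quotient
    of F at z, and the defect sum is its squared norm on the circle. *)
Lemma divided_difference (F : {poly C}) N (z w : C) : (size F <= N)%N ->
  (w - z) * \sum_(j < N) (drop_poly j.+1 F).[z] * w ^+ j = F.[w] - F.[z].
Proof.
move=> FN; have h M : (w - z) * \sum_(j < M) (drop_poly j.+1 F).[z] * w ^+ j =
    (drop_poly M F).[z] * w ^+ M - F.[z] + \sum_(j < M) F`_j * w ^+ j.
  elim: M => [|M IH]; first by rewrite !big_ord0 drop_poly0l; ring.
  rewrite !big_ord_recr/= mulrDr IH (drop_poly_step F M z) exprS; ring.
by rewrite h (drop_poly_eq0 FN) horner0 mul0r sub0r -horner_coef_wide// addrC.
Qed.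

Lemma cts_horner_cis (p : {poly C}) c : continuous (fun t => cq p.[cis (t + c)]).
Proof.
have -> : (fun t => cq p.[cis (t + c)]) =
    circ_sum iH (fun n => expI iH (n%:R * c) * cq p`_n) (size p) 1.
  apply/funext => t; have := cq_horner_cis 1 (t + c) (leqnn (size p)).
  by rewrite rmorph1 mul1r => ->; rewrite circ_sum_rot//; exact: imag_units_i.
exact: cts_circ_sum.
Qed.

(* The defect is the Poisson average of [|F - F(z)|^2], which the mean value
   property bounds by that of [|F|^2]. *)
Lemma defect_le_poisson (F : {poly C}) N r t : (size F <= N)%N -> 0 <= r < 1 ->
  2 * pi * ((1 - r ^+ 2) * \sum_(j < N) `|cq (drop_poly j.+1 F).[(r%:C)%C * cis t]| ^+ 2) <=
  itg (- pi) pi (fun s => poisson r s * `|cq F.[cis (s + t)]| ^+ 2).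
Proof.
move=> FN r01; have pi0 := @pi_gt0 R; have I2 := imag_units_i; have cP := cts_poisson r01.
have r0 : 0 <= r by case/andP: r01.
set z := (r%:C)%C * cis t; set g := fun j => cq (drop_poly j.+1 F).[z].
have zr : `|cq z| = r by rewrite norm_cqM norm_cis norm_cq_real mulr1 ger0_norm.
pose m := cq F.[z].
have cF := @cts_horner_cis F t.
have cG : continuous (fun s => circ_sum iH g N 1 (s + t)).
  have -> : (fun s => circ_sum iH g N 1 (s + t)) =
      circ_sum iH (fun n => expI iH (n%:R * t) * g n) N 1.
    by apply/funext => s; rewrite circ_sum_rot.
  exact: cts_circ_sum.
have key s : poisson r s * `|cq F.[cis (s + t)] - m| ^+ 2 =
    (1 - r ^+ 2) * `|circ_sum iH g N 1 (s + t)| ^+ 2.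
  rewrite /m -rmorphB -(divided_difference z (cis (s + t)) FN) norm_cqM exprMn.
  have -> : cq (\sum_(j < N) (drop_poly j.+1 F).[z] * cis (s + t) ^+ j) = circ_sum iH g N 1 (s + t).
    rewrite rmorph_sum; apply: eq_bigr => j _.
    by rewrite expr1n scale1r mulrC rmorphM/= cisX cq_cis.
  have -> : `|cq (cis (s + t) - z)| ^+ 2 = 1 - 2 * r * cos s + r ^+ 2.
    have -> : cis (s + t) - z = cis t * (cis s - (r%:C)%C) by rewrite cisD /z; ring.
    rewrite norm_cqM norm_cis mul1r normq_sqr /=.
    have := cos2Dsin2 s; move: (cos s) (sin s) => x y; nra.
  by rewrite /poisson mulrA divfK// gt_eqF// poisson_den_gt0.
have -> : 2 * pi * ((1 - r ^+ 2) * \sum_(j < N) `|cq (drop_poly j.+1 F).[z]| ^+ 2) =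
    itg (- pi) pi (fun s => poisson r s * `|cq F.[cis (s + t)] - m| ^+ 2).
  under eq_itg => s _ do rewrite key.
  rewrite itgZ; last by apply: cts_exp; exact: cts_normq.
  have h : - pi <= pi :> R by lra.
  rewrite -(@itg_shift _ t (fun s => `|circ_sum iH g N 1 s| ^+ 2)) //; last first.
    by apply: cts_exp; apply: cts_normq; exact: cts_circ_sum.
  have -> : pi + t = - pi + t + 2 * pi :> R by ring.
  rewrite parseval//; ring.
have e s : poisson r s * `|cq F.[cis (s + t)] - m| ^+ 2 =
    poisson r s * `|cq F.[cis (s + t)]| ^+ 2 +
    (-2 * (poisson r s * q1 (cq F.[cis (s + t)] * conjq m)) + poisson r s * `|m| ^+ 2).
  by rewrite normqD_sqr normrN /dotq/=; ring.
under eq_itg => s _ do rewrite e.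
have c1 : continuous (fun s => poisson r s * `|cq F.[cis (s + t)]| ^+ 2).
  by apply: ctsM => //; apply: cts_exp; exact: cts_normq.
have c2 : continuous (fun s => poisson r s * q1 (cq F.[cis (s + t)] * conjq m)).
  by apply: ctsM => //; apply: cts_comp_q1; exact: ctsHMr.
have c3 : continuous (fun s => poisson r s * `|m| ^+ 2).
  by apply: ctsM => //; exact: cts_cst.
rewrite itgD//; last by apply: ctsD => //; apply: ctsM => //; exact: cts_cst.
rewrite itgD//; last by apply: ctsM => //; exact: cts_cst.
rewrite itgZ//.
have -> : itg (- pi) pi (fun s => poisson r s * q1 (cq F.[cis (s + t)] * conjq m)) = 2 * pi * `|m| ^+ 2.
  transitivity (itg (- pi) pi (fun s => poisson r s *
     q1 (circ_sum iH (fun n => cq F`_n * conjq m) N 1 (s + t)))).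
    apply: eq_itg => s _; rewrite -circ_sumMr; have := cq_horner_cis 1 (s + t) FN.
    by rewrite rmorph1 mul1r => ->.
  rewrite -circ_sum_poisson// -circ_sumMr; have := cq_horner_cis r t FN => <-.
  by rewrite -/z -/m mul_conjq /= mulr1.
have -> : itg (- pi) pi (fun s => poisson r s * `|m| ^+ 2) = 2 * pi * `|m| ^+ 2.
  have := @poisson_cos R r 0 0 r01; rewrite expr0 cos0 !mulr1 => <-.
  rewrite mulrC -itgZ; last by apply: ctsM => //; exact/cts_cos/cts_affine.
  by apply: eq_itg => s _; rewrite mul0r addr0 cos0 mulr1 mulrC.
have := mulr_ge0 (ltW pi0) (exprn_ge0 2 (normr_ge0 m)); lra.
Qed.

(** The left-hand side depends on [F] only modulo constants, so [poisson_osc] may subtract its own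
    constant from the real and from the imaginary part. The two bounds 1280 pi K^2 add up to 2 pi *
    1280 K^2. *)
Lemma garsia_bound (F : {poly C}) N K (z : C) : (size F <= N)%N -> 0 < K ->
  osc_le K (fun t => complex.Re F.[cis t]) -> osc_le K (fun t => complex.Im F.[cis t]) ->
  `|cq z| <= 1 ->
  (1 - `|cq z| ^+ 2) * \sum_(j < N) `|cq (drop_poly j.+1 F).[z]| ^+ 2 <= 1280 * K ^+ 2.
Proof.
move=> FN K0 hRe hIm z1; have pi0 := @pi_gt0 R.
have K20 : 0 <= 1280 * K ^+ 2 by have := exprn_ge0 2 (ltW K0); lra.
case: N FN => [|N] FN; first by rewrite big_ord0 mulr0.
have [z1'|z1'] := eqVneq `|cq z| 1.
  by rewrite z1' expr1n subrr mul0r.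
have [r [t [-> ez]]] := polar z; set rr := `|cq z|.
have r01 : 0 <= rr < 1 by rewrite normr_ge0 lt_neqAle z1'.
have cP := cts_poisson r01.
have cQ c : continuous (fun s => cq F.[cis (s + c)]) by exact: cts_horner_cis.
have cRe c : continuous (fun s => complex.Re F.[cis (s + c)]) by exact: (@cts_comp_q1 R _ (fun s => cq F.[cis (s + c)]) (@cQ c)).
have cIm c : continuous (fun s => complex.Im F.[cis (s + c)]).
  have -> : (fun s => complex.Im F.[cis (s + c)]) =
      (fun s => q1 (cq F.[cis (s + c)] * Quat 0 (-1) 0 0)) by apply/funext => s; rewrite -qi_q1.
  by apply: (@cts_comp_q1 R _ (fun s => cq F.[cis (s + c)] * _)); apply: ctsHMr; exact: cQ.
have [b b0 hb] := poly_circle_bound F.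
have [L L0 hL] := poly_circle_lipschitz F.
have unif (k : C -> R) : (forall x y, `|k x - k y| <= `|cq (x - y)|) -> forall e : R, 0 < e ->
    exists2 d : R, 0 < d & forall u v, `|u - v| <= d -> `|k F.[cis (u + t)] - k F.[cis (v + t)]| <= e.
  move=> hk e e0; exists (e / (L + 1)); first by rewrite divr_gt0// ltr_wpDl.
  move=> u v uv; apply: le_trans (hk _ _) _; apply: le_trans (hL _ _) _.
  have -> : u + t - (v + t) = u - v by ring.
  apply: le_trans (ler_wpM2l L0 uv) _; rewrite mulrC -mulrA ler_piMr ?(ltW e0)//.
  by rewrite mulrC ler_pdivrMr ?mul1r ?lerDl// ltr_wpDl.
have shift (k : C -> R) : continuous (fun s => k F.[cis (s + 0)]) ->
    osc_le K (fun s => k F.[cis s]) -> osc_le K (fun s => k F.[cis (s + t)]).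
  move=> ck; apply: osc_le_shift.
  by have -> : (fun s => k F.[cis s]) = (fun s => k F.[cis (s + 0)]) by apply/funext => s; rewrite addr0.
have kRe (x y : C) : `|complex.Re x - complex.Re y| <= `|cq (x - y)|.
  rewrite -[leLHS]/(`|q1 (cq x) - q1 (cq y)|) -q1B -rmorphB; exact: norm_q1_le.
have kIm (x y : C) : `|complex.Im x - complex.Im y| <= `|cq (x - y)|.
  have [_ h _ _] := comp_le_normq (cq (x - y)); apply: le_trans h.
  by rewrite rmorphB.
have hb1 (k : C -> R) : (forall x y, `|k x - k y| <= `|cq (x - y)|) -> k 0 = 0 ->
    forall s, `|k F.[cis (s + t)]| <= b.
  move=> hk k0 s; rewrite -[k _]subr0 -k0; apply: le_trans (hk _ _) _.
  by rewrite subr0; apply: hb; exact: norm_cis.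
have [c1 h1] := poisson_osc (cRe t) K0 (shift _ (cRe 0) hRe) (unif _ kRe) (hb1 _ kRe erefl) r01.
have [c2 h2] := poisson_osc (cIm t) K0 (shift _ (cIm 0) hIm) (unif _ kIm) (hb1 _ kIm erefl) r01.
pose F1 := F - ((c1 +i* c2)%C)%:P.
have F1N : (size F1 <= N.+1)%N.
  apply: leq_trans (size_polyD _ _) _; rewrite geq_max FN size_polyN.
  by apply: leq_trans (size_polyC_leq1 _) _.
have F1j j : drop_poly j.+1 F1 = drop_poly j.+1 F.
  rewrite raddfB [X in _ - X]drop_poly_eq0 ?subr0//.
  by apply: leq_trans (size_polyC_leq1 _) _.
have := defect_le_poisson t F1N r01; rewrite -ez.
under eq_bigr => j _ do rewrite F1j.
have e s : poisson rr s * `|cq F1.[cis (s + t)]| ^+ 2 =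
    poisson rr s * (complex.Re F.[cis (s + t)] - c1) ^+ 2 +
    poisson rr s * (complex.Im F.[cis (s + t)] - c2) ^+ 2.
  by rewrite hornerD hornerN hornerC normq_sqr; case: (F.[_]) => x y /=; ring.
under eq_itg => s _ do rewrite e.
have cst0 c : continuous (fun _ : R => c) by exact: cts_cst.
rewrite itgD; last 2 first.
- by apply: ctsM => //; apply: cts_exp; exact: ctsB.
- by apply: ctsM => //; apply: cts_exp; exact: ctsB.
rewrite -/rr; set X := (1 - _) * _ => h.
have h3 : 2 * pi * X <= 2 * pi * (1280 * K ^+ 2) by lra.
by move: h3; rewrite ler_pM2l// mulr_gt0.
Qed.

End Garsia.

(** * Factorization and boundary values in H^1 *)

Section Factorization.
Variable R : realType.
Local Notation H := (quat R).
Local Notation C := R[i].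
Local Notation iH := (Quat 0 1 0 0 : H).
Implicit Types (r s : R) (u v : nat -> C) (h : {poly C}).

Definition circ_mean (f : R -> R) : R := (2 * pi)^-1 * itg (- pi) pi f.

Lemma circ_mean_le (f g : R -> R) : continuous f -> continuous g ->
  (forall t, f t <= g t) -> circ_mean f <= circ_mean g.
Proof.
move=> cf cg fg; have pi0 := @pi_gt0 R; rewrite /circ_mean ler_pM2l ?invr_gt0 ?mulr_gt0//.
by apply: le_itg.
Qed.

Lemma circ_mean_cst (c : R) : circ_mean (fun=> c) = c.
Proof.
have pi0 := @pi_gt0 R; rewrite /circ_mean itg_cst; last by lra.
rewrite (_ : pi - - pi = 2 * pi :> R); last by ring.
by rewrite mulrCA mulVf ?mulr1// mulf_neq0// gt_eqF.
Qed.

Lemma circ_meanD (f g : R -> R) : continuous f -> continuous g ->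
  circ_mean (fun t => f t + g t) = circ_mean f + circ_mean g.
Proof. by move=> cf cg; rewrite /circ_mean itgD// mulrDr. Qed.

Lemma cts_norm_poly h : continuous (fun t => `|cq h.[cis t]|).
Proof.
apply: cts_normq; have -> : (fun t => cq h.[cis t]) = (fun t => cq h.[cis (t + 0)]).
  by apply/funext => t; rewrite addr0.
exact: cts_horner_cis.
Qed.

Lemma circ_mean_sqr h : circ_mean (fun t => `|cq h.[cis t]| ^+ 2) = \sum_(n < size h) `|cq h`_n| ^+ 2.
Proof.
have pi0 := @pi_gt0 R; rewrite /circ_mean.
transitivity ((2 * pi)^-1 * itg (- pi) pi
    (fun t => `|circ_sum iH (fun n => cq h`_n) (size h) 1 t| ^+ 2)).
  congr (_ * _); apply: eq_itg => t _; rewrite -cq_horner_cis//.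
  by rewrite rmorph1 mul1r.
rewrite parseval_circ; last exact: imag_units_i.
by rewrite mulKf// mulf_neq0// gt_eqF.
Qed.

Lemma norm_coef_le h (e : R) n : 0 <= e -> (forall t, `|cq h.[cis t]| <= e) -> `|cq h`_n| <= e.
Proof.
move=> e0 he; have [nh|nh] := ltnP n (size h); last by rewrite nth_default// rmorph0 normr0.
rewrite -ler_sqr ?nnegrE//; apply: le_trans (_ : _ <= \sum_(n < size h) `|cq h`_n| ^+ 2) _.
  by rewrite (bigD1 (Ordinal nh))//= lerDl sumr_ge0// => i _; rewrite exprn_ge0.
rewrite -circ_mean_sqr -[leRHS]circ_mean_cst; apply: circ_mean_le.
- by apply: cts_exp; exact: cts_norm_poly.
- exact: cts_cst.
- by move=> t; rewrite lerXn2r ?nnegrE.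
Qed.

Lemma poly_l2_factor h (e : R) : 0 < e -> exists u v : {poly C},
  [/\ \sum_(n < size u) `|cq u`_n| ^+ 2 <= circ_mean (fun t => `|cq h.[cis t]|) + e,
      \sum_(n < size v) `|cq v`_n| ^+ 2 <= circ_mean (fun t => `|cq h.[cis t]|) + e &
      forall n, `|cq ((u * v)`_n - h`_n)| <= e].
Proof.
move=> e0; have [u [v huv]] := poly_circle_factor h e0; exists u, v.
have bound (p : {poly C}) : (forall t, `| `|cq p.[cis t]| ^+ 2 - `|cq h.[cis t]| | <= e) ->
    \sum_(n < size p) `|cq p`_n| ^+ 2 <= circ_mean (fun t => `|cq h.[cis t]|) + e.
  move=> hp; rewrite -circ_mean_sqr -[X in _ + X]circ_mean_cst -circ_meanD; last 2 first.
  - exact: cts_norm_poly.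
  - exact: cts_cst.
  apply: circ_mean_le => [||t].
  - by apply: cts_exp; exact: cts_norm_poly.
  - by apply: ctsD; [exact: cts_norm_poly|exact: cts_cst].
  - by have := le_trans (ler_norm _) (hp t); rewrite lerBlDl.
split.
- by apply: bound => t; have [] := huv (cis t) (norm_cis t).
- by apply: bound => t; have [] := huv (cis t) (norm_cis t).
- move=> n; rewrite -coefB; apply: norm_coef_le; first exact: ltW.
  by move=> t; have [h1 _ _] := huv (cis t) (norm_cis t); rewrite hornerD hornerN hornerM.
Qed.

Lemma cvg_mulH (T : Type) (F : set_system T) {FF : Filter F} (f g : T -> H) (p q : H) :
  f @ F --> p -> g @ F --> q -> (fun x => f x * g x) @ F --> p * q.
Proof.
move=> /cvgrPdist_le hf /cvgrPdist_le hg; apply/cvgrPdist_le => e e0.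
pose k := 1 + `|p| + `|q|; have k1 : 1 <= k by rewrite /k -addrA lerDl addr_ge0.
have k0 : 0 < k by exact: lt_le_trans ltr01 k1.
pose d := Num.min 1 (e / k).
have d0 : 0 < d by rewrite lt_min ltr01 divr_gt0.
have d1 : d <= 1 by rewrite ge_min lexx.
have dk : d * k <= e by rewrite -ler_pdivlMr// ge_min lexx orbT.
apply: filterS2 (hf d d0) (hg d d0) => z; move: (f z) (g z) => x y hp hq.
have -> : p * q - x * y = p * (q - y) + (p - x) * q - (p - x) * (q - y).
  by apply: quatP => /=; ring.
apply: le_trans dk; apply: le_trans (ler_normB _ _) _; rewrite normqM.
have := ler_normD (p * (q - y)) ((p - x) * q); rewrite !normqM.
have h1 : `|p - x| * `|q - y| <= d * 1 by apply: ler_pM => //; exact: le_trans d1.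
have h2 : `|p - x| * `|q| <= d * `|q| by apply: ler_wpM2r.
have h3 : `|p| * `|q - y| <= `|p| * d by apply: ler_wpM2l.
by rewrite /k; lra.
Qed.

Section Ultra.
Variables (G : set_system nat) (GU : UltraFilter G).

Lemma ultra_real (y : nat -> R) (B : R) : (forall k, `|y k| <= B) -> exists l : R, y @ G --> l.
Proof.
move=> yB; have [|l [_ hl]] := @segment_compact R (- B) B (y @ G) _.
  change (G (y @^-1` `[- B, B]%classic)); apply: filterE => k /=.
  by rewrite in_itv/= -ler_norml; exact: yB.
exists l => A lA; have [//|nA] := in_ultra_setVsetC (y @^-1` A) GU.
by have [z [zA Az]] := hl (~` A) A nA lA.
Qed.

Lemma ultra_complex (y : nat -> C) (B : R) : (forall k, `|cq (y k)| <= B) ->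
  exists l : C, (fun k => cq (y k)) @ G --> cq l.
Proof.
move=> yB; have [h1 h2] : (forall k, `|complex.Re (y k)| <= B) /\ (forall k, `|complex.Im (y k)| <= B).
  by split=> k; have [a b _ _] := comp_le_normq (cq (y k)); [apply: le_trans a _|apply: le_trans b _].
have [l1 hl1] := ultra_real h1; have [l2 hl2] := ultra_real h2.
by exists (l1 +i* l2)%C; apply: quat_cvg => //=; exact: cvg_cst.
Qed.

End Ultra.

Definition cauchy_prod u v n : C := \sum_(i < n.+1) u i * v (n - i)%N.

(** The approximating polynomials are factored and their factors converge, coefficient by
    coefficient, along an ultrafilter refining [\oo]. Finite sums of squares pass to the limit, so
    no mass beyond [M] appears, and each product coefficient is a finite sum. *)
Lemma l2_factor (x : nat -> C) (M : R) (p : nat -> {poly C}) :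
  (forall n, (fun k => cq (p k)`_n) @ \oo --> cq (x n)) ->
  (forall k, circ_mean (fun t => `|cq (p k).[cis t]|) <= M + harmonic k) ->
  exists u v, [/\ forall N, \sum_(n < N) `|cq (u n)| ^+ 2 <= M,
    forall N, \sum_(n < N) `|cq (v n)| ^+ 2 <= M & forall n, x n = cauchy_prod u v n].
Proof.
move=> px pM.
have /choice[uv huv] : forall k, exists uv : {poly C} * {poly C},
    [/\ \sum_(n < size uv.1) `|cq uv.1`_n| ^+ 2 <= M + 2 * harmonic k,
        \sum_(n < size uv.2) `|cq uv.2`_n| ^+ 2 <= M + 2 * harmonic k &
      forall n, `|cq ((uv.1 * uv.2)`_n - (p k)`_n)| <= harmonic k].
  move=> k; have [u [v [h1 h2 h3]]] := poly_l2_factor (p k) (harmonic_gt0 k).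
  exists (u, v); move: (pM k) h1 h2 h3; move: (harmonic k) => d ? ? ? ?.
  by split=> //=; lra.
have [G [GU hG]] := @ultraFilterLemma nat \oo _.
have GP : ProperFilter G by apply: ultra_proper.
have part (w : {poly C}) (k N : nat) : \sum_(n < size w) `|cq w`_n| ^+ 2 <= M + 2 * harmonic k ->
    \sum_(n < N) `|cq w`_n| ^+ 2 <= M + 2 * harmonic k.
  apply: le_trans; have [Nw|wN] := leqP N (size w).
    rewrite (big_ord_widen _ (fun n => `|cq w`_n| ^+ 2) Nw) big_mkcond/=.
    by apply: ler_sum => i _; case: ifP => // _; rewrite exprn_ge0.
  rewrite (big_ord_widen _ (fun n => `|cq w`_n| ^+ 2) (ltnW wN)) [leRHS]big_mkcond/=.
  apply: ler_sum => i _; case: ltnP => // h.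
  by rewrite nth_default// rmorph0 normr0 expr0n.
have h1k k : (harmonic k : R) <= 1 by rewrite /harmonic invf_le1 ?ler1n.
have bound (w : nat -> {poly C}) n : (forall k N, \sum_(n < N) `|cq (w k)`_n| ^+ 2 <= M + 2 * harmonic k) ->
    forall k, `|cq (w k)`_n| <= M + 3.
  move=> hw k; have := hw k n.+1; rewrite big_ord_recr [X in X <= _]/=.
  have : 0 <= \sum_(i < n) `|cq (w k)`_i| ^+ 2 by rewrite sumr_ge0// => i _; rewrite exprn_ge0.
  have := normr_ge0 (cq (w k)`_n); have := h1k k.
  by move: (harmonic k) (\sum_(i < n) _) `|_| => d S y *; nra.
have hu k N : \sum_(n < N) `|cq (uv k).1`_n| ^+ 2 <= M + 2 * harmonic k.
  by apply: part; have [] := huv k.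
have hv k N : \sum_(n < N) `|cq (uv k).2`_n| ^+ 2 <= M + 2 * harmonic k.
  by apply: part; have [] := huv k.
have [u cu] := choice (fun n => ultra_complex GU (bound (fun k => (uv k).1) n hu)).
have [v cv] := choice (fun n => ultra_complex GU (bound (fun k => (uv k).2) n hv)).
have hGc : (fun k => M + 2 * harmonic k) @ G --> M.
  apply: cvg_trans (_ : (fun k => M + 2 * harmonic k) @ \oo --> M).
    by move=> A /= hA; apply: hG.
  rewrite -[X in _ --> X]addr0 -[X in _ + X](mulr0 2).
  by apply: cvgD; [exact: cvg_cst|apply: cvgM; [exact: cvg_cst|exact: cvg_harmonic]].
have lim2 (w : nat -> {poly C}) (l : nat -> C) N :
    (forall k N, \sum_(n < N) `|cq (w k)`_n| ^+ 2 <= M + 2 * harmonic k) ->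
    (forall n, (fun k => cq (w k)`_n) @ G --> cq (l n)) -> \sum_(n < N) `|cq (l n)| ^+ 2 <= M.
  move=> hw cw.
  have cS : (fun k => \sum_(n < N) `|cq (w k)`_n| ^+ 2) @ G --> \sum_(n < N) `|cq (l n)| ^+ 2.
    apply: cvg_big => [|n _]; first exact: add_continuous.
    by apply: cvg_sqr; apply: cvg_norm; exact: cw.
  by apply: (ler_cvg_to cS hGc); apply: filterE => k; exact: hw.
exists u, v; split=> [N|N|n].
- exact: (lim2 _ _ _ hu cu).
- exact: (lim2 _ _ _ hv cv).
apply: cq_inj.
have c1 : (fun k => cq (p k)`_n) @ G --> cq (x n) by move=> A hA; apply: hG; exact: px hA.
have c2 : (fun k => cq ((uv k).1 * (uv k).2)`_n) @ G --> cq (cauchy_prod u v n).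
  rewrite /cauchy_prod rmorph_sum /=.
  under eq_fun do rewrite coefM rmorph_sum /=.
  apply: cvg_big => [|i _]; first exact: add_continuous.
  under eq_fun do rewrite rmorphM; rewrite rmorphM.
  by apply: cvg_mulH; [exact: cu|exact: cv].
have c3 : (fun k => cq ((uv k).1 * (uv k).2)`_n - cq (p k)`_n) @ G --> (0 : H).
  apply: cvg_trans (_ : (fun k => cq ((uv k).1 * (uv k).2)`_n - cq (p k)`_n) @ \oo --> (0 : H)).
    by move=> A hA; apply: hG.
  apply/cvgrPdist_le => e e0; have /cvgrPdist_le/(_ e e0) := @cvg_harmonic R.
  apply: filterS => k; rewrite !sub0r !normrN ger0_norm ?harmonic_ge0// => hk.
  by have [_ _ h] := huv k; rewrite -rmorphB; apply: le_trans (h n) hk.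
have c4 := cvgB c2 c3.
have e : (fun k => cq ((uv k).1 * (uv k).2)`_n) - (fun k => cq ((uv k).1 * (uv k).2)`_n - cq (p k)`_n)
    = (fun k => cq (p k)`_n) by apply/funext => k /=; rewrite fctE subKr.
rewrite e subr0 in c4.
exact: (cvg_unique (@norm_hausdorff R H) c1 (c4 _)).
Qed.

End Factorization.

(** * Products and mean-square convergence of square-summable series *)

Section BoundaryConvergence.
Variable R : realType.
Local Notation H := (quat R).
Local Notation C := R[i].
Local Notation iH := (Quat 0 1 0 0 : H).
Implicit Types (f g : H -> H) (a : nat -> H) (x u v : nat -> C) (I : H) (r s t : R).

Lemma cauchy_prod_bound u v (M : R) n : (forall N, \sum_(n < N) `|cq (u n)| ^+ 2 <= M) ->
  (forall N, \sum_(n < N) `|cq (v n)| ^+ 2 <= M) -> `|cq (cauchy_prod u v n)| <= M.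
Proof.
move=> hu hv; apply: le_trans (norm_cq_sum _ _) _.
apply: le_trans (_ : _ <= \sum_(i < n.+1) (`|cq (u i)| ^+ 2 + `|cq (v (n - i)%N)| ^+ 2) / 2) _.
  apply: ler_sum => i _; rewrite norm_cqM ler_pdivlMr//.
  by have := sqr_ge0 (`|cq (u i)| - `|cq (v (n - i)%N)|); rewrite sqrrB; lra.
rewrite -mulr_suml big_split/=.
have -> : \sum_(i < n.+1) `|cq (v (n - i)%N)| ^+ 2 = \sum_(i < n.+1) `|cq (v i)| ^+ 2.
  by rewrite (reindex_inj rev_ord_inj)/=; apply: eq_bigr => i _; rewrite subSS subKn// leq_ord.
rewrite ler_pdivrMr//; have := hu n.+1; have := hv n.+1; lra.
Qed.

(** The product of the N-th truncations has the right coefficients below N and coefficients bounded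
    by [M] from N to 2N, so it differs from the truncation of F by a geometric tail. Complex
    coefficients commute with points of the slice of [i], which makes the pointwise product the
    series of the Cauchy product. *)
Lemma slice_product (U V F : H -> H) x u v (M r t : R) :
  (forall N, \sum_(n < N) `|cq (u n)| ^+ 2 <= M) ->
  (forall N, \sum_(n < N) `|cq (v n)| ^+ 2 <= M) -> (forall n, x n = cauchy_prod u v n) ->
  has_expansion U (@cq R \o u) -> has_expansion V (@cq R \o v) -> has_expansion F (@cq R \o x) ->
  0 <= r < 1 -> F (r *: expI iH t) = U (r *: expI iH t) * V (r *: expI iH t).
Proof.
move=> hu hv xE hU hV hF r01; have I2 := @imag_units_i R; have /andP[r0 r1] := r01.
have cU := circ_sum_cvg (t := t) I2 hU r01; have cV := circ_sum_cvg (t := t) I2 hV r01.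
have cF := circ_sum_cvg (t := t) I2 hF r01.
have M0 : 0 <= M by have := hu 0%N; rewrite big_ord0.
set z := (r%:C)%C * cis t.
have zr : `|cq z| = r by rewrite norm_cqM norm_cis norm_cq_real mulr1 ger0_norm.
pose tr N (w : nat -> C) : {poly C} := \poly_(n < N) w n.
have trE N w : circ_sum iH (@cq R \o w) N r t = cq (tr N w).[z].
  rewrite (cq_horner_cis _ _ (size_poly N w)); apply: eq_bigr => n _.
  by rewrite coef_poly ltn_ord.
have trM (N : nat) (w : nat -> C) : (forall N, \sum_(n < N) `|cq (w n)| ^+ 2 <= M) ->
    forall K, \sum_(n < K) `|cq (tr N w)`_n| ^+ 2 <= M.
  move=> hw K; apply: le_trans (hw K); apply: ler_sum => n _; rewrite coef_poly.
  by case: ifP => // _; rewrite rmorph0 normr0 expr0n exprn_ge0.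
have bound N : `|cq ((tr N u).[z] * (tr N v).[z] - (tr N x).[z])| <= M * (r ^+ N / (1 - r)).
  rewrite -hornerM.
  have s1 : (size (tr N u * tr N v)%R <= N + N)%N.
    by apply: leq_trans (size_polyMleq _ _) _; rewrite (leq_trans (leq_pred _))// leq_add ?size_poly.
  have s2 : (size (tr N x) <= N + N)%N by rewrite (leq_trans (size_poly _ _))// leq_addr.
  rewrite (horner_coef_wide _ s1) (horner_coef_wide _ s2) -sumrB.
  apply: le_trans (norm_cq_sum _ _) _.
  apply: le_trans (ler_wpM2l M0 (geo_tail N (N + N) r01)); rewrite mulr_sumr.
  apply: ler_sum => n _; rewrite -mulrBl norm_cqM norm_cqX zr coefM coef_poly.
  case: ltnP => nN.
    rewrite mulr0; rewrite (_ : _ - _ = 0) ?rmorph0 ?normr0 ?mul0r//.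
    apply/eqP; rewrite subr_eq0 xE; apply/eqP; apply: eq_bigr => i _.
    rewrite !coef_poly (leq_ltn_trans (leq_ord i) nN).
    by rewrite (leq_ltn_trans (leq_subr _ _) nN).
  rewrite subr0 ler_wpM2r ?exprn_ge0//.
  exact: (cauchy_prod_bound _ (trM N u hu) (trM N v hv)).
have c0 : (fun N => cq ((tr N u).[z] * (tr N v).[z] - (tr N x).[z])) @ \oo --> (0 : H).
  apply/cvgrPdist_le => e e0.
  have r1' : 0 < 1 - r by rewrite subr_gt0.
  have d0 : 0 < e * (1 - r) / (M + 1) by rewrite divr_gt0 ?mulr_gt0// ltr_wpDl.
  have h : `|r| < 1 by rewrite ger0_norm.
  have /cvgrPdist_le/(_ _ d0) := cvg_expr h.
  apply: filterS => N; rewrite !sub0r !normrN ger0_norm ?exprn_ge0// => hN.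
  apply: le_trans (bound N) _; rewrite mulrA ler_pdivrMr//.
  move: hN; rewrite ler_pdivlMr; last by rewrite ltr_wpDl.
  by apply: le_trans; rewrite mulrC ler_wpM2l ?exprn_ge0// lerDl.
have cUV : (fun N => circ_sum iH (@cq R \o u) N r t * circ_sum iH (@cq R \o v) N r t) @ \oo -->
   U (r *: expI iH t) * V (r *: expI iH t) by exact: cvg_mulH.
have cF' : (fun N => circ_sum iH (@cq R \o x) N r t) @ \oo --> U (r *: expI iH t) * V (r *: expI iH t).
  rewrite -[X in _ --> X]subr0 (_ : (fun N => circ_sum iH (@cq R \o x) N r t) =
    (fun N => circ_sum iH (@cq R \o u) N r t * circ_sum iH (@cq R \o v) N r t) -
    (fun N => cq ((tr N u).[z] * (tr N v).[z] - (tr N x).[z]))); first exact: cvgB.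
  apply/funext => N; transitivity (circ_sum iH (@cq R \o u) N r t * circ_sum iH (@cq R \o v) N r t -
    cq ((tr N u).[z] * (tr N v).[z] - (tr N x).[z])); last by [].
  by rewrite !trE rmorphB rmorphM/= subKr.
exact: (cvg_unique (@norm_hausdorff R H) cF cF').
Qed.

Lemma powB_le (p q : R) n : 0 <= p <= 1 -> 0 <= q <= 1 -> `|p ^+ n - q ^+ n| <= n%:R * `|p - q|.
Proof.
move=> /andP[p0 p1] /andP[q0 q1]; elim: n => [|n IH]; first by rewrite !expr0 subrr normr0 mul0r.
have -> : p ^+ n.+1 - q ^+ n.+1 = p * (p ^+ n - q ^+ n) + (p - q) * q ^+ n.
  by rewrite !exprS; ring.
apply: le_trans (ler_normD _ _) _; rewrite !normrM -natr1 mulrDl mul1r; apply: lerD.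
  by apply: le_trans IH; rewrite ler_piMl// ger0_norm.
by rewrite ler_piMr// ger0_norm ?exprn_ge0// exprn_ile1.
Qed.

(** The difference of two dilates has coefficients (s^n - s'^n) a_n. The tail is small by square
    summability, the head because |s^n - s'^n| <= n |s - s'|. *)
Lemma l2_radial_cauchy I f a (M e : R) : imag_units I -> has_expansion f a ->
  (forall N, \sum_(n < N) `|a n| ^+ 2 <= M) -> 0 < e ->
  exists2 d, 0 < d & forall s s' c, 1 - d < s < 1 -> 1 - d < s' < 1 -> 0 <= s -> 0 <= s' ->
   itg c (c + 2 * pi) (fun t => `|f (s *: expI I t) - f (s' *: expI I t)| ^+ 2) <= e.
Proof.
move=> I2 fa aM e0; have pi0 := @pi_gt0 R.
have M0 : 0 <= M by have := aM 0%N; rewrite big_ord0.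
(* The final integrand 2 |D|^2 + 2 q, where |D|^2 has mean at most 2 q, integrates to at most 8 pi q
   + 4 pi q. *)
pose q := e / (12 * pi); have q0 : 0 < q by rewrite divr_gt0// mulr_gt0.
have a20 n : 0 <= `|a n| ^+ 2 by rewrite exprn_ge0.
have [m hm] := bounded_sum_tail a20 aM q0.
pose k := m%:R ^+ 2 * M + 1; have k0 : 0 < k by rewrite ltr_wpDl// mulr_ge0// exprn_ge0.
pose d := Num.min 1 (q / k).
have d0 : 0 < d by rewrite lt_min ltr01 divr_gt0.
have d1 : d <= 1 by rewrite ge_min lexx.
have dk : d * k <= q by rewrite -ler_pdivlMr// ge_min lexx orbT.
exists d => // s s' c /andP[sd s1] /andP[sd' s1'] s0 s0'.
have s01 : 0 <= s < 1 by rewrite s0. have s01' : 0 <= s' < 1 by rewrite s0'.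
pose q' := Num.min 1 q; have q'0 : 0 < q' by rewrite lt_min ltr01.
pose b n := (s ^+ n - s' ^+ n) *: a n.
have bM N : (m <= N)%N -> \sum_(n < N) `|b n| ^+ 2 <= 2 * q.
  move=> mN; have hb n : `|b n| ^+ 2 <= `|s ^+ n - s' ^+ n| ^+ 2 * `|a n| ^+ 2.
    by rewrite normrZ exprMn.
  have h1 : \sum_(n < N) `|b n| ^+ 2 - \sum_(n < m) `|b n| ^+ 2 <= q.
    apply: le_trans (hm N mN); rewrite -(sum_tail (fun n => `|b n| ^+ 2) mN).
    rewrite -(sum_tail (fun n => `|a n| ^+ 2) mN); apply: ler_sum => n _; case: ifP => // _.
    apply: le_trans (hb n) _; rewrite ler_piMl// expr_le1// ler_norml.
    have := exprn_ge0 n s0; have := exprn_ge0 n s0'.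
    have := exprn_ile1 n s0 (ltW s1); have := exprn_ile1 n s0' (ltW s1').
    by move: (s ^+ n) (s' ^+ n) => y y' *; apply/andP; split; lra.
  have h2 : \sum_(n < m) `|b n| ^+ 2 <= q.
    apply: le_trans (_ : _ <= (m%:R * d) ^+ 2 * M) _.
      apply: le_trans (ler_wpM2l (sqr_ge0 _) (aM m)); rewrite mulr_sumr.
      apply: ler_sum => n _; apply: le_trans (hb n) _; rewrite ler_wpM2r// lerXn2r ?nnegrE//.
        by rewrite mulr_ge0// ltW.
      apply: le_trans (powB_le n _ _) _; rewrite ?s0 ?s0' ?(ltW s1) ?(ltW s1')//.
      apply: ler_pM => //; first by rewrite ler_nat ltnW.
      by rewrite ler_norml; apply/andP; split; lra.
    apply: le_trans dk; rewrite /k exprMn; have : 0 <= m%:R ^+ 2 * M by rewrite mulr_ge0// exprn_ge0.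
    have dd : d ^+ 2 <= d by rewrite expr2 ler_piMl// ltW.
    move=> h; have := ler_wpM2r h dd; lra.
  lra.
have rho : 0 < Num.max (1 / 2) (Num.max s s') < 1.
  by rewrite !lt_max !gt_max; apply/andP; split; [apply/orP; left; lra|rewrite s1 s1' !andbT; lra].
have [N0 hN0] := circ_sum_uniform I2 fa rho (divr_gt0 q'0 (ltr0Sn _ 1)).
pose N := maxn N0 m.
have close t : `|f (s *: expI I t) - f (s' *: expI I t) - circ_sum I b N 1 t| <= q'.
  have h1 := hN0 N (leq_maxl _ _) s t; have h2 := hN0 N (leq_maxl _ _) s' t.
  have -> : circ_sum I b N 1 t = circ_sum I a N s t - circ_sum I a N s' t.
    rewrite /circ_sum -sumrB; apply: eq_bigr => n _.
    by rewrite expr1n scale1r -scalerAr scalerBl.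
  have -> : f (s *: expI I t) - f (s' *: expI I t) - (circ_sum I a N s t - circ_sum I a N s' t) =
     (f (s *: expI I t) - circ_sum I a N s t) - (f (s' *: expI I t) - circ_sum I a N s' t).
    by apply: quatP => /=; ring.
  apply: le_trans (ler_normB _ _) _; rewrite [leRHS]splitr; apply: lerD.
    by apply: h1; rewrite s0 !le_max lexx orbT.
  by apply: h2; rewrite s0' !le_max lexx !orbT.
have cc : c <= c + 2 * pi by rewrite lerDl mulr_ge0// ltW.
have cD : continuous (fun t => `|circ_sum I b N 1 t| ^+ 2).
  by apply: cts_exp; apply: cts_normq; exact: cts_circ_sum.
apply: le_trans (_ : _ <= itg c (c + 2 * pi) (fun t => 2 * `|circ_sum I b N 1 t| ^+ 2 + 2 * q)) _.
  apply: le_itg.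
  - by apply: cts_exp; apply: cts_normq; apply: ctsHB; exact: cts_slice I2 fa _.
  - by apply: ctsD; [apply: ctsM => //; exact: cts_cst|exact: cts_cst].
  - move=> t _; have := close t; set X := _ - f _; set D := circ_sum _ _ _ _ _ => h.
    have h3 : `|X| <= `|D| + `|X - D| by have := ler_normD D (X - D); rewrite addrC subrK.
    have h4 : `|X - D| ^+ 2 <= q.
      apply: le_trans (_ : _ <= q' ^+ 2) _; first by rewrite lerXn2r ?nnegrE// ltW.
      have q'1 : q' <= 1 by rewrite ge_min lexx.
      have q'q : q' <= q by rewrite ge_min lexx orbT.
      by apply: le_trans q'q; rewrite expr2 ler_piMl// ltW.
    have := sqr_ge0 (`|D| - `|X - D|); have := normr_ge0 X; have := normr_ge0 D; have := normr_ge0 (X - D).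
    move: h3 h4; move: `|X| `|D| `|X - D| => x1 y1 z1 h3 h4 *; nra.
rewrite itgD; [|by apply: ctsM => //; exact: cts_cst|exact: cts_cst].
rewrite [X in X + _]itgZ// parseval// itg_cst//; have := bM N (leq_maxr _ _).
have qe : 12 * pi * q = e by rewrite /q mulrC divfK// mulf_neq0// gt_eqF.
move: (\sum_(n < N) _) => S hS; have := ler_wpM2l (ltW pi0) hS; lra.
Qed.

End BoundaryConvergence.

(** * Mean convergence of dilates to the boundary values in H^1 *)

Section RadialLimitsInMean.
Variable R : realType.
Local Notation H := (quat R).
Local Notation C := R[i].
Local Notation iH := (Quat 0 1 0 0 : H).
Local Notation jH := (Quat 0 0 1 0 : H).
Local Notation mu := (@lebesgue_measure R).
Implicit Types (f g : H -> H) (a : nat -> H) (u v : nat -> C) (I : H) (r s t : R).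

(** The first coordinate in q = z + w j; the second one is [cpart (q * - jH)]. *)
Definition cpart (q : H) : C := (q1 q +i* qi q)%C.

Fact cpart_zmod : zmod_morphism cpart.
Proof. by move=> p q; apply/eqP; rewrite eq_complex/= !eqxx. Qed.
HB.instance Definition _ := GRing.isZmodMorphism.Build H C cpart cpart_zmod.

Lemma norm_cpart q : `|cq (cpart q)| <= `|q|.
Proof.
rewrite -ler_sqr ?nnegrE// !normq_sqr /=.
by have := sqr_ge0 (qj q); have := sqr_ge0 (qk q); lra.
Qed.

Lemma cpart_split q : q = cq (cpart q) + cq (cpart (q * - jH)) * jH.
Proof. by apply: quatP => /=; ring. Qed.

Lemma circ_sum_cpart a N r t :
  circ_sum iH (fun n => cq (cpart (a n))) N r t = cq (cpart (circ_sum iH a N r t)).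
Proof.
rewrite /circ_sum !raddf_sum; apply: eq_bigr => n _ /=.
by apply: quatP => /=; rewrite -?cq_cis; ring.
Qed.

(** Dilates at radii tending to 1, truncated within [harmonic k], have complex parts that are
    polynomials of mean modulus at most M + harmonic k, and their coefficients tend to those of the
    component. *)
Lemma component_factor f a (M : R) : has_expansion f a ->
  (forall r, 0 < r < 1 -> circ_mean (fun t => `|f (r *: expI iH t)|) <= M) ->
  exists u v, [/\ forall N, \sum_(n < N) `|cq (u n)| ^+ 2 <= M,
    forall N, \sum_(n < N) `|cq (v n)| ^+ 2 <= M & forall n, cpart (a n) = cauchy_prod u v n].
Proof.
move=> fa fM; have I2 := @imag_units_i R.
have /choice[N hN] : forall k, exists N, (k <= N)%N /\ forall t,
    `|f (@rseq R k *: expI iH t) - circ_sum iH a N (@rseq R k) t| <= harmonic k.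
  move=> k; have [N0 h] := circ_sum_uniform I2 fa (@rseq01 R k) (harmonic_gt0 k).
  exists (maxn k N0); split; first exact: leq_maxl.
  by move=> t; apply: h; rewrite ?leq_maxr// lexx andbT ltW//; case/andP: (@rseq01 R k).
pose p k : {poly C} := \poly_(n < N k) (((@rseq R k ^+ n)%:C)%C * cpart (a n)).
have pE k t : cq (p k).[cis t] = cq (cpart (circ_sum iH a (N k) (@rseq R k) t)).
  rewrite -circ_sum_cpart circ_sum_radius.
  have := cq_horner_cis 1 t (size_poly (N k) (fun n => ((@rseq R k ^+ n)%:C)%C * cpart (a n))).
  rewrite rmorph1 mul1r -/(p k) => ->; apply: eq_bigr => n _.
  rewrite coef_poly ltn_ord; congr (_ *: (_ * _)); rewrite rmorphM/=.
  by apply: quatP => /=; ring.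
apply: (l2_factor (p := p)) => [n|k].
  apply: cvg_trans (_ : (fun k => @rseq R k ^+ n *: cq (cpart (a n))) @ \oo --> cq (cpart (a n))).
    apply: near_eq_cvg; exists n.+1 => // k /= nk; rewrite coef_poly.
    rewrite (leq_trans nk (hN k).1) rmorphM; apply: quatP => /=; ring.
  rewrite -[X in _ --> X]scale1r; apply: cvgZr_tmp.
  elim: n => [|n IH]; first by under eq_fun do rewrite expr0; exact: cvg_cst.
  have h : (fun k => @rseq R k * @rseq R k ^+ n) @ \oo --> (1 * 1 : R).
    by apply: cvgM => //; exact: rseq_cvg1.
  by rewrite mulr1 in h; under eq_fun do rewrite exprS.
apply: le_trans (_ : _ <= circ_mean (fun t => `|f (@rseq R k *: expI iH t)| + harmonic k)) _.
  apply: circ_mean_le => [||t].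
  - exact: cts_norm_poly.
  - apply: ctsD; last exact: cts_cst.
    by apply: cts_normq; apply: cts_slice I2 fa _; case/andP: (@rseq01 R k) => h1 h2; rewrite ltW.
  - rewrite pE; apply: le_trans (norm_cpart _) _; rewrite -lerBlDl.
    apply: le_trans (lerB_dist _ _) _; rewrite distrC; exact: (hN k).2.
rewrite circ_meanD; last 2 first.
- by apply: cts_normq; apply: cts_slice I2 fa _; case/andP: (@rseq01 R k) => h1 h2; rewrite ltW.
- exact: cts_cst.
by rewrite circ_mean_cst lerD2r; exact: fM (@rseq01 R k).
Qed.

(* The complex components of [f] on the slice: the product of two functions
   with square summable coefficients has radial limits in the mean. *)
Lemma component_radial f a (M : R) : has_expansion f a ->
  (forall r, 0 < r < 1 -> circ_mean (fun t => `|f (r *: expI iH t)|) <= M) ->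
  exists F : H -> H, [/\ has_expansion F (fun n => cq (cpart (a n))),
    {ae mu, forall t, exists l : H, F (r *: expI iH t) @[r --> 1^'-] --> l} &
    forall e, 0 < e -> exists2 d, 0 < d & forall s s' c, 1 - d < s < 1 -> 1 - d < s' < 1 ->
      0 <= s -> 0 <= s' ->
      itg c (c + 2 * pi) (fun t => `|F (s *: expI iH t) - F (s' *: expI iH t)|) <= e].
Proof.
move=> fa fM; have I2 := @imag_units_i R; have pi0 := @pi_gt0 R.
have [u [v [hu hv auv]]] := component_factor fa fM.
have M0 : 0 <= M by have := hu 0%N; rewrite big_ord0.
have l2b (w : nat -> C) : (forall N, \sum_(n < N) `|cq (w n)| ^+ 2 <= M) ->
    exists W : H -> H, has_expansion W (@cq R \o w).
  move=> hw; apply: (@power_series_exists _ _ (M + 1)) => n /=.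
  have := hw n.+1; rewrite big_ord_recr/=.
  have : 0 <= \sum_(i < n) `|cq (w i)| ^+ 2 by rewrite sumr_ge0// => i _; rewrite exprn_ge0.
  by have := normr_ge0 (cq (w n)); move: `|cq (w n)| (\sum_(i < n) _) => y S *; nra.
have [U hU] := l2b u hu; have [V hV] := l2b v hv.
have [F hF] : exists F : H -> H, has_expansion F (fun n => cq (cpart (a n))).
  by apply: (@power_series_exists _ _ M) => n /=; rewrite auv; exact: cauchy_prod_bound.
have FE r t : 0 <= r < 1 -> F (r *: expI iH t) = U (r *: expI iH t) * V (r *: expI iH t).
  exact: (@slice_product R U V F (fun n => cpart (a n)) u v M r t hu hv auv hU hV hF).
exists F; split=> //.
  have [A [mA A0 hA]] := radial_cvg I2 hu hU; have [B [mB B0 hB]] := radial_cvg I2 hv hV.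
  have : mu.-negligible (A `|` B) by apply: negligibleU; [exists A; split|exists B; split].
  apply: negligibleS => t /= nt; apply: contrapT => /not_orP[tA tB]; apply: nt.
  have [l hl] : exists l : H, U (r *: expI iH t) @[r --> 1^'-] --> l by apply: contrapT => /hA.
  have [m hm] : exists l : H, V (r *: expI iH t) @[r --> 1^'-] --> l by apply: contrapT => /hB.
  exists (l * m); apply: cvg_trans (cvg_mulH hl hm); apply: near_eq_cvg.
  near=> r; rewrite FE//; apply/andP; split; near: r.
    exact: nbhs_left_ge.
  exact: nbhs_left_lt.
move=> e e0.
(* The weight in p q <= (eta/2) p^2 + q^2/(2 eta): the large factors U, V then cost at most e/2 in
   all, and the differences cost e/2 once their squares integrate to at most e eta / 2 each. *)
pose eta := e / (4 * pi * M + 1); have k0 : 0 < 4 * pi * M + 1 by rewrite ltr_wpDl// mulr_ge0// mulr_ge0// ltW.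
have eta0 : 0 < eta by rewrite divr_gt0.
have etaM : eta * (4 * pi * M) <= e.
  by rewrite /eta mulrAC ler_pdivrMr// ler_pM2l// lerDl.
have ee : 0 < e * eta / 2 by rewrite divr_gt0// mulr_gt0.
have [d1 d10 hd1] := l2_radial_cauchy I2 hU hu ee.
have [d2 d20 hd2] := l2_radial_cauchy I2 hV hv ee.
exists (Num.min d1 d2); first by rewrite lt_min d10.
move=> s s' c /andP[sd s1] /andP[sd' s1'] s0 s0'.
have s01 : 0 <= s < 1 by rewrite s0. have s01' : 0 <= s' < 1 by rewrite s0'.
have m1 : Num.min d1 d2 <= d1 by rewrite ge_min lexx.
have m2 : Num.min d1 d2 <= d2 by rewrite ge_min lexx orbT.
move: sd sd' m1 m2; move: (Num.min d1 d2) => dm sd sd' m1 m2.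
have h1 : itg c (c + 2 * pi) (fun t => `|U (s *: expI iH t) - U (s' *: expI iH t)| ^+ 2) <= e * eta / 2.
  by apply: hd1 => //; apply/andP; split=> //; lra.
have h2 : itg c (c + 2 * pi) (fun t => `|V (s *: expI iH t) - V (s' *: expI iH t)| ^+ 2) <= e * eta / 2.
  by apply: hd2 => //; apply/andP; split=> //; lra.
have h3 := circle_L2 c I2 hU hu s01; have h4 := circle_L2 c I2 hV hv s01'.
have cU : continuous (fun t => U (s *: expI iH t)) by exact: cts_slice I2 hU s01.
have cU' : continuous (fun t => U (s' *: expI iH t)) by exact: cts_slice I2 hU s01'.
have cV : continuous (fun t => V (s *: expI iH t)) by exact: cts_slice I2 hV s01.
have cV' : continuous (fun t => V (s' *: expI iH t)) by exact: cts_slice I2 hV s01'.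
set dU := fun t => U (s *: expI iH t) - U (s' *: expI iH t).
set dV := fun t => V (s *: expI iH t) - V (s' *: expI iH t).
have cdU : continuous (fun t => `|dU t| ^+ 2) by apply: cts_exp; apply: cts_normq; exact: ctsHB.
have cdV : continuous (fun t => `|dV t| ^+ 2) by apply: cts_exp; apply: cts_normq; exact: ctsHB.
have c2U : continuous (fun t => `|U (s *: expI iH t)| ^+ 2) by apply: cts_exp; exact: cts_normq.
have c2V : continuous (fun t => `|V (s' *: expI iH t)| ^+ 2) by apply: cts_exp; exact: cts_normq.
pose maj t := eta / 2 * (`|U (s *: expI iH t)| ^+ 2 + `|V (s' *: expI iH t)| ^+ 2) +
  (2 * eta)^-1 * (`|dU t| ^+ 2 + `|dV t| ^+ 2).
have cmaj : continuous maj.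
  by apply: ctsD; apply: ctsM; [exact: cts_cst|exact: ctsD|exact: cts_cst|exact: ctsD].
apply: le_trans (_ : _ <= itg c (c + 2 * pi) maj) _.
  apply: le_itg => // [|t _].
    by apply: cts_normq; apply: ctsHB; exact: cts_slice I2 hF _.
  rewrite !FE//; have -> : U (s *: expI iH t) * V (s *: expI iH t) - U (s' *: expI iH t) * V (s' *: expI iH t) =
      U (s *: expI iH t) * dV t + dU t * V (s' *: expI iH t).
    by rewrite /dU /dV mulrBr mulrBl addrA subrK.
  apply: le_trans (ler_normD _ _) _; rewrite !normqM /maj.
  have amgm (p q : R) : p * q <= eta / 2 * p ^+ 2 + (2 * eta)^-1 * q ^+ 2.
    have i0 : 0 <= (2 * eta)^-1 by rewrite invr_ge0 mulr_ge0// ltW.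
    have := mulr_ge0 i0 (sqr_ge0 (eta * p - q)).
    have -> : (2 * eta)^-1 * (eta * p - q) ^+ 2 = eta / 2 * p ^+ 2 + (2 * eta)^-1 * q ^+ 2 - p * q.
      by field; rewrite gt_eqF.
    by rewrite subr_ge0.
  have := amgm `|U (s *: expI iH t)| `|dV t|; have := amgm `|V (s' *: expI iH t)| `|dU t|; lra.
rewrite /maj itgD; last 2 first.
- by apply: ctsM; [exact: cts_cst|exact: ctsD].
- by apply: ctsM; [exact: cts_cst|exact: ctsD].
rewrite !itgZ ?itgD//; try exact: ctsD.
have g1 : eta / 2 * (2 * pi * M + 2 * pi * M) <= e / 2 by move: etaM; lra.
have g2 : (2 * eta)^-1 * (e * eta / 2 + e * eta / 2) = e / 2 by field; rewrite gt_eqF.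
rewrite [leRHS]splitr; apply: lerD.
  by apply: le_trans g1; apply: ler_wpM2l; [rewrite divr_ge0// ltW|exact: lerD].
by rewrite -g2; apply: ler_wpM2l; [rewrite invr_ge0 mulr_ge0// ltW|exact: lerD].
Unshelve. all: by end_near. Qed.

Lemma has_expansion_unique f g a q : has_expansion f a -> has_expansion g a -> `|q| < 1 -> f q = g q.
Proof.
by move=> fa ga q1; exact: (cvg_unique (@norm_hausdorff R H) (fa q q1) (ga q q1)).
Qed.

(** The function is rebuilt from its two complex components, each Cauchy in mean as the radius tends
    to 1; Fatou's lemma sends one of the two radii to the boundary. *)
Lemma bdry_L1 f a (M : R) : has_expansion f a ->
  (forall r, 0 < r < 1 -> circ_mean (fun t => `|f (r *: expI iH t)|) <= M) ->
  forall e : R, 0 < e -> exists2 d : R, 0 < d & forall s c : R, 1 - d < s < 1 -> 0 <= s ->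
    (\int[mu]_(t in `[c, (c + 2 * pi)%R]) (`|bdry f iH t - f (s *: expI iH t)|)%:E <= e%:E)%E.
Proof.
move=> fa fM; have I2 := @imag_units_i R; have pi0 := @pi_gt0 R.
have [F [hF [A [mA A0 hA]] cF]] := component_radial fa fM.
have nj : `|- jH : H| = 1 by rewrite normrN normq_sqrtE/= -[RHS]sqrtr1; congr Num.sqrt; ring.
have fM' r : 0 < r < 1 -> circ_mean (fun t => `|f (r *: expI iH t) * - jH|) <= M.
  move=> r01; under [fun t => _]funext => t do rewrite normqM nj mulr1; exact: fM.
have [G [hG [B [mB B0 hB]] cG]] := component_radial (@has_expansionMr R f a (- jH) fa) fM'.
have fE r t : 0 <= r < 1 -> f (r *: expI iH t) = F (r *: expI iH t) + G (r *: expI iH t) * jH.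
  move=> /andP[r0 r1]; apply: (@has_expansion_unique _ (fun q => F q + G q * jH) a) => //.
    have := has_expansionD hF (@has_expansionMr R _ _ jH hG).
    by congr has_expansion; apply/funext => n; rewrite -cpart_split.
  by rewrite norm_slice.
have lim : {ae mu, forall t, exists l : H, f (r *: expI iH t) @[r --> 1^'-] --> l}.
  have : mu.-negligible (A `|` B) by apply: negligibleU; [exists A; split|exists B; split].
  apply: negligibleS => t /= nt; apply: contrapT => /not_orP[tA tB]; apply: nt.
  have [l hl] : exists l : H, F (r *: expI iH t) @[r --> 1^'-] --> l by apply: contrapT => /hA.
  have [m hm] : exists l : H, G (r *: expI iH t) @[r --> 1^'-] --> l by apply: contrapT => /hB.
  exists (l + m * jH); apply: cvg_trans (cvgD hl (@cvg_mulqr R _ _ _ _ jH _ hm)); apply: near_eq_cvg.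
  near=> r; rewrite fE//; apply/andP; split; near: r.
    exact: nbhs_left_ge.
  exact: nbhs_left_lt.
move=> e e0; have e2 : 0 < e / 2 by rewrite divr_gt0.
have [d1 d10 hd1] := cF _ e2; have [d2 d20 hd2] := cG _ e2.
exists (Num.min d1 d2); first by rewrite lt_min d10.
move=> s c /andP[sd s1] s0; have s01 : 0 <= s < 1 by rewrite s0.
have m1 : Num.min d1 d2 <= d1 by rewrite ge_min lexx.
have m2 : Num.min d1 d2 <= d2 by rewrite ge_min lexx orbT.
have d0 : 0 < Num.min d1 d2 by rewrite lt_min d10.
move: sd m1 m2 d0; move: (Num.min d1 d2) => d sd m1 m2 d0.
have /cvgrPdist_lt/(_ d d0)[J _ hJ] := @rseq_cvg1 R.
pose r' j := @rseq R (j + J).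
have r'01 j : 0 <= r' j < 1 by case/andP: (@rseq01 R (j + J)) => h1 h2; rewrite ltW.
have r'd j : 1 - d < r' j.
  have := hJ (j + J)%N (leq_addl _ _); rewrite /= ger0_norm; first by rewrite -/(r' j); lra.
  by rewrite subr_ge0 ltW//; case/andP: (r'01 j).
have cf r : 0 <= r < 1 -> continuous (fun t => f (r *: expI iH t)) by move=> h; exact: cts_slice I2 fa h.
apply: (@fatou_circ _ (fun j t => `|f (r' j *: expI iH t) - f (s *: expI iH t)|)) => [j|j t||t||j].
- by apply: cts_normq; apply: ctsHB; exact: cf.
- exact: normr_ge0.
- exact: measurable_normq_bdryB I2 fa (cf s s01).
- exact: normr_ge0.
- have [N [mN N0 hN]] := lim; exists N; split=> // t /= nt; apply: hN => /= ht; apply: nt.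
  apply: cvg_norm; apply: cvgB; last exact: cvg_cst.
  have := bdry_cvg_seq ht; rewrite -(cvg_shiftn J); exact.
- have cH (W : H -> H) b r : has_expansion W b -> 0 <= r < 1 -> continuous (fun t => W (r *: expI iH t)).
    by move=> hW h; exact: cts_slice I2 hW h.
  have cW (W : H -> H) b : has_expansion W b ->
      continuous (fun t => `|W (r' j *: expI iH t) - W (s *: expI iH t)|).
    by move=> hW; apply: cts_normq; apply: ctsHB; exact: cH hW _.
  apply: le_trans (_ : _ <= itg c (c + 2 * pi) (fun t =>
     `|F (r' j *: expI iH t) - F (s *: expI iH t)| + `|G (r' j *: expI iH t) - G (s *: expI iH t)|)) _.
    apply: le_itg.
    + exact: cW fa.
    + by apply: ctsD; [exact: cW hF|exact: cW hG].
    move=> t _; rewrite !fE//.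
    have -> : F (r' j *: expI iH t) + G (r' j *: expI iH t) * jH -
       (F (s *: expI iH t) + G (s *: expI iH t) * jH) =
       (F (r' j *: expI iH t) - F (s *: expI iH t)) +
       (G (r' j *: expI iH t) - G (s *: expI iH t)) * jH.
      by rewrite mulrBl opprD addrACA.
    by apply: le_trans (ler_normD _ _) _; rewrite normqM -[`|jH|]normrN nj mulr1.
  rewrite itgD; [|exact: cW hF|exact: cW hG].
  have /andP[r0 r1] := r'01 j; have rd := r'd j.
  by rewrite [leRHS]splitr; apply: lerD; [apply: hd1|apply: hd2] => //; apply/andP; split=> //; lra.
Unshelve. all: by end_near. Qed.

Lemma H1_circ_mean f a : in_H1 f -> has_expansion f a ->
  exists2 M : R, 0 <= M & forall I r, imag_units I -> 0 < r < 1 -> circ_mean (fun t => `|f (r *: expI I t)|) <= M.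
Proof.
move=> [_ fH] fa.
have h I r : imag_units I -> 0 < r < 1 ->
    ((circ_mean (fun t => `|f (r *: expI I t)|))%:E <= H1_norm f)%E.
  move=> I2 r01; have r01' : 0 <= r < 1 by case/andP: r01 => h1 h2; rewrite ltW.
  rewrite -(circle_meanE I2 fa r01'); apply: ereal_sup_ubound => /=.
  by exists (I, r) => //=; split=> //=; rewrite in_itv.
have m0 I r : 0 <= circ_mean (fun t => `|f (r *: expI I t)|).
  by rewrite mulr_ge0 ?itg_ge0// invr_ge0 mulr_ge0// ltW// pi_gt0.
have r2 : 0 < (2^-1 : R) < 1 by apply/andP; split; lra.
have H0 : (0 <= H1_norm f)%E.
  by apply: le_trans (h _ _ (@imag_units_i R) r2); rewrite lee_fin.
have fin : H1_norm f \is a fin_num by rewrite ge0_fin_numE.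
exists (fine (H1_norm f)); first exact: fine_ge0.
by move=> I r I2 r01; rewrite -lee_fin fineK//; exact: h.
Qed.

End RadialLimitsInMean.

(** * Fejer averages *)

Section Fejer.
Variable R : realType.
Local Notation H := (quat R).
Local Notation C := R[i].
Local Notation iH := (Quat 0 1 0 0 : H).
Local Notation mu := (@lebesgue_measure R).
Implicit Types (b : H -> H) (a : nat -> H) (p : H) (f g : R -> R) (K e r s t : R).

(** The error [e] is not scaled by the length of the arc, since a dilate is close to the boundary
    function only in L1 over the whole circle. *)
Definition osc_err K e f := forall u v, u < v -> v - u <= 2 * pi ->
  itg u v (fun t => `|f t - avg u v f|) <= K * (v - u) + e.

Let ctsA f c : continuous f -> continuous (fun t => `|f t - c|).
Proof. by move=> cf; apply: cts_norm; apply: ctsB => //; exact: cts_cst. Qed.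

Lemma osc_closest f c u v : continuous f -> u < v ->
  itg u v (fun t => `|f t - avg u v f|) <= 2 * itg u v (fun t => `|f t - c|).
Proof.
move=> cf uv; have h := avg_dist_le cf c uv.
apply: le_trans (_ : _ <= itg u v (fun t => `|f t - c| + `|avg u v f - c|)) _.
  apply: le_itg; [exact: ctsA|by apply: ctsD; [exact: ctsA|exact: cts_cst]|move=> t _].
  have -> : f t - avg u v f = (f t - c) - (avg u v f - c) by ring.
  exact: ler_normB.
rewrite itgD; [|exact: ctsA|exact: cts_cst].
by rewrite itg_cst ?(ltW uv)//; lra.
Qed.

Lemma osc_err_shift K e f c : continuous f -> osc_err K e f -> osc_err K e (fun t => f (t + c)).
Proof.
move=> cf fK u v uv uv2; have uvc : u + c < v + c by rewrite ltrD2r.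
have ee : v + c - (u + c) = v - u by ring.
have ea : avg u v (fun t => f (t + c)) = avg (u + c) (v + c) f.
  by rewrite /avg ee -itg_shift// ltW.
rewrite ea -(@itg_shift _ c (fun t => `|f t - _|)) ?(ltW uv)//; last exact: ctsA.
by rewrite -[v - u]ee; apply: fK; rewrite ?ee.
Qed.

Lemma osc_err_close K e d f g : continuous f -> continuous g -> 0 <= d ->
  (forall t, `|f t - g t| <= d) -> osc_err K e f -> osc_err (K + 2 * d) e g.
Proof.
move=> cf cg d0 fg fK u v uv uv2; have vu : 0 < v - u by rewrite subr_gt0.
have ad : `|avg u v f - avg u v g| <= d.
  rewrite /avg -mulrBr normrM gtr0_norm ?invr_gt0// ler_pdivrMl// -itgB//.
  apply: le_trans (itg_norm _ _ (ctsB cf cg)) _.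
  rewrite mulrC -itg_cst ?(ltW uv)//; apply: le_itg => [||t _]; last exact: fg.
    by apply: cts_norm; exact: ctsB.
  exact: cts_cst.
apply: le_trans (_ : _ <= itg u v (fun t => `|f t - avg u v f| + 2 * d)) _.
  apply: le_itg; [exact: ctsA|by apply: ctsD; [exact: ctsA|exact: cts_cst]|move=> t _].
  have -> : g t - avg u v g = (f t - avg u v f) - (f t - g t) + (avg u v f - avg u v g) by ring.
  apply: le_trans (ler_normD _ _) _; have := ler_normB (f t - avg u v f) (f t - g t).
  have := fg t; lra.
rewrite itgD; [|exact: ctsA|exact: cts_cst].
by rewrite itg_cst ?(ltW uv)//; have := fK u v uv uv2; lra.
Qed.

Lemma osc_err_convex K e M (w : 'I_M -> R) (f : 'I_M -> R -> R) :
  (forall k, 0 <= w k) -> \sum_k w k = 1 -> (forall k, continuous (f k)) ->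
  (forall k, osc_err K e (f k)) -> osc_err K e (fun t => \sum_k w k * f k t).
Proof.
move=> w0 w1 cf fK u v uv uv2.
have cw k : continuous (fun t => w k * f k t) by apply: ctsM => //; exact: cts_cst.
have ea : avg u v (fun t => \sum_k w k * f k t) = \sum_k w k * avg u v (f k).
  rewrite /avg itg_sum// mulr_sumr; apply: eq_bigr => k _; rewrite itgZ//; ring.
rewrite ea; apply: le_trans (_ : _ <= itg u v (fun t => \sum_k w k * `|f k t - avg u v (f k)|)) _.
  have cwa k : continuous (fun t => w k * `|f k t - avg u v (f k)|).
    by apply: ctsM; [exact: cts_cst|exact: ctsA].
  apply: le_itg; [by apply: ctsA; exact: cts_sum|exact: cts_sum|move=> t _].
  rewrite -sumrB; apply: le_trans (ler_norm_sum _ _ _) _; apply: ler_sum => k _.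
  by rewrite -mulrBr normrM ger0_norm.
rewrite itg_sum => [|k]; last by apply: ctsM; [exact: cts_cst|exact: ctsA].
rewrite -[leRHS]mul1r -w1 mulr_suml; apply: ler_sum => k _.
rewrite itgZ; last exact: ctsA.
by apply: ler_wpM2l => //; exact: fK.
Qed.

(** A discrete Fejer kernel: the weights are |sum_(j < N) z^j|^2 / (N M) at the M-th roots of unity
    z. With M = D + N all exponents stay below M, so there is no aliasing and the coefficient counts
    the j with j + n < N. *)
Lemma fejer_weights N D : (0 < N)%N -> exists M (w th : 'I_M -> R),
  [/\ forall k, 0 <= w k & forall n, (n < D)%N ->
    \sum_k ((w k)%:C)%C * cis (n%:R * th k) = (((N - n)%N%:R / N%:R : R)%:C)%C].
Proof.
move=> N0; pose M := (D + N)%N; have M0 : (0 < M)%N by rewrite addn_gt0 N0 orbT.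
have NR : (0 : R) < N%:R by rewrite ltr0n.
have MR : (0 : R) < M%:R by rewrite ltr0n.
pose th (k : 'I_M) : R := k%:R * (2 * pi / M%:R).
pose S (k : 'I_M) := \sum_(j < N) cis (th k) ^+ j.
exists M, (fun k => `|cq (S k)| ^+ 2 / (N * M)%:R), th; split=> [k|n nD].
  by rewrite divr_ge0// exprn_ge0.
have rn k : ((k%:R : R)%:C)%C = k%:R :> C by exact: rmorph_nat.
have NMC : ((N * M)%:R : C) != 0 by rewrite pnatr_eq0 -lt0n muln_gt0 N0.
transitivity ((N * M)%:R^-1 * \sum_(j < N) \sum_(l < N) \sum_(k < M)
    cis (th k) ^+ (j + n) * (cis (th k))^* ^+ l).
  under [in RHS]eq_bigr => j _ do rewrite exchange_big.
  rewrite exchange_big mulr_sumr /=; apply: eq_bigr => k _.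
  rewrite -cisX; have -> : ((`|cq (S k)| ^+ 2 / (N * M)%:R)%:C)%C =
      (N * M)%:R^-1 * (S k * (S k)^*).
    by rewrite conj_norm_cq rmorphM fmorphV /= rn mulrC.
  rewrite -mulrA; congr (_ * _); rewrite /S rmorph_sum /= mulr_suml mulr_suml.
  apply: eq_bigr => j _; rewrite mulr_sumr mulr_suml; apply: eq_bigr => l _.
  by rewrite rmorphXn /= exprD; ring.
have inner (j : 'I_N) : \sum_(l < N) \sum_(k < M) cis (th k) ^+ (j + n) * (cis (th k))^* ^+ l =
    (if (j < N - n)%N then M%:R else 0).
  rewrite (eq_bigr (fun l : 'I_N => if (j + n == l)%N then M%:R else 0)) => [|l _]; last first.
    apply: cis_sum_unity.
      by rewrite /M addnC -addSn leq_add// ltnW.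
    by rewrite /M (leq_trans (ltn_ord l))// leq_addl.
  case: ltnP => jn.
    have jN : (j + n < N)%N by rewrite addnC -ltn_subRL.
    rewrite (bigD1 (Ordinal jN))//= eqxx big1 ?addr0// => l /negbTE.
    by rewrite -val_eqE/= eq_sym => ->.
  rewrite big1// => l _; case: eqP => // e; have := ltn_ord l; rewrite -e => h.
  by move: jn; rewrite leq_subLR addnC leqNgt h.
under eq_bigr => j _ do rewrite inner.
have -> : \sum_(j < N) (if (j < N - n)%N then M%:R else 0 : C) = (M * (N - n))%:R.
  rewrite -big_mkcond/= -(big_ord_widen _ (fun=> (M%:R : C)) (leq_subr n N)).
  by rewrite sumr_const card_ord natrM mulr_natr.
have -> : (((N - n)%N%:R / N%:R : R)%:C)%C = (N - n)%N%:R / N%:R :> C.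
  by rewrite rmorphM fmorphV /= !rn.
have NC : (N%:R : C) != 0 by rewrite pnatr_eq0 -lt0n.
have MC : (M%:R : C) != 0 by rewrite pnatr_eq0 -lt0n.
by rewrite !natrM; field; rewrite NC.
Qed.

(** The subtraction is truncated, so coefficients of index at least [N] vanish. *)
Definition fejer N a n : H := ((N - n)%N%:R / N%:R : R) *: a n.

Lemma fejer_average N D a p : (0 < N)%N -> (N <= D)%N -> exists M (w th : 'I_M -> R),
  [/\ forall k, 0 <= w k, \sum_k w k = 1 & forall s t,
    q1 (circ_sum iH (fejer N a) N s t * p) =
    \sum_k w k * q1 (circ_sum iH a D s (t + th k) * p)].
Proof.
move=> N0 ND; have [M [w [th [w0 wE]]]] := @fejer_weights N D N0.
have D0 : (0 < D)%N by exact: leq_trans N0 ND.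
exists M, w, th; split=> // [|s t].
  have := wE 0%N D0; under eq_bigr => k _ do rewrite mul0r cis0 mulr1.
  rewrite subn0 divff ?pnatr_eq0 -?lt0n// -rmorph_sum /=.
  by move=> /(congr1 (@complex.Re R)).
under eq_bigr => k _ do rewrite -q1Z scalerAl.
rewrite -q1_sum; congr q1; rewrite -mulr_suml; congr (_ * _).
have -> : circ_sum iH (fejer N a) N s t = circ_sum iH (fejer N a) D s t.
  rewrite /circ_sum (big_ord_widen _ (fun n => s ^+ n *: (expI iH (n%:R * t) * fejer N a n)) ND).
  rewrite big_mkcond; apply: eq_bigr => n _; case: ltnP => // h.
  by rewrite /fejer (eqP (h : N - n == 0)%N) mul0r scale0r mulr0 scaler0.
rewrite /circ_sum; under [in RHS]eq_bigr => k _ do rewrite scaler_sumr.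
rewrite exchange_big; apply: eq_bigr => n _ /=.
transitivity (s ^+ n *: (expI iH (n%:R * t) *
    (cq (\sum_k ((w k)%:C)%C * cis (n%:R * th k)) * a n))).
  rewrite wE// /fejer; congr (_ *: (_ * _)).
  by apply: quatP => /=; ring.
rewrite rmorph_sum mulr_suml mulr_sumr scaler_sumr; apply: eq_bigr => k _.
rewrite mulrDr expID; last exact: imag_units_i.
rewrite rmorphM /= cq_cis; set E := expI _ (n%:R * th k); set E' := expI _ _.
by apply: quatP => /=; ring.
Qed.

(** Triangle inequality with [bdry_L1]: the L1 distance over a full period bounds the one over every
    arc. The factor 2 comes from passing from an arbitrary constant to the average. *)
Lemma dilate_osc b a (M K e : R) : has_expansion b a ->
  (forall r, 0 < r < 1 -> circ_mean (fun t => `|b (r *: expI iH t)|) <= M) ->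
  (forall u v : R, u < v -> v - u <= 2 * pi -> exists c : H,
     (\int[mu]_(t in `[u, v]) (`|bdry b iH t - c|)%:E <= (K * (v - u))%:E)%E) ->
  0 < e -> exists2 d : R, 0 < d & forall s p, 1 - d < s < 1 -> 0 <= s -> `|p| <= 1 ->
  osc_err (2 * K) e (fun t => q1 (b (s *: expI iH t) * p)).
Proof.
move=> ba bM bK e0; have I2 := @imag_units_i R; have pi0 := @pi_gt0 R.
have [d d0 hd] := bdry_L1 ba bM (divr_gt0 e0 (ltr0Sn _ 1)).
exists d => // s p sd s0 p1 u v uv uv2; have s01 : 0 <= s < 1 by rewrite s0; case/andP: sd.
have [c hc] := bK u v uv uv2.
have cb : continuous (fun t => b (s *: expI iH t)) by exact: cts_slice I2 ba s01.
have cx : continuous (fun t => q1 (b (s *: expI iH t) * p)).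
  by apply: (@cts_comp_q1 R _ (fun t => b (s *: expI iH t) * p)); exact: ctsHMr.
apply: le_trans (osc_closest (q1 (c * p)) cx uv) _.
suff : itg u v (fun t => `|q1 (b (s *: expI iH t) * p) - q1 (c * p)|) <= K * (v - u) + e / 2 by lra.
apply: le_trans (_ : _ <= itg u v (fun t => `|b (s *: expI iH t) - c|)) _.
  apply: le_itg => [||t _].
  - exact: ctsA.
  - by apply: cts_normq; apply: ctsHB => //; exact: ctsH_cst.
  - by rewrite -q1B -mulrBl (le_trans (norm_q1_le _))// normqM ler_piMr.
rewrite -lee_fin -itgE; last by apply: cts_normq; apply: ctsHB => //; exact: ctsH_cst.
have m1 : measurable_fun `[u, v] (fun t => (`|bdry b iH t - c|)%:E).
  by apply/measurable_EFinP; apply: measurable_funTS; exact: measurable_normq_bdry I2 ba.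
have m2 D : measurable D -> measurable_fun D (fun t => (`|bdry b iH t - b (s *: expI iH t)|)%:E).
  by move=> mD; apply/measurable_EFinP; apply: measurable_funTS; exact: measurable_normq_bdryB I2 ba cb.
apply: (@le_trans _ _ (\int[mu]_(t in `[u, v])
    ((`|bdry b iH t - c|)%:E + (`|bdry b iH t - b (s *: expI iH t)|)%:E))%E).
  apply: ge0_le_integral => //.
  - apply/measurable_EFinP; apply: measurable_funTS; apply: continuous_measurable_fun.
    by apply: cts_normq; apply: ctsHB => //; exact: ctsH_cst.
  - by apply: emeasurable_funD => //; exact: m2.
  - move=> t _; rewrite -EFinD lee_fin [`|bdry b iH t - b _|]distrC [leRHS]addrC.
    exact: ler_distD.
rewrite ge0_integralD//; last exact: m2.
rewrite EFinD leeD//; apply: le_trans (hd s u sd s0).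
apply: ge0_subset_integral => //; first exact: m2.
by apply: subset_itvl; rewrite bnd_simp; lra.
Qed.

(* Oscillation of the boundary values passes to the dilates up to an error
   that vanishes as the radius grows; averaging over finitely many rotations
   preserves it, and the average no longer degenerates at radius one. *)
Lemma fejer_osc b a (M K : R) p N : has_expansion b a ->
  (forall r, 0 < r < 1 -> circ_mean (fun t => `|b (r *: expI iH t)|) <= M) ->
  (forall u v : R, u < v -> v - u <= 2 * pi -> exists c : H,
     (\int[mu]_(t in `[u, v]) (`|bdry b iH t - c|)%:E <= (K * (v - u))%:E)%E) ->
  `|p| <= 1 -> (0 < N)%N ->
  osc_le (2 * K) (fun t => q1 (circ_sum iH (fejer N a) N 1 t * p)).
Proof.
move=> ba bM bK p1 N0 u0 v0 uv0 uv20; have I2 := @imag_units_i R; have pi0 := @pi_gt0 R.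
apply/ler_addgt0Pr => e0; move: (e0 : R) => {}e0 e00.
(* Two uniform approximations, each adding 2 e to the oscillation constant on arcs of length at most
   2 pi, cost 8 pi e; the L1 error adds e. *)
pose e := e0 / (8 * pi + 1); have k0 : 0 < 8 * pi + 1 :> R by lra.
have e_gt0 : 0 < e by rewrite divr_gt0.
have ek : e * (8 * pi + 1) = e0 by rewrite /e divfK// gt_eqF.
have [d d0 hd] := dilate_osc ba bM bK e_gt0.
pose S := \sum_(n < N) `|fejer N a n| * n%:R.
have S0 : 0 <= S by apply: sumr_ge0 => n _; rewrite mulr_ge0.
have ed : 0 < Num.min d (e / (S + 1)) by rewrite lt_min d0 divr_gt0// ltr_wpDl.
have /cvgrPdist_lt/(_ _ ed)[J _ /(_ J (leqnn J))] := @rseq_cvg1 R.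
set s := @rseq R J; have /andP[s0 s1] : 0 < s < 1 := @rseq01 R J.
rewrite gtr0_norm ?subr_gt0// lt_min => /andP[sd sS].
have s01 : 0 <= s < 1 by rewrite ltW.
have oscb : osc_err (2 * K) e (fun t => q1 (b (s *: expI iH t) * p)).
  by apply: hd => //; [rewrite s1 andbT; lra|exact: ltW].
have s01' : 0 < s < 1 by rewrite s0.
have [D0 hD0] := circ_sum_uniform I2 ba s01' e_gt0.
pose D := maxn D0 N.
have cb : continuous (fun t => q1 (b (s *: expI iH t) * p)).
  by apply: (@cts_comp_q1 R _ (fun t => b (s *: expI iH t) * p)); apply: ctsHMr; exact: cts_slice I2 ba s01.
have cT c : continuous (fun t => q1 (circ_sum iH a D s (t + c) * p)).
  apply: (@cts_comp_q1 R _ (fun t => circ_sum iH a D s (t + c) * p)); apply: ctsHMr => t.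
  apply: (@continuous_comp _ _ _ (fun t => t + c) (circ_sum iH a D s)).
    by apply: ctsD; [exact: cts_id|exact: cts_cst].
  exact: cts_circ_sum.
have cT0 : continuous (fun t => q1 (circ_sum iH a D s t * p)).
  by have := cT 0; under eq_fun do rewrite addr0.
have q1p (x y : H) : `|q1 (x * p) - q1 (y * p)| <= `|x - y|.
  by rewrite -q1B -mulrBl (le_trans (norm_q1_le _))// normqM ler_piMr.
have oscT : osc_err (2 * K + 2 * e) e (fun t => q1 (circ_sum iH a D s t * p)).
  apply: osc_err_close cb cT0 (ltW e_gt0) _ oscb => t; apply: le_trans (q1p _ _) _.
  by apply: hD0; rewrite ?leq_maxl// ltW//=.
have [n [w [th [w0 w1 wE]]]] := fejer_average a p N0 (leq_maxr D0 N).
have oscF : osc_err (2 * K + 2 * e) e (fun t => q1 (circ_sum iH (fejer N a) N s t * p)).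
  have -> : (fun t => q1 (circ_sum iH (fejer N a) N s t * p)) =
      (fun t => \sum_k w k * (fun k t => q1 (circ_sum iH a D s (t + th k) * p)) k t).
    by apply/funext => t; rewrite wE.
  have cTk k : continuous (fun t => q1 (circ_sum iH a D s (t + th k) * p)) := @cT (th k).
  have oTk k : osc_err (2 * K + 2 * e) e (fun t => q1 (circ_sum iH a D s (t + th k) * p)).
    exact: (osc_err_shift (th k) cT0 oscT).
  exact: (@osc_err_convex _ _ n w _ w0 w1 cTk oTk).
have cF r : continuous (fun t => q1 (circ_sum iH (fejer N a) N r t * p)).
  by apply: (@cts_comp_q1 R _ (fun t => circ_sum iH _ N r t * p)); apply: ctsHMr; exact: cts_circ_sum.
have close t : `|q1 (circ_sum iH (fejer N a) N s t * p) - q1 (circ_sum iH (fejer N a) N 1 t * p)| <= e.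
  apply: le_trans (q1p _ _) _; rewrite /circ_sum -sumrB.
  apply: le_trans (ler_norm_sum _ _ _) _.
  apply: le_trans (_ : _ <= S * (1 - s)) _; last first.
    move: sS; rewrite ltr_pdivlMr ?ltr_wpDl// => /ltW; apply: le_trans.
    by rewrite mulrC ler_wpM2l ?subr_ge0 ?(ltW s1)// lerDl.
  rewrite /S mulr_suml; apply: ler_sum => k _; rewrite -scalerBl normrZ normqM normq_expI//.
  rewrite mul1r mulrC -mulrA ler_wpM2l//; apply: le_trans (powB_le k _ _) _; rewrite ?(ltW s0) ?(ltW s1)//=.
    by rewrite ler01 lexx.
  by rewrite distrC ger0_norm ?subr_ge0 ?(ltW s1).
have := osc_err_close (cF s) (cF 1) (ltW e_gt0) close oscF.
move=> /(_ u0 v0 uv0 uv20) /le_trans; apply.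
have : e * (v0 - u0) <= e * (2 * pi) by rewrite ler_pM2l.
move: ek; lra.
Qed.

End Fejer.

(** * The pairing and its extension *)

Section Pairing.
Variable R : realType.
Local Notation H := (quat R).
Local Notation C := R[i].
Local Notation iH := (Quat 0 1 0 0 : H).
Local Notation jH := (Quat 0 0 1 0 : H).
Local Notation mu := (@lebesgue_measure R).
Implicit Types (b : H -> H) (a : nat -> H) (x : nat -> C) (F h u v : {poly C}) (K e r s t : R).

Lemma unimodular_dual (z : C) : exists2 c : C, c * c^* = 1 & complex.Re (c * z) = `|cq z|.
Proof.
have [->|z0] := eqVneq z 0.
  by exists 1; [rewrite conjC1 mulr1|rewrite mulr0 rmorph0 normr0].
have n0 : `|cq z| != 0 by apply: contraNneq z0 => /norm_cq_eq0 ->.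
exists (z^* * ((`|cq z|^-1)%:C)%C).
  rewrite conj_norm_cq norm_cqM norm_cq_conj norm_cq_real ger0_norm ?invr_ge0//.
  by rewrite divff// expr1n.
rewrite mulrAC [z^* * z]mulrC conj_norm_cq -rmorphM /=.
by rewrite expr2 mulfK.
Qed.

Lemma circ_mean_norm_ge0 h : 0 <= circ_mean (fun t => `|cq h.[cis t]|).
Proof. by rewrite mulr_ge0 ?itg_ge0// invr_ge0 mulr_ge0// ltW// pi_gt0. Qed.

(** In an approximate factorization the constant coefficient is nearly u_0 v_0, and |u_0 v_0| <=
    (|u_0|^2 + |v_0|^2)/2. *)
Lemma coef0_le_mean h : `|cq h`_0| <= circ_mean (fun t => `|cq h.[cis t]|).
Proof.
apply/ler_addgt0Pr => e0; move: (e0 : R) => e {e0} e0.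
have e2 : 0 < e / 2 by rewrite divr_gt0.
have [u [v [hu hv huv]]] := poly_l2_factor h e2; set m := circ_mean _ in hu hv *.
have c0 (w : {poly C}) : \sum_(n < size w) `|cq w`_n| ^+ 2 <= m + e / 2 -> `|cq w`_0| ^+ 2 <= m + e / 2.
  apply: le_trans; case: (posnP (size w)) => [w0|w0].
    by rewrite nth_default ?w0// rmorph0 normr0 expr0n/= sumr_ge0// => i _; rewrite exprn_ge0.
  by rewrite (bigD1 (Ordinal w0))//= lerDl sumr_ge0// => i _; rewrite exprn_ge0.
have := huv 0%N; rewrite coef0M rmorphB => h0.
have h1 := le_trans (lerB_dist (cq h`_0) (cq (u`_0 * v`_0))) (_ : _ <= e / 2).
rewrite distrC in h1; move: (h1 h0); rewrite norm_cqM.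
have := c0 u hu; have := c0 v hv; have := sqr_ge0 (`|cq u`_0| - `|cq v`_0|).
rewrite sqrrB; lra.
Qed.

(** F is scaled to normalize Garsia's bound and [h] is factored up to an error tending to 0.
    [bellman], with the unimodular constant that makes the pairing real, gives 4 (m + m) = 8 m, and
    undoing the scaling gives 8 * 36 = 288. *)
Lemma pairing_poly F N K h : (size F <= N)%N -> 0 < K ->
  osc_le K (fun t => complex.Re F.[cis t]) -> osc_le K (fun t => complex.Im F.[cis t]) ->
  `|cq (\sum_(j < N) h`_j.+1 * (F`_j.+1)^*)| <= 288 * K * circ_mean (fun t => `|cq h.[cis t]|).
Proof.
move=> FN K0 hRe hIm; set m := circ_mean _.
(* 36^2 = 1296 exceeds the constant 1280 of [garsia_bound]. *)
pose k := (36 * K)^-1; have k0 : 0 < k by rewrite invr_gt0; lra.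
have kK : k * (36 * K) = 1 by rewrite mulVf// gt_eqF//; lra.
pose F' := (k%:C)%C *: F.
have F'N : (size F' <= N)%N by rewrite (leq_trans (size_scale_leq _ _)).
have S1 (z : C) : `|cq z| <= 1 ->
    (1 - `|cq z| ^+ 2) * \sum_(j < N) `|cq (drop_poly j.+1 F').[z]| ^+ 2 <= 1.
  move=> z1; have S2 := garsia_bound FN K0 hRe hIm z1.
  have -> : \sum_(j < N) `|cq (drop_poly j.+1 F').[z]| ^+ 2 =
      k ^+ 2 * \sum_(j < N) `|cq (drop_poly j.+1 F).[z]| ^+ 2.
    rewrite mulr_sumr; apply: eq_bigr => j _.
    by rewrite drop_polyZ hornerZ norm_cqM norm_cq_real exprMn (gtr0_norm k0).
  rewrite mulrCA; move: (_ * \sum_(j < N) _) S2 => S S2.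
  have k2 : 0 <= k ^+ 2 by rewrite exprn_ge0// ltW.
  apply: le_trans (ler_wpM2l k2 S2) _.
  have : (k * (36 * K)) ^+ 2 = 1 by rewrite kK expr1n.
  rewrite exprMn exprMn; have : 0 <= k ^+ 2 * K ^+ 2 by rewrite mulr_ge0// exprn_ge0// ltW.
  by lra.
pose X h := \sum_(j < N) h`_j.+1 * (F'`_j.+1)^*.
have bound e : 0 < e -> `|cq (X h)| <= 8 * (m + e) + e * \sum_(j < N) `|cq F'`_j.+1|.
  move=> e0; have [u [v [hu hv huv]]] := poly_l2_factor h e0; rewrite -/m in hu hv.
  have -> : X h = X (u * v) - \sum_(j < N) ((u * v)`_j.+1 - h`_j.+1) * (F'`_j.+1)^*.
    by rewrite /X -sumrB; apply: eq_bigr => j _; ring.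
  rewrite rmorphB; apply: le_trans (ler_normB _ _) _; apply: lerD.
    have [c c1 <-] := unimodular_dual (X (u * v)).
    have hB := @bellman R N F' u v c F'N c1 S1; rewrite -/(X (u * v)) in hB.
    by apply: le_trans hB _; lra.
  apply: le_trans (norm_cq_sum _ _) _; rewrite mulr_sumr; apply: ler_sum => j _.
  by rewrite norm_cqM norm_cq_conj ler_wpM2r.
have X8 : `|cq (X h)| <= 8 * m.
  apply/ler_addgt0Pr => e0; move: (e0 : R) => e {e0} e0.
  pose T := \sum_(j < N) `|cq F'`_j.+1|; have T0 : 0 <= T by rewrite sumr_ge0.
  have e1 : 0 < e / (8 + T) by rewrite divr_gt0// ltr_wpDr.
  have := bound _ e1; rewrite -/T.
  have : e / (8 + T) * (8 + T) = e by rewrite divfK// gt_eqF// ltr_wpDr.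
  move: (e / _) => d; lra.
have -> : \sum_(j < N) h`_j.+1 * (F`_j.+1)^* = ((36 * K)%:C)%C * X h.
  rewrite /X mulr_sumr; apply: eq_bigr => j _.
  have -> : (F'`_j.+1)^* = (k%:C)%C * (F`_j.+1)^*.
    rewrite coefZ rmorphM; congr (_ * _).
    by apply/eqP; rewrite eq_complex/= oppr0 !eqxx.
  have kC : ((36 * K)%:C)%C * (k%:C)%C = 1 :> C by rewrite -rmorphM /= mulrC kK rmorph1.
  transitivity (((36 * K)%:C)%C * (k%:C)%C * (h`_j.+1 * (F`_j.+1)^*)); first by rewrite kC mul1r.
  by ring.
rewrite norm_cqM norm_cq_real gtr0_norm; last lra.
have : 0 <= 36 * K by lra.
by move=> /ler_wpM2l /(_ _ _ X8); lra.
Qed.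

(** For fixed [h] the Fejer factor alters the pairing by at most T/N, while the bound for the Fejer
    polynomials does not depend on N. The term of index 0, absent from [pairing_poly], is estimated
    by [coef0_le_mean]. *)
Lemma complex_pairing x K B h : 0 < K -> `|cq (x 0%N)| <= B ->
  (forall N, (0 < N)%N -> let F := \poly_(n < N) ((((N - n)%N%:R / N%:R : R)%:C)%C * x n) in
     osc_le K (fun t => complex.Re F.[cis t]) /\ osc_le K (fun t => complex.Im F.[cis t])) ->
  forall D, (size h <= D)%N ->
  `|cq (\sum_(n < D) (x n)^* * h`_n)| <= (288 * K + B) * circ_mean (fun t => `|cq h.[cis t]|).
Proof.
move=> K0 xB hF D hD; set m := circ_mean _; have m0 : 0 <= m := circ_mean_norm_ge0 h.
apply/ler_addgt0Pr => e0; move: (e0 : R) => e {e0} e0.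
pose T := \sum_(n < D) n.+1%:R * (`|cq (x n.+1)| * `|cq h`_n.+1|).
have T0 : 0 <= T by rewrite sumr_ge0// => n _; rewrite !mulr_ge0.
pose N := (maxn D (Num.truncn (T / e)).+1).+1.
have N0 : (0 < N)%N by [].
have NR : (0 : R) < N%:R by rewrite ltr0n.
have DN : (D <= N)%N by rewrite /N leqW// leq_maxl.
have TN : T / N%:R <= e.
  rewrite ler_pdivrMr// mulrC -ler_pdivrMr//; apply: le_trans (ltW (truncnS_gt _)) _.
  by rewrite ler_nat /N leqW// leq_maxr.
have [hRe hIm] := hF N N0; set F := \poly_(n < N) _ in hRe hIm.
have FN : (size F <= N)%N := size_poly _ _.
have hP := pairing_poly h FN K0 hRe hIm; rewrite -/m in hP.
have -> : \sum_(n < D) (x n)^* * h`_n = (x 0%N)^* * h`_0 + \sum_(j < N) (x j.+1)^* * h`_j.+1.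
  rewrite (big_ord_widen N.+1 (fun n => (x n)^* * h`_n)) 1?leqW// big_mkcond/= big_ord_recl /=.
  congr (_ + _).
    by case: ltnP => // D0; rewrite nth_default ?mulr0// (leq_trans hD).
  apply: eq_bigr => j _; rewrite /bump leq0n add1n; case: ltnP => // jD.
  by rewrite nth_default ?mulr0// (leq_trans hD).
have e1 : \sum_(j < N) (x j.+1)^* * h`_j.+1 = \sum_(j < N) h`_j.+1 * (F`_j.+1)^* +
    \sum_(j < N) (if (j < D)%N then ((j.+1%:R / N%:R : R)%:C)%C * ((x j.+1)^* * h`_j.+1) else 0).
  rewrite -big_split/=; apply: eq_bigr => j _; rewrite coef_poly.
  have hj : ~~ (j < D)%N -> h`_j.+1 = 0.
    by rewrite -leqNgt => jD; rewrite nth_default// (leq_trans hD)// leqW.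
  (* At j + 1 = N the coefficient of [F] is out of range and zero, which agrees with the correction
     weight (j+1)/N being 1. *)
  case: ifP => [jN|jN]; last first.
    have eN : j.+1 = N by apply/eqP; rewrite eqn_leq ltn_ord leqNgt jN.
    rewrite rmorph0 mulr0 add0r eN divff ?gt_eqF// rmorph1 mul1r -eN.
    by case: ifP => // /negbT /hj ->; rewrite mulr0.
  rewrite rmorphM /=.
  have cr (y : R) : ((y%:C)%C : C)^* = (y%:C)%C by apply/eqP; rewrite eq_complex/= oppr0 !eqxx.
  rewrite cr; have -> : (((N - j.+1)%N%:R / N%:R : R)%:C)%C = 1 - ((j.+1%:R / N%:R : R)%:C)%C :> C.
    rewrite natrB 1?ltnW// mulrBl divff ?gt_eqF// rmorphB rmorph1//.
  case: ifP => [_|/negbT /hj ->]; first by ring.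
  by rewrite mulr0 mul0r addr0.
rewrite rmorphD; apply: le_trans (ler_normD _ _) _; rewrite e1 rmorphD.
have h1 : `|cq ((x 0%N)^* * h`_0)| <= B * m.
  rewrite norm_cqM norm_cq_conj; apply: ler_pM => //; exact: coef0_le_mean.
have h2 : `|cq (\sum_(j < N) (if (j < D)%N then ((j.+1%:R / N%:R : R)%:C)%C * ((x j.+1)^* * h`_j.+1) else 0))| <= e.
  apply: le_trans TN; apply: le_trans (norm_cq_sum _ _) _.
  rewrite /T (big_ord_widen N (fun n => n.+1%:R * (`|cq (x n.+1)| * `|cq h`_n.+1|)) DN).
  rewrite [X in _ <= X / _]big_mkcond mulr_suml.
  apply: ler_sum => j _; case: ifP => // _; last by rewrite rmorph0 normr0 mul0r.
  rewrite !norm_cqM norm_cq_real norm_cq_conj ger0_norm ?divr_ge0//.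
  by rewrite mulrAC.
have := ler_normD (cq (\sum_(j < N) h`_j.+1 * (F`_j.+1)^*))
  (cq (\sum_(j < N) (if (j < D)%N then ((j.+1%:R / N%:R : R)%:C)%C * ((x j.+1)^* * h`_j.+1) else 0))).
lra.
Qed.

Lemma cpart_mean_le (h : nat -> H) D p : `|p| <= 1 ->
  circ_mean (fun t => `|cq (\poly_(n < D) cpart (h n * p)).[cis t]|) <=
  circ_mean (fun t => `|circ_sum iH h D 1 t|).
Proof.
move=> p1; set F := \poly_(n < D) _; apply: circ_mean_le => [||t].
- exact: cts_norm_poly.
- by apply: cts_normq; exact: cts_circ_sum.
have := cq_horner_cis 1 t (size_poly D (fun n => cpart (h n * p))).
rewrite rmorph1 mul1r => ->.
have -> : circ_sum iH (fun n => cq F`_n) D 1 t = cq (cpart (circ_sum iH h D 1 t * p)).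
  rewrite circ_sumMr -circ_sum_cpart; apply: eq_bigr => n _.
  by rewrite /F coef_poly ltn_ord.
by apply: le_trans (norm_cpart _) _; rewrite normqM ler_piMr.
Qed.

Lemma BMOA_component b p : BMOA b -> `|p| <= 1 -> exists2 A : R, 0 <= A &
  forall (h : {poly C}) D, (size h <= D)%N ->
  `|cq (\sum_(n < D) (cpart (coef b n * p))^* * h`_n)| <= A * circ_mean (fun t => `|cq h.[cis t]|).
Proof.
move=> [b1 bK] p1; have ba := has_expansion_coef b1.1; set a := coef b in ba *.
have [M M0 hM] := H1_circ_mean b1 ba; have I2 := @imag_units_i R.
have bM r : 0 < r < 1 -> circ_mean (fun t => `|b (r *: expI iH t)|) <= M by exact: hM.
(* The maximum with 1 keeps the constant positive when the seminorm vanishes. *)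
pose K := Num.max 1 (fine (bmo_seminorm b)).
have K0 : 0 < K by rewrite lt_max ltr01.
have osc (u v : R) : u < v -> v - u <= 2 * pi -> exists c : H,
     (\int[mu]_(t in `[u, v]) (`|bdry b iH t - c|)%:E <= (K * (v - u))%:E)%E.
  move=> uv uv2; exists (mean b iH u v); have vu : 0 < v - u by rewrite subr_gt0.
  have h : (mean_osc b iH u v <= bmo_seminorm b)%E.
    by apply: ereal_sup_ubound; exists iH, u, v.
  have m0 : (0 <= mean_osc b iH u v)%E.
    rewrite /mean_osc mule_ge0 ?lee_fin ?invr_ge0 ?(ltW vu)//.
    by apply: integral_ge0 => t _; rewrite lee_fin.
  have fin : bmo_seminorm b \is a fin_num by rewrite ge0_fin_numE// (le_trans m0).
  have : (mean_osc b iH u v <= K%:E)%E.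
    by apply: le_trans h _; rewrite -(fineK fin) lee_fin le_max lexx orbT.
  rewrite /mean_osc => /(lee_wpmul2l (_ : 0 <= (v - u)%:E)%E) => /(_ (ltW vu)).
  by rewrite muleA -EFinM divff ?gt_eqF// mul1e -EFinM [(v - u) * K]mulrC.
pose B := `|a 0%N|.
exists (288 * (2 * K) + B); first by rewrite addr_ge0 ?normr_ge0//; lra.
move=> h D hD; apply: (complex_pairing (x := fun n => cpart (a n * p)) (K := 2 * K) (B := B) _ _ _ hD); first lra.
  by apply: le_trans (norm_cpart _) _; rewrite normqM ler_piMr.
move=> N N0 F.
have FE t : cq F.[cis t] = cq (cpart (circ_sum iH (fejer N a) N 1 t * p)).
  rewrite circ_sumMr -circ_sum_cpart.
  have := cq_horner_cis 1 t (size_poly N (fun n => (((N - n)%N%:R / N%:R : R)%:C)%C * cpart (a n * p))).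
  rewrite rmorph1 mul1r -/F => ->; apply: eq_bigr => n _.
  rewrite /F coef_poly ltn_ord /fejer; congr (_ *: (_ * _)).
  by apply: quatP => /=; ring.
have nq : `|p * Quat 0 (-1) 0 0| <= 1.
  rewrite normqM mulr_ile1//; rewrite normq_sqrtE/= -[leRHS]sqrtr1 ler_wsqrtr//.
  by rewrite !expr0n/= sqrrN expr1n !addr0 add0r.
have h1 := fejer_osc ba bM osc p1 N0; have h2 := fejer_osc ba bM osc nq N0.
split.
  rewrite (_ : (fun t => complex.Re F.[cis t]) =
    (fun t => q1 (circ_sum iH (fejer N a) N 1 t * p)))//.
  by apply/funext => t; rewrite -[LHS]/(q1 (cq F.[cis t])) FE.
rewrite (_ : (fun t => complex.Im F.[cis t]) =
  (fun t => q1 (circ_sum iH (fejer N a) N 1 t * (p * Quat 0 (-1) 0 0))))//.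
by apply/funext => t; rewrite -[LHS]/(qi (cq F.[cis t])) FE mulrA -qi_q1.
Qed.

(** Writing a = a1 + a2 j and h = h1 + h2 j, and using j z = conj(z) j, conj(a) h equals (conj(a1)
    h1 + a2 conj(h2)) + (conj(a1) h2 - a2 conj(h1)) j. These are four complex pairings, up to
    conjugation, each bounded by a component estimate. *)
Lemma BMOA_pairing b : BMOA b -> exists2 A : R, 0 <= A & forall (h : nat -> H) D,
  `|\sum_(n < D) conjq (coef b n) * h n| <= A * circ_mean (fun t => `|circ_sum iH h D 1 t|).
Proof.
move=> hb; have n1 : `|1 : H| <= 1 by rewrite normq1.
have nj : `|- jH : H| <= 1.
  by rewrite normrN normq_sqrtE/= -[leRHS]sqrtr1 ler_wsqrtr// !expr0n/= expr1n !addr0 add0r.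
have [A1 A10 h1] := BMOA_component hb n1; have [A2 A20 h2] := BMOA_component hb nj.
exists (2 * A1 + 2 * A2); first by lra.
move=> h D; set m := circ_mean _; set a := coef b.
pose X p q := \sum_(n < D) (cpart (a n * p))^* * cpart (h n * q).
have hX p q A : `|q| <= 1 -> (forall (g : {poly C}) D, (size g <= D)%N ->
    `|cq (\sum_(n < D) (cpart (a n * p))^* * g`_n)| <= A * circ_mean (fun t => `|cq g.[cis t]|)) ->
    0 <= A -> `|cq (X p q)| <= A * m.
  move=> q1' hA A0; apply: le_trans (ler_wpM2l A0 (cpart_mean_le h D q1')).
  apply: le_trans (hA _ D (size_poly _ _)); rewrite le_eqVlt; apply/orP; left; apply/eqP.
  by congr (Num.norm (cq _)); apply: eq_bigr => n _; rewrite coef_poly ltn_ord.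
have -> : \sum_(n < D) conjq (a n) * h n = (cq (X 1 1) + conjq (cq (X (- jH) (- jH)))) +
    (cq (X 1 (- jH)) - conjq (cq (X (- jH) 1))) * jH.
  rewrite /X -!cq_conj !rmorph_sum /= -big_split -sumrB mulr_suml -big_split/=.
  apply: eq_bigr => n _; rewrite !rmorphM /= !conjCK.
  by case: (a n) => ????; case: (h n) => ????; apply: quatP => /=; ring.
have j1 : `|jH| <= 1 by rewrite -normrN.
apply: le_trans (ler_normD _ _) _.
have g1 := ler_normD (cq (X 1 1)) (conjq (cq (X (- jH) (- jH)))).
have g2 := ler_normB (cq (X 1 (- jH))) (conjq (cq (X (- jH) 1))).
rewrite !norm_conjq in g1 g2.
have g3 : `|(cq (X 1 (- jH)) - conjq (cq (X (- jH) 1))) * jH| <=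
    `|cq (X 1 (- jH)) - conjq (cq (X (- jH) 1))| by rewrite normqM ler_piMr.
have k1 := hX _ _ _ n1 h1 A10; have k2 := hX _ _ _ nj h1 A10.
have k3 := hX _ _ _ n1 h2 A20; have k4 := hX _ _ _ nj h2 A20.
lra.
Qed.

End Pairing.

(** * The bounded functional on H^1 as a limit of dilated pairings *)

Section Extension.
Variable R : realType.
Local Notation H := (quat R).
Local Notation iH := (Quat 0 1 0 0 : H).
Local Notation jH := (Quat 0 0 1 0 : H).
Implicit Types (b f g : H -> H) (a : nat -> H) (r t : R).

(** Both complex components are Cauchy products of sequences whose squares sum to at most [M], so
    their coefficients are at most [M]. *)
Lemma H1_coef_bound f : in_H1 f -> exists2 M : R, 0 <= M & forall n, `|coef f n| <= M.
Proof.
move=> f1; have fa := has_expansion_coef f1.1; set a := coef f in fa *.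
have [M M0 hM] := H1_circ_mean f1 fa; have I2 := @imag_units_i R.
have nj : `|- jH : H| = 1 by rewrite normrN normq_sqrtE/= -[RHS]sqrtr1; congr Num.sqrt; ring.
have hM' r : 0 < r < 1 -> circ_mean (fun t => `|f (r *: expI iH t) * - jH|) <= M.
  by move=> r01; under [fun t => _]funext => t do rewrite normqM nj mulr1; exact: hM.
have [u [v [hu hv e1]]] := component_factor fa (fun r => hM iH r I2).
have [u' [v' [hu' hv' e2]]] := component_factor (@has_expansionMr R f a (- jH) fa) hM'.
exists (M + M) => [|n]; first exact: addr_ge0.
rewrite [a n]cpart_split; apply: le_trans (ler_normD _ _) _.
rewrite normqM -[`|jH|]normrN nj mulr1 e1 e2.
by apply: lerD; exact: cauchy_prod_bound.
Qed.

Lemma bernoulli (r : R) n : 0 <= r <= 1 -> r ^+ n * (1 + n%:R * (1 - r)) <= 1.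
Proof.
move=> /andP[r0 r1]; elim: n => [|n IH]; first by rewrite expr0 mul0r addr0 mulr1.
have h := exprn_ile1 n.+1 r0 r1; have := ler_wpM2l r0 IH.
have d0 : 0 <= 1 - r by rewrite subr_ge0.
have := ler_wpM2r d0 h; rewrite -natr1 exprS; move: (r ^+ n) (n%:R : R) => x y; nra.
Qed.

Lemma circ_sum_tail f a M N r t : has_expansion f a -> (forall n, `|a n| <= M) ->
  0 <= r < 1 -> `|f (r *: expI iH t) - circ_sum iH a N r t| <= M * (r ^+ N / (1 - r)).
Proof.
move=> fa aM r01; have I2 := @imag_units_i R; have /andP[r0 r1] := r01.
have M0 : 0 <= M by apply: le_trans (aM 0%N).
have cf := circ_sum_cvg (t := t) I2 fa r01.
have c1 : (fun K => `|circ_sum iH a K r t - circ_sum iH a N r t|) @ \oo -->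
    `|f (r *: expI iH t) - circ_sum iH a N r t|.
  by apply: cvg_norm; apply: cvgB => //; exact: cvg_cst.
apply: (ler_cvg_to c1 (@cvg_cst _ _ _ _ _)); exists N => // K /= NK.
rewrite -circ_sum_block//; apply: le_trans (ler_norm_sum _ _ _) _.
apply: le_trans (ler_wpM2l M0 (geo_tail N K r01)); rewrite mulr_sumr.
apply: ler_sum => n _; rewrite normrZ normqM normq_expI// mul1r ger0_norm ?exprn_ge0//.
by case: ifP => _; rewrite ?normr0 ?mulr0// mulrC ler_wpM2r// exprn_ge0.
Qed.

(** The pairing of [b] with the dilate of [f] at radius [rseq k], cut off to a finite sum so that it
    is linear in [f] without any convergence question. *)
Definition dilated_pairing b k f : H :=
  \sum_(n < k.+2 ^ 3) @rseq R k ^+ n *: (conjq (coef b n) * coef f n).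

(* At radius [1 - 1/(k+2)] the first [(k+2)^3] terms suffice. *)
Lemma dilated_pairing_le b (A : R) f : 0 <= A -> (forall (h : nat -> H) D,
  `|\sum_(n < D) conjq (coef b n) * h n| <= A * circ_mean (fun t => `|circ_sum iH h D 1 t|)) ->
  in_H1 f -> exists M : R, forall k,
  `|dilated_pairing b k f| <= A * (fine (H1_norm f) + M * harmonic k).
Proof.
move=> A0 hA f1; have fa := has_expansion_coef f1.1; set a := coef f in fa *.
have [M M0 hM] := H1_coef_bound f1; have I2 := @imag_units_i R; exists M => k.
have r01 := @rseq01 R k; have r01' : 0 <= @rseq R k < 1 by case/andP: r01 => h1 h2; rewrite ltW.
set N := (k.+2 ^ 3)%N; set r := @rseq R k in r01 r01' *; have /andP[r0 r1] := r01'.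
have -> : dilated_pairing b k f = \sum_(n < N) conjq (coef b n) * (r ^+ n *: a n).
  by apply: eq_bigr => n _; rewrite scalerAr.
apply: le_trans (hA (fun n => r ^+ n *: a n) N) _; apply: ler_wpM2l => //.
have cf : continuous (fun t => f (r *: expI iH t)) by exact: cts_slice I2 fa r01'.
have err t : `|f (r *: expI iH t) - circ_sum iH a N r t| <= M * harmonic k.
  apply: le_trans (circ_sum_tail N t fa hM r01') _; apply: ler_wpM2l => //.
  have r1e : 1 - r = k.+2%:R^-1 by rewrite /r /rseq subKr.
  (* Here N (1 - r) = (k+2)^2, so r^N (1 + (k+2)^2) <= 1, and the tail r^N / (1 - r) = (k+2) r^N is
     at most 1/(k+1). *)
  rewrite r1e invrK; have := bernoulli N (_ : 0 <= r <= 1); rewrite r0 (ltW r1) r1e => /(_ isT).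
  have m0 : (0 : R) < k.+2%:R by [].
  have m1 : (1 : R) <= k.+2%:R by rewrite ler1n.
  have -> : N%:R / k.+2%:R = k.+2%:R ^+ 2 :> R by rewrite /N natrX; field; rewrite gt_eqF.
  rewrite /harmonic/= -[X in _ <= X^-1]/(k.+1%:R) => hx.
  have hk : (k.+1%:R : R) <= k.+2%:R by rewrite ler_nat.
  rewrite -[leRHS]mul1r ler_pdivlMr//; have x0 := exprn_ge0 N r0.
  apply: le_trans hx; rewrite -mulrA ler_wpM2l//.
  by rewrite expr2; move: hk m0; move: (k.+1%:R : R) (k.+2%:R : R) => p q *; nra.
have mf : circ_mean (fun t => `|f (r *: expI iH t)|) <= fine (H1_norm f).
  have h : ((circ_mean (fun t => `|f (r *: expI iH t)|))%:E <= H1_norm f)%E.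
    rewrite -(circle_meanE I2 fa r01'); apply: ereal_sup_ubound => /=.
    by exists (iH, r) => //=; split=> //=; rewrite in_itv.
  have m0 : 0 <= circ_mean (fun t => `|f (r *: expI iH t)|).
    by rewrite mulr_ge0 ?itg_ge0// invr_ge0 mulr_ge0// ltW// pi_gt0.
  rewrite -lee_fin fineK// ge0_fin_numE; first exact: f1.2.
  by apply: le_trans h; rewrite lee_fin.
apply: le_trans (lerD mf (lexx (M * harmonic k))).
rewrite -[X in _ + X]circ_mean_cst -circ_meanD; last 2 first.
- exact: cts_normq.
- exact: cts_cst.
apply: circ_mean_le => [||t].
- by apply: cts_normq; exact: cts_circ_sum.
- by apply: ctsD; [exact: cts_normq|exact: cts_cst].
rewrite -circ_sum_radius -lerBlDl; apply: le_trans (lerB_dist _ _) _.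
by rewrite distrC.
Qed.

Lemma dilated_pairing_linear b k f g (c : H) : regular f -> regular g ->
  dilated_pairing b k (fun q => f q * c + g q) = dilated_pairing b k f * c + dilated_pairing b k g.
Proof.
move=> /has_expansion_coef fa /has_expansion_coef ga.
rewrite /dilated_pairing (coef_unique (has_expansionD (@has_expansionMr R f _ c fa) ga)).
rewrite mulr_suml -big_split/=; apply: eq_bigr => n _.
by rewrite -scalerAl -scalerDr mulrDr mulrA.
Qed.

Lemma has_expansion_poly (h : {poly H}) : has_expansion (poly_fun h) (fun n => h`_n).
Proof.
move=> q _; apply: cvg_near_cst; exists (size h) => // N /= hN.
rewrite /series/= big_mkord /poly_fun [RHS](big_ord_widen N (fun n => q ^+ n * h`_n))//.
rewrite [RHS]big_mkcond; apply: eq_bigr => n _; case: ltnP => // hn.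
by rewrite nth_default ?mulr0.
Qed.

Lemma dilated_pairing_poly b (h : {poly H}) :
  (fun k => dilated_pairing b k (poly_fun h)) @ \oo --> H2_pairing h b.
Proof.
have eh : coef (poly_fun h) = fun n => h`_n := coef_unique (@has_expansion_poly h).
apply: cvg_trans (_ : (fun k => \sum_(n < size h) @rseq R k ^+ n *: (conjq (coef b n) * h`_n)) @ \oo
    --> H2_pairing h b).
  apply: near_eq_cvg; exists (size h) => // k /= hk; rewrite /dilated_pairing eh.
  have hN : (size h <= k.+2 ^ 3)%N.
    by rewrite (leq_trans hk)// (leq_trans (leqW (leqnSn k)))// -{1}[k.+2]expn1 leq_exp2l.
  rewrite [LHS](big_ord_widen _ (fun n => @rseq R k ^+ n *: (conjq (coef b n) * h`_n)) hN).
  rewrite big_mkcond; apply: eq_bigr => n _; case: ltnP => // hn.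
  by rewrite nth_default ?mulr0 ?scaler0.
apply: cvg_big => [|n _]; first exact: add_continuous.
rewrite -[X in _ --> X]scale1r; apply: cvgZr_tmp.
elim: (nat_of_ord n) => [|m IH]; first by under eq_fun do rewrite expr0; exact: cvg_cst.
have hm : (fun k => @rseq R k * @rseq R k ^+ m) @ \oo --> (1 * 1 : R).
  by apply: cvgM => //; exact: rseq_cvg1.
by rewrite mulr1 in hm; under eq_fun do rewrite exprS.
Qed.

Lemma ultra_quat (G : set_system nat) (y : nat -> H) (B : R) : UltraFilter G ->
  (forall k, `|y k| <= B) -> exists l : H, y @ G --> l.
Proof.
move=> GU yB; have GP : ProperFilter G by apply: ultra_proper.
have hc (c : H -> R) : (forall q, `|c q| <= `|q|) -> exists l : R, (fun k => c (y k)) @ G --> l.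
  by move=> hc; apply: (ultra_real GU (B := B)) => k; apply: le_trans (hc _) _.
have [l1 h1] := hc (@q1 R) (fun q => let: And4 h _ _ _ := comp_le_normq q in h).
have [l2 h2] := hc (@qi R) (fun q => let: And4 _ h _ _ := comp_le_normq q in h).
have [l3 h3] := hc (@qj R) (fun q => let: And4 _ _ h _ := comp_le_normq q in h).
have [l4 h4] := hc (@qk R) (fun q => let: And4 _ _ _ h := comp_le_normq q in h).
by exists (Quat l1 l2 l3 l4); exact: quat_cvg.
Qed.

Lemma BMOA_to_functional b : BMOA b -> exists L : (H -> H) -> H,
  bounded_right_linear L /\ forall h : {poly H}, L (poly_fun h) = H2_pairing h b.
Proof.
move=> hb; have [A A0 hA] := BMOA_pairing hb.
have [G [GU hG]] := @ultraFilterLemma nat \oo _.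
have GP : ProperFilter G by apply: ultra_proper.
(* One ultrafilter serves all [f]: the bounded sequences of pairings converge along it, so the limit
   is linear on H^1, and the vanishing term M * harmonic k leaves the bound [A]. As it refines
   [\oo], polynomials receive their ordinary limit. *)
pose L f : H := lim ((fun k => dilated_pairing b k f) @ G).
have Hh := @norm_hausdorff R H.
have h1k k : 0 <= (harmonic k : R) <= 1 by rewrite harmonic_ge0 /harmonic invf_le1 ?ler1n.
have Lcvg f : in_H1 f -> (fun k => dilated_pairing b k f) @ G --> L f.
  move=> f1; have [M hM] := dilated_pairing_le A0 hA f1.
  have [|l hl] := @ultra_quat G (fun k => dilated_pairing b k f) (A * (fine (H1_norm f) + `|M|)) GU.
    move=> k; apply: le_trans (hM k) _; apply: ler_wpM2l => //; rewrite lerD2l.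
    have /andP[k0 k1] := h1k k; apply: le_trans (ler_norm _) _.
    by rewrite normrM ler_piMr// ger0_norm.
  by rewrite /L (cvg_lim Hh hl).
exists L; split; last first.
  by move=> h; apply: (cvg_lim Hh) => B hB; apply: hG; exact: dilated_pairing_poly hB.
split=> [f g c f1 g1|].
  apply: (cvg_lim Hh); rewrite (_ : (fun k => _) =
      (fun k => dilated_pairing b k f * c) + (fun k => dilated_pairing b k g)).
    by apply: cvgD; [apply: cvg_mulqr; exact: Lcvg|exact: Lcvg].
  by apply/funext => k; rewrite dilated_pairing_linear; [|exact: f1.1|exact: g1.1].
exists A => f f1; have [M hM] := dilated_pairing_le A0 hA f1.
have [r2 H0] : 0 < (2^-1 : R) < 1 /\ (0 <= H1_norm f)%E.
  have r2 : 0 < (2^-1 : R) < 1 by apply/andP; split; lra.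
  split=> //; apply: le_trans (ereal_sup_ubound _); last first.
    by exists (iH, 2^-1) => //=; split; [exact: imag_units_i|rewrite /= in_itv].
  rewrite /circle_mean mule_ge0//; last by apply: integral_ge0 => t _; rewrite lee_fin.
  by rewrite lee_fin invr_ge0 mulr_ge0// pi_ge0.
have fin : H1_norm f \is a fin_num by rewrite ge0_fin_numE//; exact: f1.2.
rewrite -(fineK fin) -EFinM lee_fin.
have c1 : (fun k => `|dilated_pairing b k f|) @ G --> `|L f| by apply: cvg_norm; exact: Lcvg.
have c2 : (fun k => A * (fine (H1_norm f) + M * harmonic k)) @ G --> A * fine (H1_norm f).
  apply: cvg_trans (_ : (fun k => A * (fine (H1_norm f) + M * harmonic k)) @ \oo --> A * fine (H1_norm f)).
    by move=> B hB; apply: hG.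
  rewrite -[X in _ --> A * X]addr0 -[X in _ + X](mulr0 M).
  apply: cvgM; first exact: cvg_cst.
  by apply: cvgD; [exact: cvg_cst|apply: cvgM; [exact: cvg_cst|exact: cvg_harmonic]].
by apply: (ler_cvg_to c1 c2); apply: filterE.
Qed.

End Extension.

Theorem theorem5p6 (R : realType) :
  (forall b : quat R -> quat R, BMOA b ->
     exists L : (quat R -> quat R) -> quat R,
       bounded_right_linear L /\
       forall h : {poly quat R}, L (poly_fun h) = H2_pairing h b) /\
  (forall L : (quat R -> quat R) -> quat R, bounded_right_linear L ->
     exists b : quat R -> quat R,
       BMOA b /\
       forall h : {poly quat R}, L (poly_fun h) = H2_pairing h b).
Proof. by split; [exact: BMOA_to_functional|exact: functional_to_BMOA]. Qed.
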